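(* For each $k\ge1$, the rule $$D_k\widetilde h_m=\frac{\widetilde h_{m+k}-\widetilde h_m\,\widetilde h_k}{q^k-1}\qquad(m\ge1)$$ defines a ($\mathbb Q(q)$-linear) derivation $D_k$ of the ring $\Lambda_{\mathbb Q(q)}$, and on symmetric functions of positive degree one has $$\Theta_{p_k}\big|_{t=1}=D_k ,$$ i.e. for every $g\in\Lambda^+_{\mathbb Q(q)}$ the element $\Theta_{p_k}g$ is regular at $t=1$ and $(\Theta_{p_k}g)|_{t=1}=D_k g$. Moreover the derivations $D_k$ pairwise commute: $D_jD_k=D_kD_j$ for all $j,k\ge1$.
   Context: Symmetric functions. $\Lambda$ is the ring of symmetric functions in $x_1,x_2,\dots$ over $\mathbb Q(q,t)$; $\Lambda_{\mathbb Q(q)}\subset\Lambda$ is the ring of symmetric functions over $\mathbb Q(q)$, so $\Lambda=\Lambda_{\mathbb Q(q)}\otimes_{\mathbb Q(q)}\mathbb Q(q,t)$. $\Lambda^+$ and $\Lambda^+_{\mathbb Q(q)}$ are the spans of the homogeneous elements of positive degree. $p_k,h_k,s_\lambda$ denote power sum, complete homogeneous and Schur functions. Row functions. Put $(q;q)_n=\prod_{i=1}^n(1-q^i)$. For $n\ge0$, $\widetilde h_n=(q;q)_n\,h_n[X/(1-q)]\in\Lambda_{\mathbb Q(q)}$, where $f\mapsto f[X/(1-q)]$ is the algebra homomorphism (fixing scalars) with $p_r\mapsto p_r/(1-q^r)$; $\widetilde h_0=1$. The $\widetilde h_m$, $m\ge1$, freely generate $\Lambda_{\mathbb Q(q)}$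 as a $\mathbb Q(q)$-algebra. Modified Macdonald basis. $\{\widetilde H_\mu\}$, $\mu$ ranging over partitions, is the modified Macdonald basis of $\Lambda$: the unique basis such that, for $\mu\vdash n$, (i) $\widetilde H_\mu[X(1-q)]\in\mathrm{span}\{s_\lambda:\lambda\ge\mu\}$, (ii) $\widetilde H_\mu[X(1-t)]\in\mathrm{span}\{s_\lambda:\lambda\ge\mu'\}$, (iii) the coefficient of $s_{(n)}$ in $\widetilde H_\mu$ is $1$. Here $\ge$ is dominance order, $\mu'$ the conjugate, and $f\mapsto f[X(1-q)]$ is the scalar-fixing algebra map $p_r\mapsto(1-q^r)p_r$ (similarly for $t$). One has $\widetilde H_{(n)}=\widetilde h_n$. Theta operators. For a partition $\mu$, $\Pi_\mu=\prod_{c\neq(0,0)}(1-q^{a'(c)}t^{l'(c)})$, the product over the cells $c$ of the diagram of $\mu$ other than the corner cell, where $a'(c)$ (coarm) is the number of cells strictly before $c$ in its row and $l'(c)$ (coleg) is the number of cells in its column lying in earlier rows (row $j$ has $\mu_j$ cells). Let $\boldsymbol\Pi$ be the linear operator on $\Lambda$ with $\boldsymbol\Pi\widetilde H_\mu=\Pi_\mu\widetilde H_\mu$. For $f\in\Lambda$ let $f^\ast=f[X/M]$, $M=(1-q)(1-t)$, be the image of $f$ under the scalar-fixing algebra map $p_r\mapsto p_r/((1-q^r)(1-t^r))$. The Theta operator is $\Theta_f=\boldsymbol\Pi\circ(\text{multiplication by }f^\ast)\circ\boldsymbol\Pi^{-1}$ on $\Lambda$. Specialization. An element of $\Lambda$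 is regular at $t=1$ if its coefficients in a basis of $\Lambda_{\mathbb Q(q)}$ (equivalently any such basis) have no pole at $t=1$, as rational functions of $t$ over $\mathbb Q(q)$; evaluating the coefficients at $t=1$ gives its specialization $|_{t=1}\in\Lambda_{\mathbb Q(q)}$. *)

(* Defs.v *)
From HB Require Import structures.
From mathcomp Require Import all_boot all_order all_algebra.
From mathcomp Require Import fingroup perm fraction.
From mathcomp Require Import mpoly.
From mathcomp Require Import boolp.

Set Implicit Arguments.
Unset Strict Implicit.
Unset Printing Implicit Defensive.

Import GRing.Theory.
Local Open Scope ring_scope.

(* The ring of symmetric functions in infinitely many variables is taken as   *)
(* the inverse limit, in the category of graded rings, of the rings of        *)
(* symmetric polynomials in n variables: an element is a sequence of          *)
(* symmetric polynomials f_n(x_1, ..., x_n) of bounded degree such that       *)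
(* f_(n+1)(x_1, ..., x_n, 0) = f_n(x_1, ..., x_n).                            *)

Definition restrict_last (K : comNzRingType) (n : nat) (p : {mpoly K[n.+1]}) :
    {mpoly K[n]} :=
  p \mPo [tuple oapp (fun j : 'I_n => 'X_j) 0 (unlift ord_max i) | i < n.+1].

Definition is_symfun (K : comNzRingType) (f : forall n, {mpoly K[n]}) : Prop :=
  [/\ forall n, f n \is symmetric,
      forall n, restrict_last (f n.+1) = f n
    & exists d, forall n, (msize (f n) <= d)%N].

Record symfun (K : comNzRingType) : Type := SymFun {
  symfun_val :> forall n, {mpoly K[n]};
  symfunP : is_symfun symfun_val }.

Section RestrictLast.
Variables (K : comNzRingType) (n : nat).
Implicit Types p q : {mpoly K[n.+1]}.

Lemma restrict_last0 : restrict_last (0 : {mpoly K[n.+1]}) = 0.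
Proof. exact: comp_mpoly0. Qed.

Lemma restrict_last1 : restrict_last (1 : {mpoly K[n.+1]}) = 1.
Proof. exact: comp_mpoly1. Qed.

Lemma restrict_lastD p q :
  restrict_last (p + q) = restrict_last p + restrict_last q.
Proof. exact: comp_mpolyD. Qed.

Lemma restrict_lastN p : restrict_last (- p) = - restrict_last p.
Proof. exact: comp_mpolyN. Qed.

Lemma restrict_lastM p q :
  restrict_last (p * q) = restrict_last p * restrict_last q.
Proof. exact: rmorphM. Qed.

Lemma restrict_lastZ c p : restrict_last (c *: p) = c *: restrict_last p.
Proof. exact: comp_mpolyZ. Qed.

Lemma restrict_last_sum I (r : seq I) (P : pred I) (F : I -> {mpoly K[n.+1]}) :
  restrict_last (\sum_(i <- r | P i) F i) =
  \sum_(i <- r | P i) restrict_last (F i).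
Proof. exact: raddf_sum. Qed.

Lemma restrict_lastX (m : 'X_{1..n.+1}) :
  restrict_last 'X_[K, m] =
  if m ord_max == 0%N then 'X_[[multinom m (lift ord_max i) | i < n]] else 0.
Proof.
rewrite /restrict_last comp_mpolyX big_ord_recr /= tnth_mktuple unlift_none /=.
case: eqP => [->|/eqP nz]; last by rewrite expr0n (negPf nz) mulr0.
rewrite expr0 mulr1 mpolyXE_id; apply: eq_bigr => i _.
have -> : widen_ord (leqnSn n) i = lift ord_max i.
  by apply: ord_inj; rewrite lift_max.
by rewrite tnth_mktuple liftK mnmE.
Qed.

Lemma mcoeff_restrict_last p (m : 'X_{1..n}) :
  (restrict_last p)@_m = p@_(mnmwiden m).
Proof.
have wE (u : 'X_{1..n}) i : mnmwiden u (lift ord_max i) = u i.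
  rewrite -(mnmwiden_widen u i); congr (mnmwiden u _).
  by apply: ord_inj; rewrite lift_max.
rewrite {1 2}[p]mpolyE restrict_last_sum !raddf_sum /=.
apply: eq_bigr => u _; rewrite restrict_lastZ !mcoeffZ; congr (_ * _).
rewrite restrict_lastX mcoeffX; case: eqP => [u0|nz].
  rewrite mcoeffX; congr (nat_of_bool _)%:R; apply/eqP/eqP => [<-|->].
    apply/mnmP => i; case: (unliftP ord_max i) => [j|] ->.
      by rewrite wE mnmE.
    by rewrite mnmwiden_ordmax.
  by apply/mnmP => i; rewrite mnmE wE.
rewrite mcoeff0; case: eqP => // eu; case: nz.
by rewrite eu mnmwiden_ordmax.
Qed.

End RestrictLast.

Section SymFunRing.
Variable K : comNzRingType.
Implicit Types f g h : symfun K.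

Lemma symfun_eq f g : (forall n, f n = g n) -> f = g.
Proof.
case: f g => [f Pf] [g Pg] /= fg.
have {}fg : f = g by apply: functional_extensionality_dep.
by case: _ / fg Pg => Pg; congr SymFun; apply: Prop_irrelevance.
Qed.

HB.instance Definition _ := gen_eqMixin (symfun K).
HB.instance Definition _ := gen_choiceMixin (symfun K).

Fact symfun0_subproof : @is_symfun K (fun n => 0).
Proof.
split=> [n|n|]; [exact: rpred0 | exact: restrict_last0 | exists 0%N => n].
by rewrite msize0.
Qed.

Fact symfun1_subproof : @is_symfun K (fun n => 1).
Proof.
split=> [n|n|]; [by apply/issymP => s; exact: msym1 | exact: restrict_last1 | exists 1%N => n].
by rewrite msize1.
Qed.

Fact symfunD_subproof f g : is_symfun (fun n => f n + g n).
Proof.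
case: f g => [f [/= fS fR [d fd]]] [g [/= gS gR [e ge]]].
split=> [n|n|]; [exact: rpredD (fS n) (gS n) | by rewrite restrict_lastD fR gR |].
exists (maxn d e) => n; apply: leq_trans (msizeD_le _ _) _.
by rewrite geq_max !leq_max fd ge orbT.
Qed.

Fact symfunN_subproof f : is_symfun (fun n => - f n).
Proof.
case: f => [f [/= fS fR [d fd]]].
split=> [n|n|]; [by rewrite rpredN; exact: fS | by rewrite restrict_lastN fR |].
by exists d => n; rewrite msizeN.
Qed.

Fact symfunM_subproof f g : is_symfun (fun n => f n * g n).
Proof.
case: f g => [f [/= fS fR [d fd]]] [g [/= gS gR [e ge]]].
split=> [n|n|]; [apply/issymP => s | by rewrite restrict_lastM fR gR |].
  by rewrite msymM (issymP _ (fS n)) (issymP _ (gS n)).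
exists (d + e).+1 => n; apply: leq_trans (msizeM_le _ _) _.
by rewrite ltnS leq_add.
Qed.

Fact symfunZ_subproof (c : K) f : is_symfun (fun n => c *: f n).
Proof.
case: f => [f [/= fS fR [d fd]]].
split=> [n|n|]; [by apply: rpredZ; exact: fS | by rewrite restrict_lastZ fR |].
by exists d => n; apply: leq_trans (msizeZ_le _ _) (fd n).
Qed.

Definition symfun0 : symfun K := SymFun symfun0_subproof.
Definition symfun1 : symfun K := SymFun symfun1_subproof.
Definition symfun_add f g : symfun K := SymFun (symfunD_subproof f g).
Definition symfun_opp f : symfun K := SymFun (symfunN_subproof f).
Definition symfun_mul f g : symfun K := SymFun (symfunM_subproof f g).
Definition symfun_scale c f : symfun K := SymFun (symfunZ_subproof c f).

Fact symfun_addA : associative symfun_add.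
Proof. by move=> f g h; apply: symfun_eq => n /=; rewrite addrA. Qed.
Fact symfun_addC : commutative symfun_add.
Proof. by move=> f g; apply: symfun_eq => n /=; rewrite addrC. Qed.
Fact symfun_add0 : left_id symfun0 symfun_add.
Proof. by move=> f; apply: symfun_eq => n /=; rewrite add0r. Qed.
Fact symfun_addN : left_inverse symfun0 symfun_opp symfun_add.
Proof. by move=> f; apply: symfun_eq => n /=; rewrite addNr. Qed.

HB.instance Definition _ := GRing.isZmodule.Build (symfun K)
  symfun_addA symfun_addC symfun_add0 symfun_addN.

Fact symfun_mulA : associative symfun_mul.
Proof. by move=> f g h; apply: symfun_eq => n /=; rewrite mulrA. Qed.
Fact symfun_mulC : commutative symfun_mul.
Proof. by move=> f g; apply: symfun_eq => n /=; rewrite mulrC. Qed.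
Fact symfun_mul1 : left_id symfun1 symfun_mul.
Proof. by move=> f; apply: symfun_eq => n /=; rewrite mul1r. Qed.
Fact symfun_mulDl : left_distributive symfun_mul symfun_add.
Proof. by move=> f g h; apply: symfun_eq => n /=; rewrite mulrDl. Qed.
Fact symfun_1neq0 : symfun1 != 0.
Proof.
apply/eqP => /(congr1 (fun f : symfun K => f 0)) /= /eqP.
by rewrite oner_eq0.
Qed.

HB.instance Definition _ := GRing.Zmodule_isComNzRing.Build (symfun K)
  symfun_mulA symfun_mulC symfun_mul1 symfun_mulDl symfun_1neq0.

Fact symfun_scaleA a b f :
  symfun_scale a (symfun_scale b f) = symfun_scale (a * b) f.
Proof. by apply: symfun_eq => n /=; rewrite scalerA. Qed.
Fact symfun_scale1 : left_id 1 symfun_scale.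
Proof. by move=> f; apply: symfun_eq => n /=; rewrite scale1r. Qed.
Fact symfun_scaleDr : right_distributive symfun_scale +%R.
Proof. by move=> c f g; apply: symfun_eq => n /=; rewrite scalerDr. Qed.
Fact symfun_scaleDl f : {morph symfun_scale^~ f : a b / a + b}.
Proof. by move=> a b; apply: symfun_eq => n /=; rewrite scalerDl. Qed.

HB.instance Definition _ := GRing.Zmodule_isLmodule.Build K (symfun K)
  symfun_scaleA symfun_scale1 symfun_scaleDr symfun_scaleDl.

Fact symfun_scaleAl c f g : c *: (f * g) = c *: f * g.
Proof. by apply: symfun_eq => n /=; rewrite scalerAl. Qed.

HB.instance Definition _ :=
  GRing.Lmodule_isLalgebra.Build K (symfun K) symfun_scaleAl.

Fact symfun_scaleAr c f g : c *: (f * g) = f * (c *: g).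
Proof. by apply: symfun_eq => n /=; rewrite scalerAr. Qed.

HB.instance Definition _ :=
  GRing.Lalgebra_isAlgebra.Build K (symfun K) symfun_scaleAr.

End SymFunRing.

Section ChangeScalars.
Variables (K L : comNzRingType) (phi : {rmorphism K -> L}).

Fact symfun_map_subproof (f : symfun K) :
  is_symfun (fun n => map_mpoly phi (f n)).
Proof.
case: f => [f [/= fS fR [d fd]]]; split=> [n|n|].
- apply/issymP => s; apply/mpolyP => m.
  by rewrite mcoeff_sym !mcoeff_map_mpoly -mcoeff_sym (issymP _ (fS n)).
- apply/mpolyP => m.
  by rewrite mcoeff_restrict_last !mcoeff_map_mpoly -mcoeff_restrict_last fR.
exists d => n; rewrite msizeE; apply/bigmax_leqP_seq => m m_supp _.
apply: leq_trans (fd n); apply: msize_mdeg_lt; move: m_supp.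
rewrite !mcoeff_msupp mcoeff_map_mpoly; apply: contra_neq => ->.
exact: rmorph0.
Qed.

Definition symfun_map (f : symfun K) : symfun L :=
  SymFun (symfun_map_subproof f).

End ChangeScalars.

Section ClassicalFunctions.
Variable K : comNzRingType.

Definition hsum (d n : nat) : {mpoly K[n]} :=
  \sum_(m : 'X_{1..n < d.+1} | mdeg m == d) 'X_[m].

Lemma mcoeff_hsum d n (m : 'X_{1..n}) : (hsum d n)@_m = (mdeg m == d)%:R.
Proof.
rewrite /hsum raddf_sum /=; case: (eqVneq (mdeg m) d) => [md|nmd].
  have mlt : (mdeg m < d.+1)%N by rewrite md.
  rewrite (bigD1 (BMultinom mlt)) /= ?md ?eqxx // mcoeffX eqxx big1 ?addr0 //.
  move=> u /andP[_ nu]; rewrite mcoeffX; case: eqP => // eu.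
  by case/eqP: nu; apply: val_inj.
rewrite big1 // => u /eqP ud; rewrite mcoeffX; case: eqP => // eu.
by case/eqP: nmd; rewrite -eu.
Qed.

Fact hfun_subproof d : is_symfun (hsum d).
Proof.
split=> [n|n|].
- apply/issymP => s; apply/mpolyP => m.
  by rewrite mcoeff_sym !mcoeff_hsum mdeg_mperm.
- apply/mpolyP => m; rewrite mcoeff_restrict_last !mcoeff_hsum; congr (_ == _)%:R.
  rewrite !mdegE big_ord_recr /= mnmwiden_ordmax addn0.
  by apply: eq_bigr => i _; rewrite mnmwiden_widen.
exists d.+1 => n; rewrite msizeE; apply/bigmax_leqP_seq => m + _.
by rewrite mcoeff_msupp mcoeff_hsum; case: (eqVneq (mdeg m) d) => [->|]; rewrite ?eqxx.
Qed.

Definition hfun (d : nat) : symfun K := SymFun (hfun_subproof d).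

(* The sum of the x_i^r is stable in the number of variables only for r > 0;  *)
(* the value at r = 0 is the conventional p_0 = 1.                            *)
Definition psum (r n : nat) : {mpoly K[n]} :=
  if r is 0%N then 1 else \sum_(i < n) 'X_i ^+ r.

Fact pfun_subproof r : is_symfun (psum r).
Proof.
case: r => [|r]; first exact: symfun1_subproof.
split=> [n|n|] /=.
- apply/issymP => s; rewrite raddf_sum /= [RHS](reindex_inj (@perm_inj _ s)) /=.
  by apply: eq_bigr => i _; rewrite rmorphXn /= /msym mmapX mmap1U.
- rewrite restrict_last_sum big_ord_recr /=.
  rewrite [X in _ + X](_ : _ = 0) ?addr0; last first.
    by rewrite /restrict_last rmorphXn /= comp_mpolyXU -tnth_nth tnth_mktuple
      unlift_none /= expr0n.
  apply: eq_bigr => i _; rewrite /restrict_last rmorphXn /= comp_mpolyXU.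
  rewrite -tnth_nth tnth_mktuple.
  have -> : widen_ord (leqnSn n) i = lift ord_max i.
    by apply: ord_inj; rewrite lift_max.
  by rewrite liftK.
exists r.+2 => n; apply: leq_trans (msize_sum _ _ _) _.
by apply/bigmax_leqP => i _; rewrite mpolyXn msizeX mdegMn mdeg1 mul1n.
Qed.

Definition pfun (r : nat) : symfun K := SymFun (pfun_subproof r).

(* Jacobi-Trudi: the (i, j) entry is h_(la_i - i + j), with h_r = 0 for r < 0. *)
Definition schur (la : seq nat) : symfun K :=
  \det (\matrix_(i < size la, j < size la)
    if (i <= nth 0 la i + j)%N then hfun (nth 0 la i + j - i)%N else 0).

Definition homogeneous (d : nat) (f : symfun K) : Prop :=
  forall n, f n \is d.-homog.

End ClassicalFunctions.

Section LinearAlgebra.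
Variables (K : nzRingType) (V : lmodType K).

Definition in_span (S : V -> Prop) (v : V) : Prop :=
  exists s : seq (K * V),
    (forall x, x \in s -> S x.2) /\ v = \sum_(x <- s) x.1 *: x.2.

Definition has_coords (I : eqType) (b : I -> V) (v : V) (c : I -> K) : Prop :=
  exists s : seq I,
    [/\ uniq s, forall i, i \notin s -> c i = 0 & v = \sum_(i <- s) c i *: b i].

Definition is_basis (I : eqType) (b : I -> V) : Prop :=
  forall v, (exists c, has_coords b v c) /\
    (forall c c', has_coords b v c -> has_coords b v c' -> c =1 c').

End LinearAlgebra.

Definition positive_degree (K : comNzRingType) (f : symfun K) : Prop :=
  in_span (fun g => exists2 d, (0 < d)%N & homogeneous d g) f.

(* The algebra endomorphism with p_r |-> c_r p_r for r > 0. Over a field of   *)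
(* characteristic 0 the p_r freely generate the ring of symmetric functions,  *)
(* so it exists and is unique; the identity branch is then never taken.       *)
Definition plethysm (K : fieldType) (c : nat -> K) :
    {lrmorphism symfun K -> symfun K} :=
  match pselect (exists phi : {lrmorphism symfun K -> symfun K},
                   forall r, (0 < r)%N -> phi (pfun K r) = c r *: pfun K r) with
  | left ex_phi => sval (cid ex_phi)
  | right _ => idfun
  end.

Definition is_part (la : seq nat) : bool := sorted geq la && (0%N \notin la).

Definition intpart : Type := {la : seq nat | is_part la}.
HB.instance Definition _ := Countable.on intpart.

Fact row_part_subproof n : is_part (nseq (0 < n) n).
Proof. by case: n. Qed.

(* The partition (n), which is empty for n = 0.                               *)
Definition row_part (n : nat) : intpart :=
  exist (fun la => is_true (is_part la)) _ (row_part_subproof n).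

Definition conj_part (la : seq nat) : seq nat :=
  [seq count (fun m => (j < m)%N) la | j <- iota 0 (head 0%N la)].

(* la >= mu in dominance order.                                               *)
Definition dominates (la mu : seq nat) : Prop :=
  sumn la = sumn mu /\
  forall k, (sumn (take k mu) <= sumn (take k la))%N.

Notation Qq := {fraction {poly rat}}.
(* Q(q, t) is built as the field of fractions of Q(q)[t].                     *)
Notation Qqt := {fraction {poly Qq}}.

Definition qvar : Qq := tofrac 'X.
Definition tvar : Qqt := tofrac 'X.

Definition scalar_incl : {rmorphism Qq -> Qqt} := (@tofrac {poly Qq}) \o polyC.
Definition qtvar : Qqt := scalar_incl qvar.

Notation LambdaQq := (symfun Qq).
Notation LambdaQqt := (symfun Qqt).

Definition Lambda_incl : LambdaQq -> LambdaQqt := symfun_map scalar_incl.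

Definition qpoch (n : nat) : Qq := \prod_(1 <= i < n.+1) (1 - qvar ^+ i).

Definition htilde (n : nat) : LambdaQq :=
  qpoch n *: plethysm (fun r => (1 - qvar ^+ r)^-1) (hfun Qq n).

Definition is_modified_Macdonald (H : intpart -> LambdaQqt) : Prop :=
  is_basis H /\ forall mu : intpart,
  [/\ in_span
        (fun f => exists2 la : intpart,
           dominates (val la) (val mu) & f = schur Qqt (val la))
        (plethysm (fun r => 1 - qtvar ^+ r) (H mu)),
      in_span
        (fun f => exists2 la : intpart,
           dominates (val la) (conj_part (val mu)) & f = schur Qqt (val la))
        (plethysm (fun r => 1 - tvar ^+ r) (H mu))
    & exists2 c, has_coords (fun la : intpart => schur Qqt (val la)) (H mu) c &
        c (row_part (sumn (val mu))) = 1].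

(* The cell in row j and column i (both counted from 0) has coarm i and       *)
(* coleg j.                                                                   *)
Definition Pi_coef (mu : seq nat) : Qqt :=
  \prod_(j < size mu) \prod_(i < nth 0%N mu j | (i != 0 :> nat)%N || (j != 0 :> nat)%N)
    (1 - qtvar ^+ i * tvar ^+ j).

Definition star (f : LambdaQqt) : LambdaQqt :=
  plethysm (fun r => ((1 - qtvar ^+ r) * (1 - tvar ^+ r))^-1) f.

Definition Theta (Pi Pi_inv : LambdaQqt -> LambdaQqt) (f g : LambdaQqt) :
    LambdaQqt :=
  Pi (star f * Pi_inv g).

(* c has no pole at t = 1, and its value there is v.                          *)
Definition scalar_at_t1 (c : Qqt) (v : Qq) : Prop :=
  exists a b : {poly Qq},
    [/\ b.[1] != 0, c = tofrac a / tofrac b & v = a.[1] / b.[1]].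

(* F is regular at t = 1, with specialization G: in a basis of LambdaQq, the  *)
(* coefficients of F are regular at t = 1 and their values there are the      *)
(* coefficients of G.                                                         *)
Definition specializes_at_t1 (F : LambdaQqt) (G : LambdaQq) : Prop :=
  exists (I : eqType) (b : I -> LambdaQq) (c : I -> Qqt) (v : I -> Qq),
  [/\ is_basis b, has_coords (fun i => Lambda_incl (b i)) F c,
      forall i, scalar_at_t1 (c i) (v i) & has_coords b G v].

Definition is_derivation (D : LambdaQq -> LambdaQq) : Prop :=
  forall f g, D (f * g) = D f * g + f * D g.

Definition row_rule (k : nat) (D : LambdaQq -> LambdaQq) : Prop :=
  forall m, (0 < m)%N ->
    D (htilde m) = (qvar ^+ k - 1)^-1 *: (htilde (m + k) - htilde m * htilde k).

(* Main.v *)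
Require Import Defs.
From HB Require Import structures.
From mathcomp Require Import all_boot all_order all_algebra.
From mathcomp Require Import fingroup perm fraction mpoly boolp.
From mathcomp Require Import ring zify.

(** Both sides are computed on bases of eigenvectors of one operator, followed
down to t = 1.

Let D be the Macdonald operator f |-> f[X + (1 - q)(1 - t)/z] Exp[- z X] at z^0.
After X |-> X (1 - q) it acts on a Schur function by weighting the terms of the
Jacobi-Trudi determinant ([macop_schur]), hence triangularly for dominance, and
some polynomial in D kills the functions allowed by the first condition on the
modified Macdonald basis. As D is symmetric in q and t, the second condition
gives another such polynomial, and the only root that the two share is the
eigenvalue attached to mu. So H_mu is an eigenvector of D
([macdonald_eigen]), for the eigenvalue 1 - (1 - t) sum_i t^i (1 - q^(mu_i)).

The eigenvalues of N = (1 - D)/(1 - t) ([mac_lap]) tend at t = 1 to the numbers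
sum_i (1 - q^(mu_i)), which are still pairwise distinct. Lagrange interpolation in
N therefore projects to the line of H_mu without a pole at t = 1. This is used in
two algebras over the scalars that are regular at t = 1, each with a reduction to
the symmetric functions over Q(q) ([spec]); both are stable under N.

- Reduction A. The algebra is generated by the h~_m/(1 - t), and h~_m/(1 - t) is
  sent to - (q;q)_(m-1) p_m. Then N reduces to sum_i (1 - T_(q, x_i))
  ([specA_lap]), whose eigenvectors are the augmented monomial functions, and
  p_k[X/M] reduces to - p_k/(1 - q^k) ([specA_star]).
- Reduction L. The algebra is generated by the h~_m, and h~_m is sent to itself:
  this is the specialization of the theorem. Then N reduces to the derivation
  h~_m |-> (1 - q^m) h~_m ([specL_lap]), whose eigenvectors are the products h~_mu.

The same multiple of H_mu reduces under A to the augmented monomial function m~_mu,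
up to a scalar, and under L, once multiplied by (1 - t)^l with l the length of mu,
to h~_mu ([eig_ex]). Since Pi_mu is (1 - t)^(l - 1) times a unit with a
known value at t = 1 ([at1_Pi]), the operator (1 - t) Pi carries reduction A to
reduction L, and m~_mu to (-1)^l (l - 1)! h~_mu ([specL_Pi_aug]). Through this
dictionary Theta_(p_k) becomes the multiplication of m~_mu by p_k, that is

  p_k m~_mu = m~_(k, mu) + the sum over i of m~ of mu with mu_i raised by k,

which translates into the value of D_k on h~_mu ([specL_Theta_eig]): the coefficient
- l of h~_k h~_mu is the quotient of the two factorials.

This settles the multiple of H_mu that reduces to h~_mu. The difference between it and
h~_mu reduces to 0; its coefficients on the eigenvectors vanish at t = 1, so its
image under Theta reduces to 0 too ([specL_Theta_small]). The empty partition is an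
exception to the order of vanishing of Pi_mu, but it only carries the constant term,
which is why the theorem is about positive degree.

That the D_k exist, are unique and commute is checked on the h~_m, which generate
freely ([htilde_free], [derivation_ex], [rowD_comm]). Freeness, like the existence of
all plethysms, comes from the universal property of the power sums ([symeval]), which
in turn rests on the fact that augmented monomial functions are eigenvectors for
distinct eigenvalues ([aug_class_sum]). *)

Set Implicit Arguments.
Unset Strict Implicit.
Unset Printing Implicit Defensive.
Import GRing.Theory.
Local Open Scope ring_scope.

(** Newton's identities: the generating function of [a] is exp of the sum of the
P_r z^r / r over r > 0. *)
Definition newton (B : comNzRingType) (P a : nat -> B) : Prop :=
  a 0%N = 1 /\
  forall n, a n.+1 *+ n.+1 = \sum_(i < n.+1) P i.+1 * a (n - i)%N.

Definition conv (B : comNzRingType) (a b : nat -> B) (n : nat) : B :=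
  \sum_(i < n.+1) a i * b (n - i)%N.

Definition torsion_free (B : nmodType) : Prop :=
  forall n (x : B), x *+ n.+1 = 0 -> x = 0.

Section Newton.
Variable B : comNzRingType.
Implicit Types (P Q a b : nat -> B).

(** Truncated generating functions are polynomials, whose product is at hand. *)
Definition trunc N a : {poly B} := \poly_(i < N.+1) a i.

Lemma coef_trunc N a i : (i <= N)%N -> (trunc N a)`_i = a i.
Proof. by move=> le; rewrite coef_poly ltnS le. Qed.

Lemma coef_truncM N a b n :
  (n <= N)%N -> (trunc N a * trunc N b)`_n = conv a b n.
Proof.
move=> nN; rewrite coefM; apply: eq_bigr => i _.
have := ltn_ord i; rewrite ltnS => iN.
by rewrite !coef_trunc ?(leq_trans (leq_subr _ _)) ?(leq_trans iN).
Qed.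

Definition zero_at0 P (n : nat) : B := if n is 0%N then 0 else P n.

Lemma newton_conv P a : newton P a <->
  a 0%N = 1 /\ forall n, a n *+ n = conv (zero_at0 P) a n.
Proof.
split=> -[a0 aP]; split=> // n.
  case: n => [|n]; first by rewrite /conv big_ord1 /= mul0r.
  by rewrite aP /conv [RHS]big_ord_recl /= mul0r add0r.
by rewrite aP /conv [LHS]big_ord_recl /= mul0r add0r.
Qed.

(** For the generating functions, [newton P a] says that z A' = P A, where P starts
in degree 1; the rule for products is the Leibniz rule for z (A B)'. *)
Lemma newton_prod P Q a b :
  newton P a -> newton Q b -> newton (fun n => P n + Q n) (conv a b).
Proof.
rewrite !newton_conv => -[a0 aP] [b0 bQ]; split.
  by rewrite /conv big_ord1 a0 b0 mulr1.
move=> n; pose A := trunc n a; pose C := trunc n b.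
pose U := trunc n (zero_at0 P); pose V := trunc n (zero_at0 Q).
have dE u (W : {poly B}) v : (forall i, v i *+ i = u i) -> forall i, (i <= n)%N ->
    (trunc n v)`_i *+ i = u i.
  by move=> e i le; rewrite coef_trunc // e.
(* The Leibniz rule, with n = i + (n - i) in the term of index i. *)
have lhs : conv a b n *+ n = ((U * A) * C)`_n + ((V * C) * A)`_n.
  rewrite -(coef_truncM a b (leqnn n)) -/A -/C !coefM -sumrMnl.
  rewrite (eq_bigr (fun i : 'I_n.+1 =>
     (A`_i *+ i) * C`_(n - i) + A`_i * (C`_(n - i) *+ (n - i)))); last first.
    move=> i _; have := ltn_ord i; rewrite ltnS => le.
    by rewrite mulrnAl mulrnAr -mulrnDr subnKC.
  rewrite big_split /=; congr (_ + _).
    apply: eq_bigr => i _; have := ltn_ord i; rewrite ltnS => le.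
    by rewrite coef_truncM // -aP coef_trunc.
  rewrite (reindex_inj rev_ord_inj) /=; apply: eq_bigr => i _.
  have := ltn_ord i; rewrite ltnS => le; rewrite subSS subKn // mulrC.
  by rewrite coef_truncM // -bQ [C`_i]coef_trunc.
rewrite lhs mulrAC -[V * C * A]mulrA [C * A]mulrC -[U * C * A]mulrA.
rewrite [C * A]mulrC -coefD -mulrDl !coefM; apply: eq_bigr => i _.
have := ltn_ord i; rewrite ltnS => le; congr (_ * _).
  by rewrite coefD !coef_trunc //; case: (nat_of_ord i) => //=; rewrite addr0.
by rewrite coef_truncM ?leq_subr.
Qed.

Lemma newton_uniq P Q a b : torsion_free B ->
  newton P a -> newton Q b -> (forall n, P n.+1 = Q n.+1) -> a =1 b.
Proof.
move=> tf [a0 aP] [b0 bQ] PQ n; elim/ltn_ind: n => -[|n] IH; first by rewrite a0 b0.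
apply/eqP; rewrite -subr_eq0; apply/eqP; apply: (tf n).
rewrite mulrnBl aP bQ; apply/eqP; rewrite subr_eq0; apply/eqP.
by apply: eq_bigr => i _; rewrite PQ IH // ltnS leq_subr.
Qed.

(** The identities are solved for P_1, P_2, ... one after the other, no division
being needed. *)
Lemma newton_ex a : a 0%N = 1 -> exists P, newton P a.
Proof.
move=> a0.
(* Append P_(n+1) to the list [l] of P_1, ..., P_n. *)
pose step (l : seq B) := let n := size l in
  rcons l (a n.+1 *+ n.+1 - \sum_(i < n) nth 0 l i * a (n - i)%N).
pose L n := iter n step [::].
have szL n : size (L n) = n by elim: n => // n IH; rewrite /= size_rcons IH.
have nthL n m i : (i < n)%N -> (n <= m)%N -> nth 0 (L m) i = nth 0 (L n) i.
  move=> lt_in; elim: m => [|m IH]; first by rewrite leqn0 => /eqP n0; rewrite n0 in lt_in.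
  rewrite leq_eqVlt => /orP[/eqP-> //|]; rewrite ltnS => le.
  by rewrite /= nth_rcons szL (leq_trans lt_in) // IH.
exists (fun n => nth 0 (L n) n.-1); split=> // n.
rewrite big_ord_recr /= subnn a0 mulr1 nth_rcons szL ltnn eqxx.
rewrite addrC -/(L n) -addrA [X in _ + X](_ : _ = 0) ?addr0 // addrC; apply/eqP.
rewrite subr_eq0; apply/eqP; apply: eq_bigr => i _; congr (_ * _).
exact/esym/(nthL i.+1).
Qed.

Lemma newton_scale P a (c : B) :
  newton P a -> newton (fun n => c ^+ n * P n) (fun n => c ^+ n * a n).
Proof.
move=> [a0 aP]; split=> [|n]; first by rewrite expr0 mul1r.
rewrite -mulrnAr aP mulr_sumr; apply: eq_bigr => i _.
have := ltn_ord i; rewrite ltnS => le.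
have {1}-> : n.+1 = (i.+1 + (n - i))%N by lia.
by rewrite exprD; ring.
Qed.

(** The sum of the (1 - t^r) (w z)^r / r is the logarithm of
(1 - t w z) / (1 - w z). *)
Lemma newton_geom (t w : B) :
  newton (fun n => (1 - t ^+ n) * w ^+ n)
         (fun n => if n is 0%N then 1 else (1 - t) * w ^+ n).
Proof.
split=> // n; rewrite big_ord_recr /= subnn mulr1.
rewrite (eq_bigr (fun i : 'I_n => (1 - t) * w ^+ n.+1 - (1 - t) * t ^+ i.+1 * w ^+ n.+1)).
  rewrite big_split /= sumr_const card_ord sumrN.
  have -> : \sum_(i < n) (1 - t) * t ^+ i.+1 * w ^+ n.+1 = t * (1 - t ^+ n) * w ^+ n.+1.
    rewrite -{2}(expr1n _ n) subrXX mulr_sumr mulr_sumr mulr_suml.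
    by apply: eq_bigr => i _; rewrite expr1n exprS; ring.
  rewrite mulrSr !exprS; ring.
move=> i _; have := ltn_ord i => lt.
have -> : (n - i)%N = (n - i).-1.+1 by lia.
have -> : n.+1 = (i.+1 + (n - i).-1.+1)%N by lia.
rewrite exprD; ring.
Qed.

End Newton.

Lemma newton_map (B C : comNzRingType) (f : {rmorphism B -> C}) P a :
  newton P a -> newton (f \o P) (f \o a).
Proof.
move=> [a0 aP]; split=> [|n] /=; first by rewrite a0 rmorph1.
by rewrite -rmorphMn aP rmorph_sum; apply: eq_bigr => i _; rewrite rmorphM.
Qed.

Lemma newton_ext (B : comNzRingType) (P Q a b : nat -> B) :
  newton P a -> (forall n, P n.+1 = Q n.+1) -> a =1 b -> newton Q b.
Proof.
move=> [a0 aP] PQ ab; split=> [|n]; first by rewrite -ab.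
by rewrite -ab aP; apply: eq_bigr => i _; rewrite PQ ab.
Qed.

(** * Polynomials in a linear endomorphism *)

Section Act.
Variables (K : fieldType) (V : lmodType K) (D : {linear V -> V}).
Implicit Types (p r : {poly K}) (v : V).

(** The polynomial [p] in the endomorphism [D], at [v]. *)
Definition act p v : V := \sum_(i < size p) p`_i *: iter i D v.

Lemma act_widen n p v : (size p <= n)%N -> act p v = \sum_(i < n) p`_i *: iter i D v.
Proof.
move=> le; rewrite /act (big_ord_widen n (fun i => p`_i *: iter i D v)) //.
rewrite big_mkcond; apply: eq_bigr => i _; case: ltnP => // ge.
by rewrite nth_default // scale0r.
Qed.

Lemma iter_linear i a u v : iter i D (a *: u + v) = a *: iter i D u + iter i D v.
Proof. by elim: i => //= i ->; rewrite linearP. Qed.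

Fact act_linear p : linear (act p).
Proof.
move=> a u v; rewrite /act scaler_sumr -big_split; apply: eq_bigr => i _ /=.
by rewrite iter_linear scalerDr scalerA mulrC -scalerA.
Qed.
HB.instance Definition _ p := GRing.isLinear.Build K V V _ (act p) (@act_linear p).

Lemma actD p r v : act (p + r) v = act p v + act r v.
Proof.
pose n := maxn (size p) (size r).
rewrite !(@act_widen n) ?leq_maxl ?leq_maxr ?size_polyD //.
by rewrite -big_split; apply: eq_bigr => i _; rewrite coefD scalerDl.
Qed.

Lemma actZ c p v : act (c *: p) v = c *: act p v.
Proof.
rewrite (@act_widen (size p)) ?size_scale_leq // /act scaler_sumr.
by apply: eq_bigr => i _; rewrite coefZ scalerA.
Qed.

Lemma act0 v : act 0 v = 0.
Proof. by rewrite /act size_poly0 big_ord0. Qed.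

Lemma actC c v : act c%:P v = c *: v.
Proof. by rewrite (@act_widen 1) ?size_polyC_leq1 // big_ord1 coefC. Qed.

Lemma actMX p v : act (p * 'X) v = act p (D v).
Proof.
rewrite (@act_widen (size p).+1); last first.
  by rewrite (leq_trans (size_polyMleq _ _)) // size_polyX addn2.
rewrite big_ord_recl coefMX scale0r add0r; apply: eq_bigr => i _.
by rewrite coefMX /= -iterSr.
Qed.

Lemma actM p r v : act (p * r) v = act p (act r v).
Proof.
elim/poly_ind: r v => [|r c IH] v; first by rewrite mulr0 !act0 linear0.
rewrite mulrDr mulrA !actD actMX IH [p * _]mulrC mul_polyC actZ actMX actC.
by rewrite linearD linearZ.
Qed.

Lemma actXsubC c v : act ('X - c%:P) v = D v - c *: v.
Proof. by rewrite -polyCN actD -['X]mul1r actMX !actC scale1r scaleNr. Qed.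

Lemma act_eigen e p v : D v = e *: v -> act p v = p.[e] *: v.
Proof.
move=> ev; elim/poly_ind: p => [|p c IH]; first by rewrite act0 horner0 scale0r.
rewrite actD actMX ev linearZ /= IH actC hornerMXaddC scalerDl scalerA mulrC.
by [].
Qed.

Lemma act_dvd p r v : act p v = 0 -> p %| r -> act r v = 0.
Proof. by move=> pv /dvdpP[u ->]; rewrite actM pv linear0. Qed.

(** By Bezout, some combination of [p] and [r] is 1; multiplied by X - e, it is
a polynomial that kills [v]. *)
Lemma act_bezout e p r v : coprimep p r ->
  act (p * ('X - e%:P)) v = 0 -> act (r * ('X - e%:P)) v = 0 -> D v = e *: v.
Proof.
move/Bezout_eq1_coprimepP=> [[u w] /= uw] pv rv; apply/eqP; rewrite -subr_eq0.
rewrite -actXsubC -['X - _]mul1r -uw mulrDl -!mulrA actD.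
by rewrite [act (u * _) v]actM pv [act (w * _) v]actM rv !linear0 addr0.
Qed.

End Act.

(** The Lagrange interpolation polynomial for the values 1 at [E k] and 0 at the
other points of [E] on [S]. *)
Definition lagrange_at (K : fieldType) (I : eqType) (E : I -> K) (S : seq I) (k : I) :
    {poly K} :=
  \prod_(j <- S | j != k) ((E k - E j)^-1 *: ('X - (E j)%:P)).

Section Lagrange.
Variables (K : fieldType) (I : eqType) (E : I -> K) (S : seq I).
Hypothesis E_inj : {in S &, injective E}.

Lemma lagrange_atE j k : j \in S -> k \in S -> (lagrange_at E S k).[E j] = (j == k)%:R.
Proof.
move=> jS kS; rewrite horner_prod; case: (eqVneq j k) => [->|njk].
  rewrite big1_seq // => i /andP[nik iS]; rewrite hornerZ hornerXsubC mulVf //.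
  by rewrite subr_eq0; apply: contra nik => /eqP/E_inj->.
by rewrite (big_rem j jS) /= njk hornerZ hornerXsubC subrr mulr0 mul0r.
Qed.

End Lagrange.

(** For [s] the exponents of a monomial function, these are the terms of its
product with p_k in which the variable of p_k is one of those present. *)
Fixpoint bumps (k : nat) (s : seq nat) : seq (seq nat) :=
  if s is a :: s' then ((a + k)%N :: s') :: [seq a :: u | u <- bumps k s'] else [::].

Lemma size_bumps k s u : u \in bumps k s -> size u = size s.
Proof.
elim: s u => // a s IH u; rewrite inE => /orP[/eqP-> //|/mapP[v /IH vs ->]].
by rewrite /= vs.
Qed.

Lemma big_bumps_cons (V : nmodType) k a s (F : seq nat -> V) :
  \sum_(u <- bumps k (a :: s)) F u =
  F ((a + k)%N :: s) + \sum_(u <- bumps k s) F (a :: u).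
Proof. by rewrite big_cons big_map. Qed.

(** Raising first one entry and then another, or the same one twice, leads to the
same lists whatever the order of [j] and [k]. *)
Lemma bumpsC (V : nmodType) j k s (F : seq nat -> V) :
  \sum_(u <- bumps k s) \sum_(v <- bumps j u) F v =
  \sum_(u <- bumps j s) \sum_(v <- bumps k u) F v.
Proof.
have E x y a t (G : seq nat -> V) :
    \sum_(u <- bumps x (a :: t)) \sum_(v <- bumps y u) G v =
    G ((a + x + y)%N :: t) + (\sum_(v <- bumps y t) G ((a + x)%N :: v) +
    \sum_(u <- bumps x t) G ((a + y)%N :: u)) +
    \sum_(u <- bumps x t) \sum_(v <- bumps y u) G (a :: v).
  rewrite !big_bumps_cons -!addrA; congr (_ + (_ + _)).
  by rewrite -big_split; apply: eq_bigr => u _; rewrite big_bumps_cons.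
elim: s F => [|a s IH] F; first by rewrite !big_nil.
by rewrite !E (IH (fun u => F (a :: u))) addnAC; congr (_ + _ + _); rewrite addrC.
Qed.

(** The augmented monomial symmetric function as a polynomial in the power
sums, the latter replaced by elements of any ring. The fuel [n] bounds the
length of [s]. *)
Fixpoint augn (B : comNzRingType) (g : nat -> B) (n : nat) (s : seq nat) : B :=
  match n, s with
  | n'.+1, k :: s' => g k * augn g n' s' - \sum_(u <- bumps k s') augn g n' u
  | _, _ => 1
  end.

Definition aug (B : comNzRingType) (g : nat -> B) (s : seq nat) : B :=
  augn g (size s) s.

Lemma aug_cons (B : comNzRingType) (g : nat -> B) k s :
  aug g (k :: s) = g k * aug g s - \sum_(u <- bumps k s) aug g u.
Proof.
rewrite /aug /=; congr (_ - _); apply: eq_big_seq => u /size_bumps ->.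
by [].
Qed.

Lemma mul_aug (B : comNzRingType) (g : nat -> B) k s :
  g k * aug g s = aug g (k :: s) + \sum_(u <- bumps k s) aug g u.
Proof. by rewrite aug_cons subrK. Qed.

(** The indices met by the recursion are sums of entries of [s]. The second hypothesis
reaches them while avoiding the index 0, where p_0 = 1 differs from the sum of the
x_i^0. *)
Lemma aug_map (B C : comNzRingType) (f : {rmorphism B -> C}) (g : nat -> B)
    (g' : nat -> C) s :
  (forall k, k \in s -> f (g k) = g' k) ->
  (forall k l, f (g k) = g' k -> f (g l) = g' l -> f (g (k + l)%N) = g' (k + l)%N) ->
  f (aug g s) = aug g' s.
Proof.
move=> + add; have [n] := ubnP (size s); elim: n s => // n IH [|k s] /=.
  by move=> _ _; rewrite /aug /= rmorph1.
rewrite ltnS => sn gk; rewrite !aug_cons rmorphB rmorphM rmorph_sum /=.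
have gs l : l \in s -> f (g l) = g' l by move=> ls; rewrite gk // inE ls orbT.
rewrite gk ?mem_head // IH //; congr (_ - _); apply: eq_big_seq => u us.
apply: IH => [|l lu]; first by rewrite (size_bumps us).
have gk' : f (g k) = g' k by rewrite gk ?mem_head.
clear sn gk; elim: s u us gs l lu => // a s IHs u.
rewrite inE => /orP[/eqP-> gs l|/mapP[v vs ->] gs l].
  rewrite inE => /orP[/eqP->|ls]; last by apply/gs; rewrite inE ls orbT.
  by apply: add => //; apply/gs/mem_head.
rewrite inE => /orP[/eqP->|]; first exact/gs/mem_head.
by apply: (IHs v vs) => m ms; apply: gs; rewrite inE ms orbT.
Qed.

Section AugPerm.
Variables (B : comNzRingType) (g : nat -> B).

(** The recursion treats the head of the list apart; the two heads can be
exchanged because p_j p_k = p_k p_j. *)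
Lemma aug_swap j k s : aug g (j :: k :: s) = aug g (k :: j :: s).
Proof.
have E x y : \sum_(u <- bumps x s) aug g (y :: u) =
    g y * \sum_(u <- bumps x s) aug g u - \sum_(u <- bumps x s) \sum_(v <- bumps y u) aug g v.
  by rewrite mulr_sumr -sumrB; apply: eq_bigr => u _; rewrite aug_cons.
rewrite [LHS]aug_cons big_bumps_cons [RHS]aug_cons big_bumps_cons !E.
rewrite [aug g (k :: s)]aug_cons [aug g (j :: s)]aug_cons.
rewrite (bumpsC j k s) addnC; ring.
Qed.

(** Up to permutation the raised entry may be moved to the front, which makes the
sum visibly invariant under permutations of [s]. *)
Lemma big_bumps_perm k s (F : seq nat -> B) :
  (forall u v, size u = size s -> perm_eq u v -> F u = F v) ->
  \sum_(u <- bumps k s) F u = \sum_(a <- s) F ((a + k)%N :: rem a s).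
Proof.
elim: s F => [|b s IH] F Fp; first by rewrite !big_nil.
rewrite big_bumps_cons big_cons /= eqxx; congr (_ + _).
rewrite (IH (fun u => F (b :: u))); last first.
  by move=> u v us uv; apply: Fp; rewrite /= ?us ?perm_cons.
apply: eq_big_seq => a as_; apply: Fp.
  by have := perm_size (perm_to_rem as_) => /= ->.
rewrite -/([:: b] ++ [:: (a + k)%N] ++ rem a s).
case: eqP => [->|_]; rewrite perm_catCA /= perm_cons ?perm_refl //.
by rewrite perm_sym perm_to_rem.
Qed.

Lemma aug_perm s s' : perm_eq s s' -> aug g s = aug g s'.
Proof.
have [n] := ubnP (size s); elim: n s s' => // n IH [|k s] s' sn ss'.
  by have := perm_size ss' => /= /esym/size0nil->.
rewrite ltnS in sn.
have tl a u v : size u = size s -> perm_eq u v -> aug g (a :: u) = aug g (a :: v).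
  move=> us uv; rewrite !aug_cons (IH u v) //; last by rewrite us.
  have Fp w : size w = size s -> forall u v, size u = size w -> perm_eq u v ->
      aug g u = aug g v.
    by move=> ws ? ? uw; apply: IH; rewrite uw ws.
  rewrite !big_bumps_perm; [|apply: Fp|apply: Fp]=> //; last by rewrite -us (perm_size uv).
  congr (_ - _); rewrite (perm_big _ uv) /=; apply: eq_big_seq => b bv.
  have bu : b \in u by rewrite (perm_mem uv).
  apply: IH.
    by have := perm_size (perm_to_rem bu) => /= <-; rewrite us.
  rewrite perm_cons -(perm_cons b).
  by rewrite (perm_trans _ (perm_to_rem bv)) // perm_sym (perm_trans _ (perm_to_rem bu)) // perm_sym.
case: s' ss' => [|j t] ss'; first by have := perm_size ss'.
case: (eqVneq j k) ss' => [-> |njk] ss'; first by apply: tl => //; rewrite perm_cons in ss'.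
have kt : k \in t.
  by have := perm_mem ss' k; rewrite mem_head inE eq_sym (negPf njk) => /esym.
have st : size t = size s by have := perm_size ss' => /= -[].
rewrite (tl j t _ st (perm_to_rem kt)) aug_swap; apply: tl => //.
rewrite -(perm_cons k) (perm_trans ss') //.
rewrite (perm_trans (y := j :: k :: rem k t)) ?perm_cons ?perm_to_rem //.
by rewrite -/([:: j] ++ [:: k] ++ _) perm_catCA.
Qed.

End AugPerm.

Lemma card_notin n (A : {set 'I_n}) : #|[pred j | j \notin A]| = (n - #|A|)%N.
Proof.
have := cardC (mem A); rewrite card_ord => e; apply/eqP.
rewrite -(eqn_add2l #|A|) subnKC; last by rewrite -[leqRHS]e leq_addr.
by rewrite -[eqbRHS]e eqn_add2l; apply/eqP/eq_card => i; rewrite !inE.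
Qed.

(** The eigenvalue of sum_i (1 - T_(q, x_i)) on a monomial symmetric function of
exponents [s]. *)
Definition qexp (K : comNzRingType) (q : K) (s : seq nat) : K :=
  \sum_(k <- s) (1 - q ^+ k).

Section MonoPoly.
Variables (K : comNzRingType) (n : nat).
Implicit Types (A : {set 'I_n}) (s : seq nat) (i j : 'I_n).

Definition psum_out k A : {mpoly K[n]} := \sum_(j | j \notin A) 'X_j ^+ k.

(** The augmented monomial symmetric function in the variables outside [A]: a
sum over the injective placements of the exponents, where [A] collects the
variables that are already taken. *)
Fixpoint mono s A : {mpoly K[n]} :=
  if s is k :: s' then \sum_(j | j \notin A) 'X_j ^+ k * mono s' (j |: A) else 1.

Lemma mono_swap (j k : nat) s A : mono (j :: k :: s) A = mono (k :: j :: s) A.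
Proof.
rewrite /=.
under eq_bigr => a _ do rewrite mulr_sumr.
under [in RHS]eq_bigr => a _ do rewrite mulr_sumr.
rewrite (exchange_big_dep (fun b => b \notin A)) /=; last first.
  by move=> a b _; rewrite !inE negb_or => /andP[].
apply: eq_bigr => b bA; apply: eq_big => a.
  by rewrite !inE !negb_or bA eq_sym /= andbT andbC.
by move=> _; rewrite setUCA mulrCA.
Qed.

(** The variable of p_k is either new or one of those already present. *)
Lemma mul_mono k s A :
  psum_out k A * mono s A = mono (k :: s) A + \sum_(u <- bumps k s) mono u A.
Proof.
elim: s A => [|j s IH] A.
  by rewrite big_nil addr0 mulr1 /=; apply: eq_bigr => i _; rewrite mulr1.
rewrite mono_swap big_bumps_cons [mono (j :: s) A]/= mulr_sumr.
have step i : i \notin A -> psum_out k A = 'X_i ^+ k + psum_out k (i |: A).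
  move=> iA; rewrite /psum_out (bigD1 i) //=; congr (_ + _).
  by apply: eq_bigl => l; rewrite !inE negb_or andbC.
rewrite (eq_bigr (fun i => 'X_i ^+ (j + k) * mono s (i |: A) +
   ('X_i ^+ j * mono (k :: s) (i |: A) +
   \sum_(u <- bumps k s) 'X_i ^+ j * mono u (i |: A)))); last first.
  move=> i iA; rewrite (step i iA) mulrCA mulrDl IH exprD !mulrDr -mulr_sumr.
  by rewrite !mulrA.
rewrite big_split big_split /= addrCA; congr (_ + (_ + _)).
by rewrite exchange_big.
Qed.

Lemma mono_aug s : mono s set0 = aug (psum_out^~ set0) s.
Proof.
have [m] := ubnP (size s); elim: m s => // m IH [|k s] //=.
rewrite ltnS => sm; rewrite aug_cons -(IH s) // mul_mono.
rewrite [X in _ - X](_ : _ = \sum_(u <- bumps k s) mono u set0).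
  by rewrite addrK.
by apply: eq_big_seq => u us; rewrite IH // (size_bumps us).
Qed.

(** The q-shift T_(q, x_i) of one variable. *)
Definition dilate (q : K) i : {mpoly K[n]} -> {mpoly K[n]} :=
  mmap (@mpolyC n K) (fun j => if j == i then q *: 'X_j else 'X_j).
HB.instance Definition _ q i := GRing.RMorphism.on (dilate q i).

Lemma dilateZ q i c p : dilate q i (c *: p) = c *: dilate q i p.
Proof. by rewrite /dilate mmapZ mul_mpolyC. Qed.

Lemma dilateX q i j : dilate q i 'X_j = if j == i then q *: 'X_j else 'X_j.
Proof. by rewrite /dilate mmapX mmap1U. Qed.

Definition qlap (q : K) (p : {mpoly K[n]}) := \sum_i (p - dilate q i p).

Fact qlap_linear q : linear (qlap q).
Proof.
move=> c u v; rewrite /qlap scaler_sumr -big_split; apply: eq_bigr => i _ /=.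
rewrite rmorphD /= dilateZ scalerBr; ring.
Qed.
HB.instance Definition _ q :=
  GRing.isLinear.Build K {mpoly K[n]} {mpoly K[n]} _ (qlap q) (@qlap_linear q).

Lemma dilate_mono q i s A : i \in A -> dilate q i (mono s A) = mono s A.
Proof.
elim: s A => [|k s IH] A iA /=; first by rewrite rmorph1.
rewrite rmorph_sum; apply: eq_bigr => j jA /=.
rewrite rmorphM rmorphXn /= dilateX IH ?inE ?iA ?orbT //.
by case: eqP => // ji; rewrite ji iA in jA.
Qed.

(** A variable in [A] does not occur, so that peeling off the first exponent
leaves one q-shift for the variable that carries it and the induction
hypothesis for the others. *)
Lemma qlap_mono_out q s A :
  \sum_(i | i \notin A) (mono s A - dilate q i (mono s A)) = qexp q s *: mono s A.
Proof.
elim: s A => [|k s IH] A /=.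
  by rewrite /qexp big_nil scale0r big1 // => i _; rewrite rmorph1 subrr.
rewrite scaler_sumr.
under eq_bigr => i _ do rewrite rmorph_sum -sumrB.
rewrite exchange_big /=; apply: eq_bigr => j jA.
rewrite (bigD1 j) //= rmorphM rmorphXn /= dilateX eqxx dilate_mono ?setU11 //.
rewrite (eq_bigr (fun i => 'X_j ^+ k * (mono s (j |: A) - dilate q i (mono s (j |: A))))).
  rewrite -mulr_sumr (eq_bigl (fun i => i \notin j |: A)); last first.
    by move=> i; rewrite !inE negb_or andbC.
  rewrite IH exprZn -scalerAl -scalerAr -{1}[_ * mono _ _]scale1r -scalerBl -scalerDl.
  by rewrite /qexp big_cons.
move=> i /andP[iA ij]; rewrite rmorphM rmorphXn /= dilateX eq_sym (negPf ij).
by rewrite mulrBr.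
Qed.

Lemma qlap_mono q s : qlap q (mono s set0) = qexp q s *: mono s set0.
Proof. by rewrite -qlap_mono_out; apply: eq_bigl => i; rewrite inE. Qed.

(** The number of injective placements. It shows that these polynomials are
nonzero when there are enough variables. *)
Lemma mono_count s A :
  (mono s A).@[fun=> 1] = \prod_(i < size s) (n - #|A| - i)%:R.
Proof.
elim: s A => [|k s IH] A /=; first by rewrite rmorph1 big_ord0.
rewrite rmorph_sum big_ord_recl subn0 /=.
rewrite (eq_bigr (fun=> \prod_(i < size s) (n - #|A| - i.+1)%:R)); last first.
  move=> j jA; rewrite rmorphM rmorphXn /= mevalXU expr1n mul1r IH.
  by apply: eq_bigr => i _; rewrite cardsU1 jA add1n -!subnDA addSnnS.
by rewrite sumr_const card_notin mulr_natl.
Qed.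

End MonoPoly.

(** ** Symmetrization of a monomial *)

Section Average.
Variables (K : comNzRingType) (n : nat).
Implicit Types (A : {set 'I_n}).

Lemma big_tuple_cons (V : nmodType) (T : finType) k (P : pred (seq T)) (F : seq T -> V) :
  \sum_(u : k.+1.-tuple T | P u) F u =
  \sum_(x : T) \sum_(u : k.-tuple T | P (x :: u)) F (x :: u).
Proof.
rewrite pair_big_dep /= (reindex (fun p : T * k.-tuple T => [tuple of p.1 :: p.2])) /=.
  exact: eq_bigl.
exists (fun u : k.+1.-tuple T => (thead u, [tuple of behead u])) => [[x u] _|u _] /=.
  by congr (_, _); apply: val_inj.
by rewrite [RHS]tuple_eta.
Qed.

Lemma mono_tuple s A (x0 : 'I_n) :
  mono K s A = \sum_(u : (size s).-tuple 'I_n | uniq u && all (fun j => j \notin A) u)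
     \prod_(i < size s) 'X_(nth x0 u i) ^+ nth 0%N s i.
Proof.
elim: s A => [|k s IH] A /=.
  rewrite (big_pred1 [tuple]) ?big_ord0 // => u.
  by rewrite (tuple0 u) /= eqxx.
rewrite (@big_tuple_cons _ _ (size s) (fun u => uniq u && all (fun j => j \notin A) u)
  (fun u => \prod_(i < (size s).+1) 'X_(nth x0 u i) ^+ nth 0%N (k :: s) i)) /=.
rewrite big_mkcond; apply: eq_bigr => j _; case: ifP => jA; last first.
  by rewrite big_pred0 // => u; rewrite /= andbF.
rewrite IH mulr_sumr; apply: eq_big => [u|u _]; last by rewrite big_ord_recl.
rewrite /= -andbA andbCA; congr (_ && _).
elim: (tval u) => //= a l ->; rewrite !inE !negb_or eq_sym.
by case: eqP => //= _; case: (a \in A) => //=; rewrite andbF.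
Qed.

(** The permutations of the n variables are their injective enumerations. *)
Lemma sum_msym (m : 'X_{1..n}) :
  \sum_(p : 'S_n) msym p 'X_[K, m] = mono K [seq m i | i <- enum 'I_n] set0.
Proof.
case: (posnP n) => [n0|n_gt0].
  subst n; rewrite (_ : enum 'I_0 = [::]) /=; last by apply: size0nil; rewrite size_enum_ord.
  rewrite (big_pred1 1%g) => [|p]; last by apply/esym/eqP/permP=> -[].
  by rewrite /msym mmapX /mmap1 big_ord0.
pose x0 : 'I_n := Ordinal n_gt0.
rewrite (mono_tuple _ _ x0) size_map size_enum_ord.
rewrite (reindex_onto (fun p : 'S_n => [tuple p i | i < n])
   (fun u => insubd (1%g : 'S_n) (finfun (tnth u)))) /=; last first.
  move=> u /andP[uu _]; apply: eq_from_tnth => i.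
  rewrite (tnth_nth x0) (nth_map i) ?size_enum_ord // nth_ord_enum.
  have -> (p : 'S_n) : p i = val p i by rewrite -pvalE.
  rewrite val_insubd (_ : injectiveb _) ?ffunE //.
  apply/injectiveP => a b; rewrite !ffunE => ab.
  exact/(tuple_uniqP _ uu).
apply: eq_big => [p|p _].
  apply/esym; rewrite -andbA; apply/and3P; split.
  - by rewrite map_inj_uniq ?enum_uniq //; apply: perm_inj.
  - by apply/allP => a _; rewrite inE.
  apply/eqP; apply: val_inj; rewrite val_insubd.
  have -> : [ffun i => tnth [tuple p i0 | i0 < n] i] = val p.
    by apply/ffunP => i; rewrite ffunE tnth_mktuple -pvalE.
  by rewrite (valP p).
rewrite /msym mmapX /mmap1; apply: eq_bigr => i _.
have E : nth i (Finite.enum 'I_n) i = i by rewrite -enumT nth_ord_enum.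
by rewrite !(nth_map i) -?enumT ?size_enum_ord // enumT E.
Qed.

End Average.

(** A zero exponent places a variable without trace: it multiplies by the number
of variables that are still free. *)
Lemma mono_pos (K : comNzRingType) n s : exists c : nat -> K,
  forall A : {set 'I_n}, mono K s A = c #|A| *: mono K [seq k <- s | (0 < k)%N] A.
Proof.
elim: s => [|k s [c IH]]; first by exists (fun=> 1) => A; rewrite scale1r.
case: (posnP k) => [->|k_gt0] /=; last first.
  rewrite k_gt0; exists (fun a => c a.+1) => A /=; rewrite scaler_sumr.
  apply: eq_bigr => j jA; by rewrite IH cardsU1 jA add1n -scalerAr.
exists (fun a => ((n - a)%N%:R - (size s)%:R) * c a) => A.
have := mul_mono K 0 s A.
have -> : bumps 0 s = nseq (size s) s.
  by clear; elim: s => //= a u ->; rewrite addn0 map_nseq.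
rewrite /psum_out (eq_bigr (fun=> 1)) => [|i _]; last by rewrite expr0.
rewrite sumr_const card_notin big_nseq iter_addr_0 -scalerA -IH scalerBl !scaler_nat mulr_natl.
by move=> ->; rewrite addrK.
Qed.

(** * Symmetric functions as combinations of augmented monomials *)

Section EvalSymfun.
Variables (K : comNzRingType).

Definition symfun_ev n (f : symfun K) : {mpoly K[n]} := f n.
Fact symfun_ev_additive n : additive (symfun_ev n). Proof. by []. Qed.
HB.instance Definition _ n :=
  GRing.isAdditive.Build (symfun K) {mpoly K[n]} (symfun_ev n) (symfun_ev_additive n).
Fact symfun_ev_multiplicative n : multiplicative (symfun_ev n). Proof. by []. Qed.
HB.instance Definition _ n :=
  GRing.isMultiplicative.Build (symfun K) {mpoly K[n]} (symfun_ev n)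
    (symfun_ev_multiplicative n).
Fact symfun_ev_scalable n : scalable (symfun_ev n). Proof. by []. Qed.
HB.instance Definition _ n :=
  GRing.isScalable.Build K (symfun K) {mpoly K[n]} _ (symfun_ev n)
    (symfun_ev_scalable n).

Lemma aug_ev n s : all (ltn 0) s -> (aug (pfun K) s) n = mono K s (set0 : {set 'I_n}).
Proof.
move=> /allP spos; rewrite mono_aug -/(symfun_ev n _).
have pE k : (0 < k)%N -> symfun_ev n (pfun K k) = psum_out K k (set0 : {set 'I_n}).
  by case: k => // k _; apply: eq_bigl => i; rewrite inE.
apply: aug_map => [k /spos /pE //|k l pk pl].
case: (posnP (k + l)%N) => [|/pE //].
by move=> /eqP; rewrite addn_eq0 => /andP[/eqP k0 /eqP ->]; rewrite addn0.
Qed.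

Lemma mono_homog n s (A : {set 'I_n}) : mono K s A \is (sumn s).-homog.
Proof.
elim: s A => [|k s IH] A /=; first exact: dhomog1.
apply: rpred_sum => j _; apply: dhomogM => //.
by rewrite mpolyXn dhomogX /= mdegMn mdeg1 mul1n.
Qed.

Lemma msize_mono n s (A : {set 'I_n}) : (msize (mono K s A) <= (sumn s).+1)%N.
Proof.
rewrite msizeE; apply/bigmax_leqP_seq => m md _.
by rewrite (dhomog_mf (mono_homog s A) md).
Qed.

(** A monomial of degree less than [d] in more than [d] variables misses one of them,
which symmetry lets be the last; restriction to fewer variables then keeps
its coefficient. *)
Lemma symfun_finite_eq0 d (f : symfun K) :
  (forall n, (msize (f n) <= d)%N) -> f d = 0 -> f = 0.
Proof.
case: f => f [/= fS fR ?] fd f0; apply: symfun_eq => /= n.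
case: (leqP n d) => [nd|dn].
  rewrite -(subKn nd); elim: (d - n)%N => [|m IH]; first by rewrite subn0.
  case: (leqP d m) => [dm|md].
    by rewrite (_ : d - m.+1 = d - m)%N //; lia.
  have -> : (d - m.+1 = (d - m).-1)%N by lia.
  have e : (d - m = (d - m).-1.+1)%N by lia.
  rewrite -fR; move: IH; rewrite e /= => ->; exact: restrict_last0.
(* Ascending from d variables. *)
have {}dn := ltnW dn; rewrite -(subnKC dn); elim: (n - d)%N => [|m IH].
  by rewrite addn0.
rewrite addnS; apply/mpolyP => u; rewrite mcoeff0.
case: (ltnP (mdeg u) d) => [ud|du]; last first.
  by apply/memN_msupp_eq0/msize_mdeg_ge; apply: leq_trans du.
have [i /eqP ui] : exists i, u i == 0%N.
  apply/existsP; apply: contraLR ud => /existsPn un; rewrite -leqNgt mdegE.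
  apply: leq_trans (_ : \sum_(i < (d + m).+1) 1 <= _)%N; first by rewrite sum1_card card_ord; lia.
  by apply: leq_sum => i _; rewrite lt0n.
rewrite -(issymP _ (fS _) (tperm i ord_max)) mcoeff_sym.
set v := [multinom _ | _ < _].
have vmax : v ord_max = 0%N by rewrite mnmE tpermR.
have -> : v = mnmwiden [multinom v (lift ord_max j) | j < d + m].
  apply/mnmP => j; case: (unliftP ord_max j) => [k|] ->.
    rewrite -[in RHS](_ : widen_ord (leqnSn _) k = lift ord_max k).
      by rewrite mnmwiden_widen mnmE.
    by apply: ord_inj; rewrite lift_max.
  by rewrite vmax mnmwiden_ordmax.
by rewrite -mcoeff_restrict_last fR IH mcoeff0.
Qed.

End EvalSymfun.

Section Span.
Variable (K : fieldType).
Hypothesis K_char0 : forall n, n.+1%:R != 0 :> K.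

(** In [d] variables, d bounding the degree, d! f is the sum of the images of f
under permutations; each monomial of f contributes an augmented monomial
function. *)
Lemma aug_span (f : symfun K) : exists l : seq (K * seq nat),
  all (fun x => all (ltn 0) x.2) l /\ f = \sum_(x <- l) x.1 *: aug (pfun K) x.2.
Proof.
case: (symfunP f) => fS _ [d fd].
pose ex (m : 'X_{1..d}) := [seq k <- [seq m i | i <- enum 'I_d] | (0 < k)%N].
have ex_pos m : all (ltn 0) (ex m) by apply/allP => k; rewrite mem_filter => /andP[].
have ex_sum m : sumn (ex m) = mdeg m.
  rewrite mdegE (_ : (\sum_i m i = \sum_(i <- enum 'I_d) m i)%N) /ex; last by rewrite big_enum.
  elim: (enum _) => [|i u IH] /=; first by rewrite big_nil.
  by rewrite big_cons -IH; case: (posnP (m i)) => [->|].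
have [c cP] : {c : 'X_{1..d} -> K & forall m : 'X_{1..d},
    mono K [seq m i | i <- enum 'I_d] set0 = c m *: mono K (ex m) (set0 : {set 'I_d})}.
  apply: (@choice _ _ (fun (m : 'X_{1..d}) a => mono K [seq m i | i <- enum 'I_d]
    (set0 : {set 'I_d}) = a *: mono K (ex m) set0)) => m.
  by case: (mono_pos K d [seq m i | i <- enum 'I_d]) => a ->; eexists.
exists [seq (d`!%:R^-1 * ((f d)@_m * c m), ex m) | m <- msupp (f d)]; split.
  by rewrite all_map; apply/allP => m _ /=.
set g := (X in f = X); suff : f - g = 0 by move/eqP; rewrite subr_eq0 => /eqP.
have ev n (l : seq (K * seq nat)) : (\sum_(x <- l) x.1 *: aug (pfun K) x.2 : symfun K) n =
    \sum_(x <- l) x.1 *: (aug (pfun K) x.2) n.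
  by rewrite -/(symfun_ev n _) linear_sum; apply: eq_bigr => x _; rewrite linearZ.
have d_neq0 : d`!%:R != 0 :> K by case: (d`!) (fact_gt0 d).
apply: (@symfun_finite_eq0 _ d) => [n|] /=.
  apply: leq_trans (msizeD_le _ _) _; rewrite geq_max fd msizeN /g ev big_map.
  apply: leq_trans (msize_sum _ _ _) _; apply/bigmax_leqP_seq => m md _ /=.
  apply: leq_trans (msizeZ_le _ _) _; rewrite aug_ev //.
  apply: leq_trans (msize_mono _ _ _) _; rewrite ex_sum.
  exact: leq_trans (msize_mdeg_lt md) (fd d).
apply/eqP; rewrite subr_eq0 /g ev big_map; apply/eqP.
apply: (scalerI d_neq0); rewrite scaler_sumr scaler_nat.
have -> : f d *+ d`! = \sum_(p : 'S_d) msym p (f d).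
  rewrite (eq_bigr (fun=> f d)) => [|p _]; last by rewrite (issymP _ (fS d)).
  by rewrite sumr_const card_Sn.
rewrite [f d in LHS]mpolyE; under eq_bigr => p _ do rewrite linear_sum.
rewrite exchange_big; apply: eq_bigr => m _ /=.
under eq_bigr => p _ do rewrite msymZ.
rewrite -scaler_sumr sum_msym cP aug_ev // !scalerA; congr (_ *: _).
by rewrite mulVKf.
Qed.

End Span.

(** * The universal property of the power sums *)

Definition positive (s : seq nat) : bool := all (ltn 0) s.

(** [q] behaves as an indeterminate: the eigenvalues [qexp q s] of different types
are different. In particular the characteristic is 0. *)
Definition generic (K : comNzRingType) (q : K) : Prop :=
  forall s s', positive s -> positive s' -> qexp q s = qexp q s' -> perm_eq s s'.

Definition monom (B : comNzRingType) (g : nat -> B) (s : seq nat) : B :=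
  \prod_(k <- s) g k.

Lemma monom_cat (B : comNzRingType) (g : nat -> B) s u :
  monom g (s ++ u) = monom g s * monom g u.
Proof. exact: big_cat. Qed.

Lemma monom_cons (B : comNzRingType) (g : nat -> B) k s :
  monom g (k :: s) = g k * monom g s.
Proof. exact: big_cons. Qed.

Lemma monom_map (B C : comNzRingType) (f : {rmorphism B -> C}) g s :
  f (monom g s) = monom (f \o g) s.
Proof. exact: rmorph_prod. Qed.

Lemma bumps_positive k s u : positive s -> u \in bumps k s -> positive u.
Proof.
elim: s u => // a s IH u /= /andP[a0 s0]; rewrite inE => /orP[/eqP->|/mapP[v vs ->]] /=.
  by rewrite s0 andbT ltn_addr.
by rewrite a0 (IH v).
Qed.

(** The expansion is uniform in the ring and in [g], so that relations pass from
monomials to augmented functions. The other terms come from products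
of power sums in which variables coincide, hence are shorter. *)
Lemma monom_aug s : positive s -> exists2 L : seq (seq nat),
  all (fun u => positive u && (size u < size s)%N) L &
  forall (B : comNzRingType) (g : nat -> B), monom g s = aug g s + \sum_(u <- L) aug g u.
Proof.
elim: s => [_|k s IH /= /andP[k0 sp]].
  by exists [::] => // B g; rewrite big_nil addr0 /monom big_nil.
have [L /allP Lp LE] := IH sp.
exists (bumps k s ++ flatten [seq (k :: u) :: bumps k u | u <- L]).
  apply/allP => v; rewrite mem_cat => /orP[vs|/flatten_mapP[u uL]].
    by rewrite (bumps_positive sp vs) (size_bumps vs) ltnS /=.
  have /andP[up us] := Lp u uL; rewrite inE => /orP[/eqP->|vu].
    by rewrite /positive /= k0 ltnS us andbT.
  by rewrite (bumps_positive up vu) (size_bumps vu) ltnS ltnW.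
move=> B g; rewrite monom_cons LE mulrDr mul_aug -addrA; congr (_ + _).
rewrite big_cat /=; congr (_ + _); rewrite mulr_sumr big_flatten big_map.
by apply: eq_bigr => u _; rewrite mul_aug big_cons.
Qed.

Section Generic.
Variables (K : fieldType) (q : K).
Hypothesis q_generic : generic q.

Lemma generic_char0 n : n.+1%:R != 0 :> K.
Proof.
apply/eqP => n0; have := q_generic (s := nseq n.+1 1%N) (s' := [::]).
rewrite /positive all_nseq /qexp big_nseq iter_addr_0 big_nil -mulr_natl n0 mul0r.
by move/(_ isT isT erefl)/perm_size.
Qed.

Lemma generic_natr_neq0 n : (0 < n)%N -> n%:R != 0 :> K.
Proof. by case: n => // n _; apply: generic_char0. Qed.

(** Augmented monomial functions of different types are eigenvectors of the
operator sum_i (1 - T_(q, x_i)) for different eigenvalues, so a relation between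
them splits by types. *)
Lemma aug_class_sum (l : seq (K * seq nat)) e :
  all (fun x => positive x.2) l -> \sum_(x <- l) x.1 *: aug (pfun K) x.2 = 0 ->
  \sum_(x <- l | qexp q x.2 == e) x.1 = 0.
Proof.
(* Enough variables for all the functions in the relation to be nonzero. *)
move=> /allP lp l0; pose N := \max_(x <- l) size x.2.
have lN x : x \in l -> (size x.2 <= N)%N by move=> xl; apply: leq_bigmax_seq.
pose S := undup (e :: [seq qexp q x.2 | x <- l]).
pose P := lagrange_at id S e.
have PE x : x \in l -> P.[qexp q x.2] = (qexp q x.2 == e)%:R.
  move=> xl; rewrite (lagrange_atE (E := id)) //.
  - by rewrite mem_undup inE (map_f (fun x => qexp q x.2) xl) orbT.
  - by rewrite mem_undup mem_head.
have := congr1 (fun f : symfun K => act (qlap q) P (symfun_ev N f)) l0.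
rewrite /= raddf0 [RHS]raddf0 !linear_sum /=.
rewrite (eq_big_seq (fun x => (x.1 * (qexp q x.2 == e)%:R) *: mono K x.2 (set0 : {set 'I_N}))).
  case: (boolP (has (fun x => qexp q x.2 == e) l)) => [/hasP[x0 x0l x0e]|/hasPn nl]; last first.
    by move=> _; rewrite big1_seq // => x /andP[xe /nl]; rewrite xe.
  rewrite (eq_big_seq (fun x => (x.1 * (qexp q x.2 == e)%:R) *: mono K x0.2 (set0 : {set 'I_N}))).
    (* All terms are now multiples of one function; evaluate it at x_i = 1. *)
    rewrite -scaler_suml; move=> /(congr1 (meval (fun=> 1))).
    rewrite mevalZ mono_count raddf0 => /eqP; rewrite mulf_eq0 => /orP[/eqP|].
      move=> c0; rewrite big_mkcond -[RHS]c0; apply: eq_bigr => x _.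
      by case: eqP; rewrite ?mulr1 ?mulr0.
    move/prodf_eq0 => [i _]; rewrite cards0 subn0; apply: contraTeq => _.
    by apply: generic_natr_neq0; rewrite subn_gt0 (leq_trans (ltn_ord i)) // lN.
  move=> x xl; case: eqP => [xe|]; last by rewrite mulr0 !scale0r.
  rewrite -!aug_ev; [|exact: lp..]; congr (_ *: symfun_val _ N); apply: aug_perm.
  by apply: q_generic; rewrite ?xe ?(eqP x0e) //; apply: lp.
move=> x xl; rewrite !linearZ /= -scalerA; congr (_ *: _).
rewrite aug_ev; last exact: lp.
by rewrite (act_eigen _ (qlap_mono _ _ _)) PE.
Qed.

(** By [aug_class_sum] a relation between augmented functions is trivial up to
permutations of the lists, thus holds for arbitrary elements [g] in place of
the power sums. *)
Lemma aug_free (B : comNzRingType) (iota : {rmorphism K -> B}) (g : nat -> B)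
    (l : seq (K * seq nat)) :
  all (fun x => positive x.2) l -> \sum_(x <- l) x.1 *: aug (pfun K) x.2 = 0 ->
  \sum_(x <- l) iota x.1 * aug g x.2 = 0.
Proof.
have [n] := ubnP (size l); elim: n l => // n IH [|x0 l] ln lp l0; first by rewrite big_nil.
pose c x := qexp q (x : K * seq nat).2 == qexp q x0.2.

have perm_c x : x \in x0 :: l -> c x -> perm_eq x.2 x0.2.
  move=> xl /eqP cx; apply: q_generic => //; first exact: (allP lp x xl).
  by apply: (allP lp x0); apply: mem_head.
have csum := aug_class_sum (qexp q x0.2) lp l0.
have part0 (C : comNzRingType) (j : {rmorphism K -> C}) (h : nat -> C) :
    \sum_(x <- x0 :: l | c x) j x.1 * aug h x.2 = 0.
  rewrite big_seq_cond (eq_bigr (fun x => j x.1 * aug h x0.2)).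
    by rewrite -big_seq_cond -mulr_suml -rmorph_sum csum rmorph0 mul0r.
  by move=> x /andP[xl /(perm_c x xl) px]; rewrite (aug_perm h px).
rewrite (bigID c) /= part0 add0r -big_filter; apply: IH.
- rewrite /= {1}/c eqxx /=; rewrite size_filter (leq_ltn_trans (count_size _ _)) //.
- by apply/allP => x; rewrite mem_filter => /andP[_]; apply: (allP lp).
have := part0 _ (in_alg (symfun K)) (pfun K).
under eq_bigr => x _ do rewrite /= mulr_algl.
by rewrite big_filter => p0; rewrite -[RHS]l0 [RHS](bigID c) /= p0 add0r.
Qed.

Let K_char0 : forall n, n.+1%:R != 0 :> K := generic_char0.

Lemma monom_span (f : symfun K) : exists l : seq (K * seq nat),
  all (fun x => positive x.2) l /\ f = \sum_(x <- l) x.1 *: monom (pfun K) x.2.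
Proof.
pose inS (f : symfun K) := exists l : seq (K * seq nat),
  all (fun x => positive x.2) l /\ f = \sum_(x <- l) x.1 *: monom (pfun K) x.2.
have inD u v : inS u -> inS v -> inS (u + v).
  move=> [l [lp ->]] [m [mp ->]]; exists (l ++ m).
  by rewrite all_cat lp mp big_cat.
have inZ c u : inS u -> inS (c *: u).
  move=> [l [lp ->]]; exists [seq (c * x.1, x.2) | x <- l].
  rewrite all_map big_map scaler_sumr; split=> //.
  by apply: eq_bigr => x _; rewrite scalerA.
have inP k u : (0 < k)%N -> inS u -> inS (pfun K k * u).
  move=> k0 [l [/allP lp ->]]; exists [seq (x.1, k :: x.2) | x <- l]; split.
    by rewrite all_map; apply/allP => x xl /=; rewrite /positive /= k0; apply: lp.
  by rewrite big_map mulr_sumr; apply: eq_bigr => x _; rewrite monom_cons scalerAr.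
have in0 : inS 0 by exists [::]; rewrite big_nil.
have inS_sum (I : eqType) (r : seq I) (F : I -> symfun K) :
    (forall i, i \in r -> inS (F i)) -> inS (\sum_(i <- r) F i).
  move=> rF; rewrite big_seq; apply: (big_ind inS) => //.
have inA s : positive s -> inS (aug (pfun K) s).
  have [n] := ubnP (size s); elim: n s => // n IH [|k s].
    by move=> _ _; exists [:: (1, [::])]; rewrite big_seq1 scale1r /monom big_nil.
  rewrite ltnS => sn sp; have /andP[k0 s0] := sp; rewrite aug_cons -scaleN1r.
  apply: inD; first exact/inP/IH.
  apply/inZ/inS_sum => u us; apply: IH; first by rewrite (size_bumps us).
  exact: bumps_positive us.
have [l [/allP lp ->]] := aug_span K_char0 f.
by apply: inS_sum => x /lp xp; apply/inZ/inA.
Qed.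

Lemma monom_free (B : comNzRingType) (iota : {rmorphism K -> B}) (g : nat -> B)
    (l : seq (K * seq nat)) :
  all (fun x => positive x.2) l -> \sum_(x <- l) x.1 *: monom (pfun K) x.2 = 0 ->
  \sum_(x <- l) iota x.1 * monom g x.2 = 0.
Proof.
move=> lp l0.
have [L LE] : {L : seq nat -> seq (seq nat) & forall s, positive s -> all positive (L s) /\
    forall (C : comNzRingType) (h : nat -> C), monom h s = \sum_(u <- L s) aug h u}.
  apply: (@choice _ _ (fun s Ls => positive s -> all positive Ls /\
    forall (C : comNzRingType) (h : nat -> C), monom h s = \sum_(u <- Ls) aug h u)) => s.
  case: (boolP (positive s)) => [sp|_]; last by exists [::].
  have [Ls /allP p E] := monom_aug sp; exists (s :: Ls) => _; split.
    by rewrite /= sp; apply/allP => u /p /andP[].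
  by move=> C h; rewrite big_cons E.
pose l' := flatten [seq [seq (x.1, u) | u <- L x.2] | x <- l].
have lE (C : comNzRingType) (j : {rmorphism K -> C}) (h : nat -> C) :
   \sum_(x <- l) j x.1 * monom h x.2 = \sum_(x <- l') j x.1 * aug h x.2.
  rewrite big_flatten big_map; apply: eq_big_seq => x xl; rewrite big_map.
  by rewrite (LE _ (allP lp x xl)).2 mulr_sumr.
rewrite lE; apply: aug_free.
  apply/allP => y /flatten_mapP[x xl /mapP[u uL ->]] /=.
  exact: (allP (LE _ (allP lp x xl)).1).
have := lE _ (in_alg (symfun K)) (pfun K).
under eq_bigr => x _ do rewrite /= mulr_algl.
under [in RHS]eq_bigr => x _ do rewrite /= mulr_algl.
by move=> <-.
Qed.

End Generic.

Section Universal.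
Variables (K : fieldType) (q : K).
Hypothesis q_generic : generic q.
Variables (B : comNzRingType) (iota : {rmorphism K -> B}) (g : nat -> B).

(** A symmetric function is evaluated through any expression in the power sums; by
[monom_free] the expressions agree. *)
Definition symeval_graph (f : symfun K) (b : B) : Prop :=
  exists l : seq (K * seq nat), [/\ all (fun x => positive x.2) l,
    f = \sum_(x <- l) x.1 *: monom (pfun K) x.2 &
    b = \sum_(x <- l) iota x.1 * monom g x.2].

Lemma symeval_graph_ex f : exists b, symeval_graph f b.
Proof. by have [l [lp ->]] := monom_span q_generic f; eexists; exists l. Qed.

Lemma symeval_graphZD c f b f' b' : symeval_graph f b -> symeval_graph f' b' ->
  symeval_graph (c *: f + f') (iota c * b + b').
Proof.
move=> [l [lp -> ->]] [m [mp -> ->]].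
exists ([seq (c * x.1, x.2) | x <- l] ++ m); split.
- by rewrite all_cat all_map lp mp.
- rewrite big_cat big_map scaler_sumr; congr (_ + _).
  by apply: eq_bigr => x _; rewrite scalerA.
rewrite big_cat big_map mulr_sumr; congr (_ + _).
by apply: eq_bigr => x _; rewrite rmorphM mulrA.
Qed.

Lemma symeval_graphM f b f' b' : symeval_graph f b -> symeval_graph f' b' ->
  symeval_graph (f * f') (b * b').
Proof.
move=> [l [/allP lp -> ->]] [m [/allP mp -> ->]].
exists [seq (x.1 * y.1, x.2 ++ y.2) | x <- l, y <- m]; split.
- apply/allP => z /allpairsP[[x y] [xl ym ->]] /=.
  by rewrite /positive all_cat [all _ _]lp // [all _ _]mp.
- rewrite big_allpairs_dep mulr_suml; apply: eq_bigr => x _; rewrite mulr_sumr.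
  by apply: eq_bigr => y _; rewrite monom_cat -scalerAl -scalerAr scalerA.
rewrite big_allpairs_dep mulr_suml; apply: eq_bigr => x _; rewrite mulr_sumr.
by apply: eq_bigr => y _; rewrite monom_cat rmorphM; ring.
Qed.

Lemma symeval_graph_fun f b b' : symeval_graph f b -> symeval_graph f b' -> b = b'.
Proof.
move=> fb fb'; have := symeval_graphZD (-1) fb fb'.
rewrite scaleN1r addNr rmorphN rmorph1 mulN1r => -[l [lp /esym l0]].
rewrite (monom_free q_generic iota g lp l0) => /eqP.
by rewrite addrC subr_eq0 => /eqP.
Qed.

Definition symeval (f : symfun K) : B := sval (cid (symeval_graph_ex f)).

Lemma symevalP f b : symeval_graph f b -> symeval f = b.
Proof. by apply: symeval_graph_fun; rewrite /symeval; case: cid. Qed.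

Lemma symeval_val f : symeval_graph f (symeval f).
Proof. by rewrite /symeval; case: cid. Qed.

Lemma symevalZ c f : symeval (c *: f) = iota c * symeval f.
Proof.
apply: symevalP; rewrite -[c *: f]addr0 -[_ * _]addr0.
by apply: symeval_graphZD (symeval_val f) _; exists [::]; rewrite !big_nil.
Qed.

Lemma symeval_p k : (0 < k)%N -> symeval (pfun K k) = g k.
Proof.
move=> k0; apply: symevalP; exists [:: (1, [:: k])].
by rewrite /positive /= k0 !big_seq1 scale1r rmorph1 mul1r /monom !big_seq1.
Qed.

Fact symeval_additive : additive symeval.
Proof.
move=> f f'; apply: symevalP.
have -> : f - f' = -1 *: f' + f by rewrite scaleN1r addrC.
have -> : symeval f - symeval f' = iota (-1) * symeval f' + symeval f.
  by rewrite rmorphN rmorph1 mulN1r addrC.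
exact: symeval_graphZD (symeval_val _) (symeval_val _).
Qed.
HB.instance Definition _ :=
  GRing.isAdditive.Build (symfun K) B symeval symeval_additive.

Fact symeval_multiplicative : multiplicative symeval.
Proof.
split=> [f f'|].
  by apply: symevalP; apply: symeval_graphM (symeval_val _) (symeval_val _).
apply: symevalP; exists [:: (1, [::])].
by rewrite !big_seq1 scale1r rmorph1 mul1r /monom !big_nil.
Qed.
HB.instance Definition _ :=
  GRing.isMultiplicative.Build (symfun K) B symeval symeval_multiplicative.

End Universal.

Section Endo.
Variables (K : fieldType) (q : K) (q_generic : generic q) (g : nat -> symfun K).

Definition symendo : symfun K -> symfun K :=
  symeval q_generic (in_alg (symfun K)) g.
HB.instance Definition _ := GRing.RMorphism.on symendo.
Fact symendo_scalable : scalable symendo.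
Proof. by move=> c f; rewrite /symendo symevalZ /= mulr_algl. Qed.
HB.instance Definition _ :=
  GRing.isScalable.Build K (symfun K) (symfun K) _ symendo symendo_scalable.

Lemma symendo_p k : (0 < k)%N -> symendo (pfun K k) = g k.
Proof. exact: symeval_p. Qed.

End Endo.

Section Generated.
Variables (K : fieldType) (q : K) (q_generic : generic q).

Lemma symfun_p_ind (P : symfun K -> Prop) :
  P 1 -> (forall c f f', P f -> P f' -> P (c *: f + f')) ->
  (forall k f, (0 < k)%N -> P f -> P (pfun K k * f)) -> forall f, P f.
Proof.
move=> P1 PZD PM f; have P0 : P 0 by have := PZD (-1) _ _ P1 P1; rewrite scaleN1r addNr.
have Pm s : positive s -> P (monom (pfun K) s).
  elim: s => [_|k s IH /= /andP[k0 /IH Ps]]; first by rewrite /monom big_nil.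
  by rewrite monom_cons; apply: PM.
have [l [lp ->]] := monom_span q_generic f.
elim: l lp => [_|x l IH /= /andP[xp /IH Pl]]; first by rewrite big_nil.
by rewrite big_cons; apply: PZD => //; apply: Pm.
Qed.

Lemma plethysm_p (c : nat -> K) k : (0 < k)%N -> plethysm c (pfun K k) = c k *: pfun K k.
Proof.
move=> k0; rewrite /plethysm; case: pselect => [ex|[]]; first by case: cid => /= phi ->.
exists (symendo q_generic (fun r => c r *: pfun K r) : {lrmorphism _ -> _}) => r r0.
exact: symendo_p.
Qed.

End Generated.

(** * Free generators *)

Lemma mcoeffXM (K : comNzRingType) n (u m : 'X_{1..n}) (p : {mpoly K[n]}) :
  ('X_[u] * p)@_m = if (u <= m)%MM then p@_(m - u)%MM else 0.
Proof.
have E v : ('X_[u] * 'X_[v] : {mpoly K[n]})@_m = if (u <= m)%MM then ('X_[K, v])@_(m - u)%MM else 0.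
  rewrite -mpolyXD !mcoeffX; case: ifP => um.
    congr (nat_of_bool _)%:R; apply/eqP/eqP => [<-|->]; last by rewrite addmC submK.
    by rewrite addmC addmK.
  case: eqP => // e; case/negP: (negbT um); rewrite -e; apply/mnm_lepP => i.
  by rewrite mnmDE leq_addr.
rewrite [p]mpolyE mulr_sumr !raddf_sum /=.
case: ifP => um; last first.
  by rewrite big1 // => v _; rewrite -scalerAr mcoeffZ E um mulr0.
by apply: eq_bigr => v _; rewrite -scalerAr !mcoeffZ E um.
Qed.

(** At a monomial x^m of degree d + 1, the right side counts the pairs of a variable
x_j and an exponent between 1 and m_j. *)
Lemma newton_h (K : comNzRingType) : newton (pfun K) (hfun K).
Proof.
split=> [|d]; apply: symfun_eq => n.
  by apply/mpolyP => m; rewrite mcoeff_hsum mcoeff1 mdeg_eq0.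
rewrite -[LHS]/(symfun_ev n _) -[RHS]/(symfun_ev n _) raddfMn raddf_sum /=.
apply/mpolyP => m; rewrite mcoeffMn /symfun_ev mcoeff_hsum raddf_sum /=.
under eq_bigr => i _ do rewrite mulr_suml raddf_sum /=.
rewrite exchange_big /=.
rewrite (eq_bigr (fun j : 'I_n => if mdeg m == d.+1 then (m j)%:R else 0)).
  case: eqP => md; last by rewrite mul0rn big1.
  by rewrite -natr_sum -mdegE md.
move=> j _; rewrite (eq_bigr (fun i : 'I_d.+1 => if mdeg m == d.+1 then (i < m j)%:R else 0)).
  case: eqP => md; last by rewrite big1.
  have mj : (m j <= d.+1)%N by rewrite -md mdegE (bigD1 j) //= leq_addr.
  rewrite -natr_sum; congr _%:R.
  rewrite (eq_bigr (fun i : 'I_d.+1 => if (i < m j)%N then 1%N else 0%N)) => [|i _].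
    by rewrite -big_mkcond (big_ord_narrow mj) sum1_card card_ord.
  by case: ltnP.
move=> i _; rewrite mpolyXn mcoeffXM mcoeff_hsum.
have lem : (U_(j) *+ i.+1 <= m)%MM = (i < m j)%N.
  apply/mnm_lepP/idP => [/(_ j)|im l]; first by rewrite mulmnE mnm1E eqxx mul1n.
  by rewrite mulmnE mnm1E; case: eqP => [<-|_]; rewrite ?mul1n ?mul0n.
rewrite lem; case: ifP => im; last by rewrite if_same.
have : (mdeg (m - U_(j) *+ i.+1)%MM + i.+1 = mdeg m)%N.
  have um : (U_(j) *+ i.+1 <= m)%MM by rewrite lem.
  by rewrite -[in RHS](submK um) mdegD mdegMn mdeg1 mul1n.
have := ltn_ord i; case: (eqVneq (mdeg m)) => md ltid e.
  by rewrite (_ : mdeg _ == _) //; apply/eqP; lia.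
by rewrite (_ : (mdeg _ == _) = false) //; apply/eqP; move/eqP: md; lia.
Qed.

Section FreeGens.
Variables (K : fieldType).

(** Generation as an induction principle and freeness as a universal property: the
two forms in which they are used and in which they pass from one sequence to
another. *)
Definition free_gens (x : nat -> symfun K) : Prop :=
  (forall P : symfun K -> Prop, P 1 ->
     (forall c f f', P f -> P f' -> P (c *: f + f')) ->
     (forall k f, (0 < k)%N -> P f -> P (x k * f)) -> forall f, P f) /\
  (forall (B : comNzRingType) (iota : {rmorphism K -> B}) (g : nat -> B),
     exists phi : {rmorphism symfun K -> B},
       (forall c f, phi (c *: f) = iota c * phi f) /\
       forall k, (0 < k)%N -> phi (x k) = g k).

Variables (q : K) (q_generic : generic q).

Lemma free_gens_p : free_gens (pfun K).
Proof.
split=> [|B iota g]; first exact: symfun_p_ind q_generic.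
exists (symeval q_generic iota g); split; first exact: symevalZ.
exact: symeval_p.
Qed.

Lemma torsion_free_alg (B : comNzRingType) (iota : {rmorphism K -> B}) : torsion_free B.
Proof.
move=> n b nb; rewrite -[b]mul1r -(rmorph1 iota).
rewrite -(mulVf (generic_char0 q_generic n)) rmorphM rmorph_nat -mulrA mulr_natl nb.
by rewrite mulr0.
Qed.

(** Newton's identities express a_n through p_n and p_n through a_n modulo lower
terms; the values of a homomorphism at the p_n are found by [newton_ex] from
those at the a_n. *)
Lemma newton_free_gens (c d : nat -> K) (a : nat -> symfun K) :
  (forall r, (0 < r)%N -> c r != 0) -> (forall n, (0 < n)%N -> d n != 0) ->
  newton (fun r => c r *: pfun K r) a -> free_gens (fun n => d n *: a n).
Proof.
move=> c0 d0 na; have [a0 aP] := na; split=> [P P1 PZD PM f|B iota b].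
  pose Q f := forall g, P g -> P (f * g).
  have P0 : P 0 by have := PZD (-1) _ _ P1 P1; rewrite scaleN1r addNr.
  have QZD e u v : Q u -> Q v -> Q (e *: u + v).
    by move=> Qu Qv g Pg; rewrite mulrDl -scalerAl; apply: PZD; [apply: Qu|apply: Qv].
  have Q0 : Q 0 by move=> g _; rewrite mul0r.
  have QM u v : Q u -> Q v -> Q (u * v).
    by move=> Qu Qv g Pg; rewrite -mulrA; apply/Qu/Qv.
  have Qa k : (0 < k)%N -> Q (a k).
    move=> k0 g Pg; have := PZD (d k)^-1 _ _ (PM k g k0 Pg) P0.
    by rewrite addr0 -scalerAl scalerA mulVf ?d0 // scale1r.
  have Qp k : (0 < k)%N -> Q (pfun K k).
    elim/ltn_ind: k => -[//|k] IH _.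
    have := aP k; rewrite big_ord_recr /= subnn a0 mulr1 => e.
    have -> : pfun K k.+1 = (c k.+1)^-1 *: (k.+1%:R *: a k.+1
        + - 1 *: \sum_(i < k) c i.+1 *: pfun K i.+1 * a (k - i)%N) + 0.
      rewrite scaler_nat e addr0 scaleN1r [X in X - _]addrC addrK.
      by rewrite scalerA mulVf ?c0 // scale1r.
    apply: (QZD) => //; apply: (QZD); first exact: Qa.
    rewrite -[X in Q X]addr0; apply: (QZD) => //; apply: (big_ind Q) => // [u v Qu Qv|i _].
      by rewrite -[u]scale1r; apply: (QZD).
    rewrite -scalerAl -[X in Q X]addr0; apply/QZD => //; apply: (QM).
      by apply: IH; rewrite // ltnS.
    by apply: Qa; rewrite subn_gt0.
  rewrite -[f]mulr1; move: f 1 P1; apply: (free_gens_p.1 Q).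
  - by move=> g; rewrite mul1r.
  - exact: QZD.
  - by move=> k f k0; apply: (QM); apply: Qp.
(* The values forced on the [a n], completed by 1 at index 0. *)
pose b' n : B := if n is 0%N then 1 else iota (d n)^-1 * b n.
have [r rP] : exists r, newton r b' by apply: newton_ex.
have [phi [phiZ phip]] := free_gens_p.2 B iota (fun n => iota (c n)^-1 * r n).
exists phi; split=> // k k0; rewrite phiZ.
have -> : phi (a k) = b' k.
  apply: (newton_uniq (torsion_free_alg iota) (newton_map phi na) rP) => n /=.
  by rewrite phiZ phip // mulrA -rmorphM mulfV ?c0 // rmorph1 mul1r.
by case: k k0 => // k _; rewrite /= mulrA -rmorphM mulfV ?d0 // rmorph1 mul1r.
Qed.

End FreeGens.

(** ** Coordinates on the monomials in free generators *)

Section Coordinates.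
Variables (K : fieldType) (x : nat -> symfun K) (x_free : free_gens x).

Lemma free_gens_span (f : symfun K) : exists l : seq (K * seq nat),
  all (fun y => positive y.2) l /\ f = \sum_(y <- l) y.1 *: monom x y.2.
Proof.
move: f; apply: (x_free.1 (fun f => exists l : seq (K * seq nat),
  all (fun y => positive y.2) l /\ f = \sum_(y <- l) y.1 *: monom x y.2)).
- by exists [:: (1, [::])]; rewrite big_seq1 scale1r /monom big_nil.
- move=> c _ _ [l [lp ->]] [m [mp ->]]; exists ([seq (c * y.1, y.2) | y <- l] ++ m).
  rewrite all_cat all_map big_cat big_map scaler_sumr lp mp; split=> //; congr (_ + _).
  by apply: eq_bigr => y _; rewrite scalerA.
move=> k _ k0 [l [/allP lp ->]]; exists [seq (y.1, k :: y.2) | y <- l]; split.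
  by rewrite all_map; apply/allP => y yl /=; rewrite /positive /= k0; apply: lp.
by rewrite big_map mulr_sumr; apply: eq_bigr => y _; rewrite monom_cons scalerAr.
Qed.

Definition coord_gens N (k : nat) : {mpoly K[N]} :=
  if insub k.-1 is Some i then 'X_i else 0.

(** Freeness lets [x] be mapped to the variables. Their number is finite, and
generators with a larger index go to 0. *)
Definition coordm N : {rmorphism symfun K -> {mpoly K[N]}} :=
  sval (cid (x_free.2 _ (@mpolyC N K) (coord_gens N))).

Lemma coordmZ N c f : coordm N (c *: f) = c *: coordm N f.
Proof. by rewrite /coordm; case: cid => phi /= [-> _]; rewrite mul_mpolyC. Qed.

Lemma coordm_gen N k : (0 < k)%N -> coordm N (x k) = coord_gens N k.
Proof. by move=> k0; rewrite /coordm; case: cid => phi /= [_ ->]. Qed.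

Definition mult N (s : seq nat) : 'X_{1..N} := [multinom count_mem i.+1 s | i < N].

Lemma coordm_monom N s : positive s ->
  coordm N (monom x s) = if all (fun k => k <= N)%N s then 'X_[mult N s] else 0.
Proof.
elim: s => [_|k s IH /= /andP[k0 sp]].
  rewrite /monom big_nil rmorph1 /= (_ : mult N [::] = 0%MM) ?mpolyX0 //.
rewrite monom_cons rmorphM coordm_gen // IH // /coord_gens.
case: k k0 => //= k _; case: insubP => [i ki ki'|]; last first.
  by rewrite -leqNgt ltnNge => ->; rewrite mul0r.
rewrite ki /=; case: ifP => _; last by rewrite mulr0.
rewrite -mpolyXD; congr 'X_[_]; apply/mnmP => j; rewrite !mnmE /= -ki'.
by rewrite eqSS -val_eqE.
Qed.

(** The coefficient of the monomial [monom x la]. *)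
Definition coordp (la : seq nat) (f : symfun K) : K :=
  (coordm (sumn la) f)@_(mult (sumn la) la).

Lemma coordpZD la c f f' : coordp la (c *: f + f') = c * coordp la f + coordp la f'.
Proof. by rewrite /coordp rmorphD coordmZ mcoeffD mcoeffZ. Qed.

Lemma coordp0 la : coordp la 0 = 0.
Proof. by rewrite /coordp rmorph0 mcoeff0. Qed.

Lemma leq_sumn k s : k \in s -> (k <= sumn s)%N.
Proof.
elim: s => // a s IH; rewrite inE => /orP[/eqP->|/IH le] /=; first exact: leq_addr.
exact: leq_trans le (leq_addl _ _).
Qed.

Lemma coordp_monom la s : positive la -> positive s ->
  coordp la (monom x s) = (perm_eq la s)%:R.
Proof.
move=> lap sp; rewrite /coordp coordm_monom //; case: ifP => sN.
  rewrite mcoeffX; congr (nat_of_bool _)%:R; apply/eqP/idP => [/mnmP e|ps].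
    rewrite perm_sym; apply/allP => k; rewrite mem_cat => ks /=; apply/eqP.
    have [k0 kN] : (0 < k)%N /\ (k <= sumn la)%N.
      case/orP: ks => ks; split; first exact: (allP sp).
      - exact: (allP sN).
      - exact: (allP lap).
      - exact: leq_sumn.
    case: k k0 kN ks => // k _ kN _.
    by have := e (Ordinal kN); rewrite !mnmE.
  by apply/mnmP => i; rewrite !mnmE; move/seq.permP: ps => ->.
rewrite mcoeff0; case: (boolP (perm_eq la s)) => // ps; case/negP: (negbT sN).
by apply/allP => k; rewrite -(perm_mem ps); apply: leq_sumn.
Qed.

Lemma coordp_sum la (I : Type) (r : seq I) (P : pred I) (c : I -> K) (F : I -> symfun K) :
  coordp la (\sum_(i <- r | P i) c i *: F i) = \sum_(i <- r | P i) c i * coordp la (F i).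
Proof.
elim: r => [|i r IH]; first by rewrite !big_nil coordp0.
by rewrite !big_cons; case: (P i); rewrite // coordpZD IH.
Qed.

End Coordinates.

(** * Partitions *)

Lemma is_part_sort s : positive s -> is_part (sort geq s).
Proof.
move=> sp; rewrite /is_part sort_sorted; last by move=> a b /=; apply: leq_total.
by rewrite /= mem_sort; apply/negP => /(allP sp).
Qed.

Definition part_of (s : seq nat) : intpart := insubd (row_part 0) (sort geq s).

Lemma part_ofE s : positive s -> val (part_of s) = sort geq s.
Proof. by move=> sp; rewrite val_insubd is_part_sort. Qed.

Lemma part_perm s : positive s -> perm_eq (val (part_of s)) s.
Proof. by move=> sp; rewrite part_ofE // perm_sort. Qed.

Lemma part_positive (la : intpart) : positive (val la).
Proof.
case/andP: (valP la) => _ nz; apply/allP => k kl /=; rewrite lt0n.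
by apply: contraNneq nz => <-.
Qed.

Lemma perm_part (la mu : intpart) : perm_eq (val la) (val mu) -> la = mu.
Proof.
move=> p; apply: val_inj; apply: (sorted_eq (leT := geq)) => //.
- by move=> a b c /= ab bc; apply: leq_trans bc ab.
- by move=> a b /andP[/= ab ba]; apply/eqP; rewrite eqn_leq ab ba.
- by case/andP: (valP la).
- by case/andP: (valP mu).
Qed.

Lemma part_of_val (la : intpart) : part_of (val la) = la.
Proof. exact/perm_part/part_perm/part_positive. Qed.

Lemma eq_part_of s la : positive s -> (part_of s == la) = perm_eq s (val la).
Proof.
move=> sp; have p := part_perm sp; apply/eqP/idP => [<-|e]; first by rewrite perm_sym.
by apply: perm_part; apply: perm_trans p e.
Qed.

Lemma monom_perm (B : comNzRingType) (g : nat -> B) s s' :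
  perm_eq s s' -> monom g s = monom g s'.
Proof. exact: perm_big. Qed.

Section Basis.
Variables (K : fieldType) (x : nat -> symfun K) (x_free : free_gens x).

Lemma has_coordsE (f : symfun K) (c : intpart -> K) :
  has_coords (fun la : intpart => monom x (val la)) f c ->
  forall la, c la = coordp x_free (val la) f.
Proof.
move=> [s [us s0 ->]] la; rewrite coordp_sum.
rewrite (eq_bigr (fun mu => if mu == la then c la else 0)) => [|mu _]; last first.
  rewrite coordp_monom ?part_positive //; case: eqP => [->|n].
    by rewrite perm_refl mulr1.
  rewrite (_ : perm_eq _ _ = false) ?mulr0 //; apply/negP => /perm_part e.
  by case: n.
rewrite -big_mkcond; case: (boolP (la \in s)) => [las|/s0 ->]; last by rewrite big1.
by rewrite -big_filter filter_pred1_uniq // big_seq1.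
Qed.

Lemma has_coords_ex (f : symfun K) : exists c,
  has_coords (fun la : intpart => monom x (val la)) f c.
Proof.
have [l [/allP lp ->]] := free_gens_span x_free f.
pose P := [seq part_of y.2 | y <- l].
exists (fun la => \sum_(y <- l | part_of y.2 == la) y.1), (undup P).
split=> [|la|]; first exact: undup_uniq.
  rewrite mem_undup => laP; rewrite big_seq_cond big1 // => y /andP[yl /eqP e].
  by case/negP: laP; rewrite -e; apply/map_f.
transitivity (\sum_(y <- l) y.1 *: monom x (val (part_of y.2))).
  by apply: eq_big_seq => y /lp yp; rewrite (monom_perm _ (part_perm yp)).
under [RHS]eq_bigr => la _ do rewrite scaler_suml.
rewrite (exchange_big_dep predT) //=; apply: eq_big_seq => y yl.
rewrite -(big_filter _ (fun la => part_of y.2 == la)).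
rewrite (eq_filter (a2 := pred1 (part_of y.2))) => [|la]; last by rewrite /= eq_sym.
rewrite filter_pred1_uniq ?undup_uniq ?big_seq1 // mem_undup.
exact: map_f.
Qed.

Lemma monom_basis : is_basis (fun la : intpart => monom x (val la)).
Proof.
move=> f; split; first exact: has_coords_ex.
by move=> c c' fc fc' la; rewrite (has_coordsE fc) (has_coordsE fc').
Qed.

Lemma coordp_eq0 f : (forall la : intpart, coordp x_free (val la) f = 0) -> f = 0.
Proof.
move=> f0; have [c fc] := has_coords_ex f; have cE := has_coordsE fc.
case: fc => s [_ _ ->]; rewrite big1 // => la _.
by rewrite cE f0 scale0r.
Qed.

(** A derivation D is the same as a homomorphism f |-> f + D f X to polynomials
modulo X^2, and freeness provides homomorphisms. *)
Lemma derivation_ex (v : nat -> symfun K) : exists D : {linear symfun K -> symfun K},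
  (forall f g, D (f * g) = D f * g + f * D g) /\ forall k, (0 < k)%N -> D (x k) = v k.
Proof.
have [phi [phiZ phix]] := x_free.2 {poly symfun K} (polyC \o in_alg (symfun K))
  (fun k => (x k)%:P + (v k)%:P * 'X).
have phi0 f : (phi f)`_0 = f.
  move: f; apply: (x_free.1 (fun f => (phi f)`_0 = f)).
  - by rewrite rmorph1 coef1.
  - move=> c f f' fE fE'.
    by rewrite rmorphD coefD phiZ /= coefCM mulr_algl fE fE'.
  - move=> k f k0 fE; rewrite rmorphM coef0M fE phix // coefD coefC coefMX /=.
    by rewrite addr0.
pose D f := (phi f)`_1.
have Dl : linear D.
  by move=> c f f'; rewrite /D rmorphD coefD phiZ /= coefCM mulr_algl.
pose DL : {linear symfun K -> symfun K} :=
  HB.pack D (GRing.isLinear.Build K (symfun K) (symfun K) _ D Dl).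
exists DL; split=> [f g|k k0] /=.
  rewrite /D rmorphM coefM !big_ord_recl big_ord0 /= addr0 !phi0.
  by rewrite addrC.
by rewrite /D phix // coefD coefC coefMX /= coefC add0r.
Qed.

Definition free_derivation v : {linear symfun K -> symfun K} := sval (cid (derivation_ex v)).

Lemma free_derivationM v f g :
  free_derivation v (f * g) = free_derivation v f * g + f * free_derivation v g.
Proof. by rewrite /free_derivation; case: cid => D []. Qed.

Lemma free_derivationE v k : (0 < k)%N -> free_derivation v (x k) = v k.
Proof. by move=> k0; rewrite /free_derivation; case: cid => D /= [_ ->]. Qed.

Lemma derivation1 (D : symfun K -> symfun K) :
  (forall f g, D (f * g) = D f * g + f * D g) -> D 1 = 0.
Proof.
move=> DM; have := DM 1 1; rewrite !mulr1 mul1r => e.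
by apply: (addrI (D 1)); rewrite addr0 -e.
Qed.

Lemma derivation_uniq (D E : {linear symfun K -> symfun K}) :
  (forall f g, D (f * g) = D f * g + f * D g) ->
  (forall f g, E (f * g) = E f * g + f * E g) ->
  (forall k, (0 < k)%N -> D (x k) = E (x k)) -> D =1 E.
Proof.
move=> DM EM DE f; move: f; apply: (x_free.1 (fun f => D f = E f)).
- by rewrite !derivation1.
- by move=> c f f' e e'; rewrite !linearP e e'.
- by move=> k f k0 e; rewrite DM EM DE // e.
Qed.

End Basis.

(** * Dominance order *)

Section Dominance.
Local Open Scope nat_scope.

(** The number of cells of the diagram of [s] to the right of column [c]. *)
Definition excess (c : nat) (s : seq nat) : nat := \sum_(k <- s) (k - c).

Lemma excess0 s : excess 0 s = sumn s.
Proof. by rewrite sumnE; apply: eq_bigr => k _; rewrite subn0. Qed.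

Lemma excess_perm c s s' : perm_eq s s' -> excess c s = excess c s'.
Proof. exact: perm_big. Qed.

Lemma excess_pos c s : excess c [seq k <- s | 0 < k] = excess c s.
Proof. by rewrite /excess big_filter [RHS](bigID (ltn 0)) /= [X in _ = _ + X]big1 ?addn0 // => -[]. Qed.

Lemma excessS c s : excess c s = excess c.+1 s + count (ltn c) s.
Proof.
rewrite /excess; elim: s => [|k s IH]; first by rewrite !big_nil.
by rewrite !big_cons IH /=; case: ltnP; lia.
Qed.

(** Second differences of the excess are the multiplicities. *)
Lemma excess_inj s s' : positive s -> positive s' ->
  (forall c, excess c s = excess c s') -> perm_eq s s'.
Proof.
move=> sp sp' e.
have cE c : count (ltn c) s = count (ltn c) s'.
  by apply/eqP; rewrite -(eqn_add2l (excess c.+1 s)) -excessS e excessS e.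
have cm (u : seq nat) k : count_mem k.+1 u + count (ltn k.+1) u = count (ltn k) u.
  by elim: u => //= a u IH; rewrite -IH; case: (ltngtP k.+1 a); case: (ltnP k a); lia.
apply/allP => k; rewrite mem_cat => ks; apply/eqP.
have : 0 < k by case/orP: ks => ks; [apply: (allP sp) | apply: (allP sp')].
by case: k {ks} => // k _; have := cm s k; have := cm s' k; rewrite !cE; lia.
Qed.

(** With [sumn_take_nth] and [excess_take], which give equality for suitable c or k,
this makes partial sums and excesses Legendre dual to each other: an inequality
between all the former is one between all the latter. *)
Lemma sumn_take_le k c s : sumn (take k s) <= k * c + excess c s.
Proof.
elim: s k => [|a s IH] [|k] //=; rewrite /excess big_cons -/(excess c s).
by have := IH k; rewrite mulSn; lia.
Qed.

Lemma sorted_geq_cons a s : sorted geq (a :: s) -> all (geq a) s /\ sorted geq s.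
Proof.
move=> /= p; split; last exact: path_sorted p.
by apply: order_path_min p => x y z /= ab bc; apply: leq_trans bc ab.
Qed.

Lemma excess_small c s : all (geq c) s -> excess c s = 0.
Proof. by move/allP => h; rewrite /excess big1_seq // => k /andP[_ /h /=]; lia. Qed.

Lemma sumn_take_nth k s : sorted geq s ->
  sumn (take k s) = k * nth 0 s k + excess (nth 0 s k) s.
Proof.
elim: s k => [|a s IH] [|k] srt.
- by rewrite /excess big_nil.
- by rewrite /= muln0 /excess big_nil.
- rewrite /= mul0n add0n /excess big_cons subnn add0n -/(excess a s) excess_small //.
  by case: (sorted_geq_cons srt).
have [al ss] := sorted_geq_cons srt; rewrite /= IH // /excess big_cons mulSn.
have : nth 0 s k <= a.
  by case: (ltnP k (size s)) => ks; [apply: (allP al); apply: mem_nth | rewrite nth_default].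
lia.
Qed.

Lemma excess_take c s : sorted geq s ->
  sumn (take (count (ltn c) s) s) = count (ltn c) s * c + excess c s.
Proof.
elim: s => [|a s IH] srt; first by rewrite /excess big_nil.
have [al ss] := sorted_geq_cons srt; rewrite /excess big_cons -/(excess c s) /=.
case: ltnP => ca /=; first by rewrite add1n /= IH // mulSn; lia.
have ->: count (ltn c) s = 0.
  by apply/eqP; rewrite -leqn0 leqNgt -has_count; apply/hasPn => x /(allP al) /=; lia.
rewrite /= mul0n excess_small; first by lia.
by apply/allP => x /(allP al) /=; lia.
Qed.

(** Dominance, tested on excesses instead of partial sums, which do not depend on
the order of the list. *)
Definition excess_dom (nu mu : seq nat) : Prop :=
  forall c, excess c mu <= excess c nu.

Lemma excess_dom_take nu mu : sorted geq mu ->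
  (forall k, sumn (take k mu) <= sumn (take k nu)) -> excess_dom nu mu.
Proof.
move=> smu h c; have := h (count (ltn c) mu).
by have := sumn_take_le (count (ltn c) mu) c nu; rewrite excess_take //; lia.
Qed.

Lemma take_excess_dom nu mu k : sorted geq nu -> excess_dom nu mu ->
  sumn (take k mu) <= sumn (take k nu).
Proof.
move=> snu h; rewrite (sumn_take_nth k snu).
by have := sumn_take_le k (nth 0 nu k) mu; have := h (nth 0 nu k); lia.
Qed.

Lemma excess_dom_trans la mu nu : excess_dom la mu -> excess_dom mu nu -> excess_dom la nu.
Proof. by move=> h h' c; apply: leq_trans (h' c) (h c). Qed.

Lemma excess_dom_antisym (la mu : intpart) :
  excess_dom (val la) (val mu) -> excess_dom (val mu) (val la) -> la = mu.
Proof.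
move=> h h'; apply/perm_part/excess_inj; try exact: part_positive.
by move=> c; apply/eqP; rewrite eqn_leq h h'.
Qed.

(** Induction downwards along dominance terminates because the sum of all excesses
is bounded on the partitions of a given number. *)
Lemma excess_dom_ind (P : intpart -> Prop) :
  (forall mu, (forall nu, excess_dom (val nu) (val mu) -> nu <> mu ->
     sumn (val nu) = sumn (val mu) -> P nu) -> P mu) -> forall mu, P mu.
Proof.
move=> step mu; have [n mun] : exists n, sumn (val mu) = n by eexists.
(* The measure of the induction: G increases along dominance and is at most n * n. *)
pose G (nu : intpart) := \sum_(c < n) excess c (val nu).
have Gle nu : sumn (val nu) = n -> G nu <= n * n.
  move=> nun; apply: leq_trans (_ : \sum_(c < n) n <= _); last by rewrite sum_nat_const card_ord.
  apply: leq_sum => c _; apply: (@leq_trans (excess 0 (val nu))).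
    by rewrite /excess; apply: leq_sum => k _; rewrite subn0 leq_subr.
  by rewrite excess0 nun.
have [m mP] := ubnP (n * n - G mu).
elim: m mu mP mun => // m IH ka kaP kan; apply: step => nu nuka ne nun.
apply: IH; last by rewrite nun.
have lt : G ka < G nu; last by have := Gle nu; rewrite nun => /(_ kan); lia.
rewrite ltnNge; apply/negP => le; apply: ne; apply: excess_dom_antisym => // c.
case: (ltnP c n) => cn; last first.
  rewrite [X in X <= _]excess_small //; apply/allP => k ks /=; apply: leq_trans cn.
  by rewrite -kan -nun; apply: leq_sumn.
rewrite leqNgt; apply/negP => lt; move: le; rewrite leqNgt => /negP; apply.
rewrite /G (bigD1 (Ordinal cn)) //= [X in _ < X](bigD1 (Ordinal cn)) //=.
by rewrite -addSn leq_add //; apply: leq_sum => i _; apply: nuka.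
Qed.

(** ** Conjugate partitions *)

Lemma conj_part_nth s j : nth 0 (conj_part s) j =
  if j < head 0 s then count (ltn j) s else 0.
Proof.
rewrite /conj_part; case: ltnP => js.
  by rewrite (nth_map 0) ?size_iota // nth_iota.
by rewrite nth_default // size_map size_iota.
Qed.

Lemma is_part_conj (la : intpart) : is_part (conj_part (val la)).
Proof.
apply/andP; split.
  have srt m n : sorted geq [seq count (ltn j) (val la) | j <- iota m n].
    elim: n m => // -[|n] IH m //; have /= := IH m.+1 => ->; rewrite andbT.
    by apply: sub_count => x /=; lia.
  exact: srt.
apply/negP => /mapP[j]; rewrite mem_iota add0n => /andP[_ jl] /esym/eqP.
rewrite -leqn0 leqNgt -has_count => /hasPn h; case: (val la) jl h => //= a s ja.
by move/(_ a (mem_head _ _)) => /=; rewrite ja.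
Qed.

Definition conj_intpart (la : intpart) : intpart :=
  exist (fun s => is_true (is_part s)) _ (is_part_conj la).

Lemma head_max (s : seq nat) k : sorted geq s -> k \in s -> k <= head 0 s.
Proof.
case: s => // a s srt; rewrite inE => /orP[/eqP-> //|].
by have [al _] := sorted_geq_cons srt; move/(allP al).
Qed.

Lemma count_sum (s : seq nat) (P : pred nat) : count P s = \sum_(k <- s) P k.
Proof. by elim: s => [|a s IH]; rewrite ?big_nil // big_cons /= IH. Qed.

Lemma sumn_take_conj (s : seq nat) c : sorted geq s ->
  sumn (take c (conj_part s)) + excess c s = sumn s.
Proof.
move=> srt; rewrite -[RHS]excess0.
have -> : sumn (take c (conj_part s)) = \sum_(j <- iota 0 (minn c (head 0 s))) count (ltn j) s.
  by rewrite /conj_part -map_take take_iota sumnE big_map.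
under eq_bigr => j _ do rewrite count_sum.
rewrite exchange_big /= /excess -big_split /=; apply: eq_big_seq => k ks.
have := head_max srt ks; rewrite -[X in X + _]count_sum => kh; rewrite subn0.
have -> m n : count (fun j => j < k) (iota m n) = minn n (k - m).
  by elim: n m => [|n IH] m /=; rewrite ?min0n // IH; case: ltnP; lia.
lia.
Qed.

Lemma excess_conj (s : seq nat) c : sorted geq s ->
  excess c (conj_part s) = sumn (drop c s).
Proof.
move=> srt; rewrite /excess /conj_part big_map.
have cnt j : count (ltn j) s - c = count (ltn j) (drop c s).
  elim: s c srt => [|a s IH] [|c] srt //=; first by rewrite subn0.
  have [al ss] := sorted_geq_cons srt; rewrite -IH //.
  case: ltnP => ja /=; first by lia.
  suff -> : count (ltn j) s = 0 by [].
  apply/eqP; rewrite -leqn0 leqNgt -has_count; apply/hasPn => x /(allP al) /=; lia.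
under eq_bigr => j _ do rewrite cnt count_sum.
rewrite exchange_big sumnE /=; apply: eq_big_seq => k ks.
have kh : k <= head 0 s by apply: head_max => //; apply: mem_drop ks.
rewrite -[LHS]count_sum; have -> m n : count (fun j => j < k) (iota m n) = minn n (k - m).
  by elim: n m => [|n IH] m /=; rewrite ?min0n // IH; case: ltnP; lia.
lia.
Qed.

(** By [excess_conj] the excesses of a conjugate are the tail sums of the rows, and
a larger excess goes with smaller tail sums. *)
Lemma excess_dom_conj (ka mu : intpart) : sumn (val ka) = sumn (val mu) ->
  excess_dom (val ka) (conj_part (val mu)) -> excess_dom (val mu) (conj_part (val ka)).
Proof.
move=> e h c; have /andP[ska _] := valP ka; have /andP[smu _] := valP mu.
have := sumn_take_conj c smu; rewrite (excess_conj c ska).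
have := take_excess_dom c ska h; have : sumn (take c (val ka)) + sumn (drop c (val ka)) = sumn (val ka).
  by rewrite -sumn_cat cat_take_drop.
lia.
Qed.

End Dominance.

(** * Rank one perturbations of a determinant *)

Section RankOne.
Variables (R : comNzRingType) (n : nat).
Implicit Types (U : 'M[R]_n) (a rho : 'I_n -> R).

(** [U] bordered by the column [a], the row [- rho] and the corner 1; row operations with
the corner turn it into [U + a rho] below a trivial border. *)
Definition bordered U a rho : 'M[R]_n.+1 := \matrix_(i, j)
  match unlift ord0 i, unlift ord0 j with
  | None, None => 1
  | None, Some m => - rho m
  | Some k, None => a k
  | Some k, Some m => U k m
  end.

End RankOne.

Lemma det_bordered (R : comNzRingType) n (U : 'M[R]_n) a rho :
  \det (bordered U a rho) = \det U + \sum_m \sum_i rho m * a i * cofactor U i m.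
Proof.
rewrite (expand_det_row _ ord0) big_ord_recl; congr (_ + _).
  rewrite mxE unlift_none mul1r /cofactor addn0 expr0 mul1r; congr (\det _).
  by apply/matrixP => i j; rewrite !mxE !liftK.
apply: eq_bigr => m _; case: n U a rho m => [|n] U a rho m; first by case: m.
rewrite mxE unlift_none liftK /cofactor (expand_det_col _ ord0) !mulr_sumr.
apply: eq_bigr => i _; rewrite !mxE liftK.
have -> : lift (lift ord0 m) ord0 = ord0 :> 'I_n.+2 by apply: val_inj.
rewrite unlift_none /cofactor addn0.
set d1 := \det _; set d2 := \det (row' i (col' m U)).
have -> : d1 = d2.
  congr (\det _); apply/matrixP => k l; rewrite !mxE liftK.
  have -> : lift (lift ord0 m) (lift ord0 l) = lift ord0 (lift m l) :> 'I_n.+2.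
    by apply: val_inj; rewrite /= /bump !leq0n !add1n ltnS addnS.
  by rewrite liftK.
by rewrite /= /bump leq0n add0n add1n exprS exprD; ring.
Qed.

Lemma det_rank_one (R : comNzRingType) n (U : 'M[R]_n) a rho :
  \det (\matrix_(i, j) (U i j + a i * rho j)) =
  \det U + \sum_m \sum_i rho m * a i * cofactor U i m.
Proof.
rewrite -det_bordered.
(* Subtract a_k times the row of the border from row k. *)
pose L : 'M[R]_n.+1 := \matrix_(i, j)
  if unlift ord0 i is Some k then if unlift ord0 j is Some l then (k == l)%:R else - a k
  else (unlift ord0 j == None)%:R.
pose V : 'M[R]_n := \matrix_(i, j) (U i j + a i * rho j).
have LE : L *m bordered U a rho = bordered V (fun=> 0) rho.
  apply/matrixP => i j; rewrite !mxE big_ord_recl !mxE unlift_none.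
  case: (unliftP ord0 i) => [k|] ->; rewrite ?liftK ?unlift_none /=; last first.
    rewrite mul1r big1 ?addr0 // => l _.
    by rewrite !mxE unlift_none liftK mul0r.

  rewrite (bigD1 k) //= !mxE !liftK eqxx mul1r big1 ?addr0; last first.
    by move=> l lk; rewrite !mxE !liftK eq_sym (negPf lk) mul0r.
  by case: (unlift ord0 j) => [m|]; rewrite ?mxE; ring.
have detL : \det L = 1.
  rewrite (expand_det_row _ ord0) big_ord_recl big1 => [|j _].
    rewrite mxE unlift_none eqxx mul1r addr0 /cofactor expr0 mul1r -[RHS](det1 R n).
    by congr (\det _); apply/matrixP => i j; rewrite !mxE !liftK.
  by rewrite mxE unlift_none liftK mul0r.
rewrite -[RHS]mul1r -detL -det_mulmx LE det_bordered -/V.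
by rewrite [X in _ + X]big1 ?addr0 // => m _; rewrite big1 // => i _; rewrite mulr0 mul0r.
Qed.

(** * Macdonald operators *)

Section Shift.
Variables (K : fieldType) (q0 : K) (q0_generic : generic q0).
Implicit Types (c e : nat -> K) (f g : symfun K) (om : nat -> symfun K).

(** f[X + w Y], with p_r[Y] = c_r, as a polynomial in w. *)
Definition shift c : symfun K -> {poly symfun K} :=
  symeval q0_generic (polyC \o in_alg (symfun K))
    (fun r => (pfun K r)%:P + (c r)%:A%:P * 'X^r).
HB.instance Definition _ c := GRing.RMorphism.on (shift c).

Lemma shiftZ c a f : shift c (a *: f) = a%:A%:P * shift c f.
Proof. exact: symevalZ. Qed.

Lemma shift_p c r : (0 < r)%N -> shift c (pfun K r) = (pfun K r)%:P + (c r)%:A%:P * 'X^r.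
Proof. exact: symeval_p. Qed.

Lemma shift_coef0 c f : (shift c f)`_0 = f.
Proof.
move: f; apply: (symfun_p_ind q0_generic) => [|a f g fE gE|k f k0 fE].
- by rewrite rmorph1 coef1.
- by rewrite rmorphD coefD /= shiftZ coefCM mulr_algl fE gE.
rewrite rmorphM coef0M fE /= shift_p // coefD coefC coefCM coefXn /=.
by case: k k0 => //= k _; rewrite mulr0 addr0.
Qed.

(** The coefficients of (1 - t z) / (1 - z). *)
Definition geom_coef (B : comNzRingType) (t : B) (i : nat) : B := if i is 0%N then 1 else 1 - t.

(** Where p_r[Y] e_r = 1 - t^r, the substitution multiplies the generating function
of [a] by (1 - t w z) / (1 - w z). *)
Lemma shift_newton c e (t : K) (a : nat -> symfun K) :
  newton (fun r => e r *: pfun K r) a ->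
  (forall r, (0 < r)%N -> e r * c r = 1 - t ^+ r) ->
  forall n i, (shift c (a n))`_i = if (i <= n)%N then geom_coef t i *: a (n - i)%N else 0.
Proof.
move=> na ec n i.
(* Both sides are solutions of the same Newton identities. *)
have tfP : torsion_free {poly symfun K}.
  exact: (torsion_free_alg q0_generic (polyC \o in_alg (symfun K))).
have E : shift c (a n) = conv (fun n => if n is 0%N then 1 else (1 - t%:A%:P) * 'X ^+ n)
    (polyC \o a) n.
  apply: (newton_uniq tfP (newton_map (shift c) na)
    (newton_prod (newton_geom t%:A%:P 'X) (newton_map _ na))) => m /=.
  rewrite shiftZ shift_p // mulrDr -[_ *: pfun K m.+1]mulr_algl polyCM addrC.
  congr (_ + _); rewrite mulrA; congr (_ * _).
  have -> : t%:A%:P ^+ m.+1 = (t ^+ m.+1)%:A%:P :> {poly symfun K}.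
    exact/esym/(rmorphXn (polyC \o in_alg (symfun K))).
  by rewrite -polyCM mulr_algl scalerA ec // scalerBl scale1r polyCB polyC1.
have gE j : (if j is 0%N then 1 else (1 - t%:A%:P) * 'X ^+ j : {poly symfun K})
    = (geom_coef t j)%:A%:P * 'X^j.
  case: j => [|j] /=; first by rewrite scale1r mulr1.
  by rewrite scalerBl scale1r polyCB polyC1.
rewrite E /conv coef_sum.
under eq_bigr => j _ do rewrite gE /= mulrAC -polyCM coefCM coefXn.
case: leqP => ni.
  have ni1 : (i < n.+1)%N by [].
  rewrite (bigD1 (Ordinal ni1)) //= eqxx mulr1 mulr_algl big1 ?addr0 // => j /negP ji.
  by case: eqP => [e'|_]; rewrite ?mulr0 //; case: ji; apply/eqP/val_inj.
rewrite big1 // => j _; case: eqP => [e'|_]; rewrite ?mulr0 //.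
by have := ltn_ord j; rewrite -e'; lia.
Qed.

(** The coefficient of z^0 in p(1/z) times the generating function of [om] in z. *)
Definition pairing om (p : {poly symfun K}) : symfun K :=
  \sum_(k < size p) p`_k * om k.

Lemma pairing_widen n om (p : {poly symfun K}) :
  (size p <= n)%N -> pairing om p = \sum_(k < n) p`_k * om k.
Proof.
move=> le; rewrite /pairing (big_ord_widen n (fun k => p`_k * om k)) //.
rewrite big_mkcond; apply: eq_bigr => i _; case: ltnP => // ge.
by rewrite nth_default // mul0r.
Qed.

Lemma pairingD om (p r : {poly symfun K}) : pairing om (p + r) = pairing om p + pairing om r.
Proof.
pose n := maxn (size p) (size r).
rewrite !(@pairing_widen n) ?leq_maxl ?leq_maxr ?size_polyD //.
by rewrite -big_split; apply: eq_bigr => i _; rewrite coefD mulrDl.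
Qed.

Lemma pairingC om a (p : {poly symfun K}) : pairing om (a%:P * p) = a * pairing om p.
Proof.
rewrite (@pairing_widen (size p)) ?mul_polyC ?size_scale_leq // mulr_sumr.
by apply: eq_bigr => i _; rewrite coefZ mulrA.
Qed.

Lemma pairing0 om : pairing om 0 = 0.
Proof. by rewrite /pairing size_poly0 big_ord0. Qed.

Lemma pairing_sum om (I : Type) (r : seq I) (P : pred I) (F : I -> {poly symfun K}) :
  pairing om (\sum_(i <- r | P i) F i) = \sum_(i <- r | P i) pairing om (F i).
Proof. exact: (big_morph _ (pairingD om) (pairing0 om)). Qed.

(** The general form of Macdonald's operators: f |-> f[X + Y/z] Om(z) at z^0. *)
Definition macop c om f : symfun K := pairing om (shift c f).

Fact macop_linear c om : linear (macop c om).
Proof. by move=> a f g; rewrite /macop rmorphD pairingD /= shiftZ pairingC mulr_algl. Qed.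
HB.instance Definition _ c om :=
  GRing.isLinear.Build K (symfun K) (symfun K) _ (macop c om) (macop_linear c om).

(** A plethysm rescales the variables, and the added alphabet along with them. *)
Lemma shift_plethysm c c' e f : (forall r, (0 < r)%N -> c r = e r * c' r) ->
  map_poly (plethysm e) (shift c f) = shift c' (plethysm e f).
Proof.
move=> cE; move: f; apply: (symfun_p_ind q0_generic) => [|a f g fE gE|k f k0 fE].
- by rewrite !rmorph1.
- rewrite !rmorphD /= !shiftZ rmorphM /= map_polyC /= fE gE !linearZ /= rmorph1.
  by rewrite shiftZ.
rewrite !rmorphM /= fE; congr (_ * _).
rewrite (plethysm_p q0_generic) // shiftZ !shift_p // rmorphD rmorphM /= !map_polyC /= map_polyXn.
rewrite (plethysm_p q0_generic) // linearZ rmorph1 /= mulrDr -[_ *: pfun K k]mulr_algl polyCM.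
congr (_ + _); rewrite mulrA -polyCM cE //.
by rewrite -![_%:A]/(in_alg _ _) rmorphM.
Qed.

Lemma macop_plethysm c c' e om f : (forall r, (0 < r)%N -> c r = e r * c' r) ->
  plethysm e (macop c om f) = macop c' (plethysm e \o om) (plethysm e f).
Proof.
move=> cE; rewrite /macop -(shift_plethysm f cE) [RHS](@pairing_widen (size (shift c f))).
  rewrite /pairing rmorph_sum; apply: eq_bigr => i _.
  by rewrite rmorphM coef_map.
by rewrite /map_poly size_poly.
Qed.

Lemma plethysmK c c' : (forall r, (0 < r)%N -> c' r * c r = 1) ->
  cancel (plethysm c) (plethysm c').
Proof.
move=> cc'; apply: (symfun_p_ind q0_generic) => [|a f g fE gE|k f k0 fE].
- by rewrite !rmorph1.
- by rewrite !linearP /= fE gE.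
rewrite !rmorphM /= fE !(plethysm_p q0_generic) // linearZ /= (plethysm_p q0_generic) //.
rewrite scalerA [c _ * _]mulrC cc' //.
by rewrite scale1r.
Qed.

End Shift.

(** ** The Macdonald operator on Schur functions *)

Section Bidiagonal.
Variables (R : comNzRingType) (n : nat).

(** Multiplication by this matrix on the right subtracts [x] times each column from
the next one. *)
Definition bidiag (x : R) : 'M[R]_n :=
  \matrix_(i, j) ((i == j)%:R - x * (i.+1 == j :> nat)%:R).

Lemma det_bidiag x : \det (bidiag x) = 1.
Proof.
rewrite -det_tr det_trig.
  rewrite big1 // => i _; rewrite !mxE eqxx (_ : (i.+1 == i :> nat) = false) ?mulr0 ?subr0 //.
  by apply/eqP; lia.
apply/is_trig_mxP => i j ij; rewrite !mxE.
have -> : (j == i) = false by apply/eqP => e; move: ij; rewrite e ltnn.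
have -> : (j.+1 == i :> nat) = false by apply/eqP; lia.
by rewrite mulr0 subr0.
Qed.

Lemma mul_bidiag (F : 'I_n -> nat -> R) x :
  (\matrix_(i, j) F i j) *m bidiag x =
  \matrix_(i, j) (F i j - if val j is k.+1 then x * F i k else 0).
Proof.
apply/matrixP => i j; rewrite !mxE.
under eq_bigr => k _ do rewrite !mxE mulrBr.
rewrite big_split /= sumrN; congr (_ - _).
  rewrite (bigD1 j) //= eqxx mulr1 big1 ?addr0 // => k kj.
  by rewrite (negPf kj) mulr0.
case: j => -[|j] jn /=; first by rewrite big1 // => k _; rewrite !mulr0.
have jn' : (j < n)%N by apply: ltnW.
rewrite (bigD1 (Ordinal jn')) //= eqxx mulr1 mulrC big1 ?addr0 // => k kj.
rewrite eqSS (_ : (k == j :> nat) = false) ?mulr0 //.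
by apply: contra_neqF kj => /eqP e; apply: val_inj.
Qed.

End Bidiagonal.

Section MacopSchur.
Variables (K : fieldType) (q0 : K) (q0_generic : generic q0) (q t : K).
Variable om : nat -> symfun K.
Hypothesis om_newton : newton (fun r => - ((1 - q ^+ r) *: pfun K r)) om.
Local Notation h := (hfun K).
Local Notation T := (shift q0_generic (fun r => 1 - t ^+ r)).

(** h_(n - m), with the convention that it vanishes for n < m. *)
Definition hsub (n m : nat) : symfun K := if (m <= n)%N then h (n - m) else 0.

Lemma hsub_add n m k : hsub (n + k) (m + k) = hsub n m.
Proof. by rewrite /hsub leq_add2r subnDr. Qed.

Lemma schur_hsub la :
  schur K la = \det (\matrix_(i < size la, j < size la) hsub (nth 0%N la i + j) i).
Proof. by []. Qed.

(** The generating function of [om] is Exp[- (1 - q) z X], and its product with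
Exp[z X] is Exp[q z X]. *)
Lemma sum_om_h n : \sum_(k < n.+1) om k * h (n - k) = q ^+ n *: h n.
Proof.
have E r : q%:A ^+ r = (q ^+ r)%:A :> symfun K by rewrite -(rmorphXn (in_alg _)).
rewrite -mulr_algl -E.
apply: (newton_uniq (torsion_free_alg q0_generic (in_alg (symfun K)))
  (newton_prod om_newton (newton_h K)) (newton_scale q%:A (newton_h K))) => r.
by rewrite E mulr_algl scalerBl scale1r opprB subrK.
Qed.

Lemma sum_om_hsub n m :
  \sum_(k < n.+1) hsub n (m + k) * om k = q ^+ (n - m) *: hsub n m.
Proof.
rewrite {2}/hsub; case: leqP => mn; last first.
  by rewrite scaler0 big1 // => k _; rewrite /hsub leqNgt (leq_trans mn) ?leq_addr ?mul0r.
rewrite -sum_om_h (big_ord_widen n.+1 (fun k => om k * h (n - m - k))); last by lia.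
rewrite [RHS]big_mkcond; apply: eq_bigr => k _; rewrite /hsub ltnS leq_subRL // mulrC.
by case: ifP; rewrite ?mulr0 // subnDA.
Qed.

Lemma shift_hsub n m i : (T (hsub n m))`_i = geom_coef t i *: hsub n (m + i).
Proof.
rewrite /hsub; case: leqP => mn; last first.
  by rewrite rmorph0 coef0 leqNgt (leq_trans mn) ?leq_addr // scaler0.
have nh : newton (fun r => 1 *: pfun K r) h.
  by apply: newton_ext (newton_h K) _ _ => // r; rewrite scale1r.
rewrite (shift_newton q0_generic (t := t) nh); last by move=> r _; rewrite mul1r.
by rewrite leq_subRL //; case: ifP; rewrite ?scaler0 // subnDA.
Qed.

(** The generating function of h is multiplied by (1 - t w z) / (1 - w z); this is
the same with the denominator cleared. *)
Lemma shift_hsubS n m : T (hsub n.+1 m) - 'X * T (hsub n m) =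
  (hsub n.+1 m)%:P - t%:A%:P * 'X * (hsub n m)%:P.
Proof.
apply/polyP => i; rewrite !coefB !coefXM shift_hsub -mulrA coefCM coefXM !coefC.
case: i => [|[|i]] /=; first by rewrite scale1r addn0 mulr0.
  have -> : hsub n.+1 (m + 1) = hsub n m by rewrite -[n.+1]addn1 hsub_add.
  rewrite shift_hsub addn0 /= mulr_algl scale1r.
  by rewrite scalerBl scale1r addrAC subrr.
by rewrite shift_hsub !addnS -[n.+1]addn1 -[(m + i).+2]addn1 hsub_add subrr mulr0 subr0.
Qed.

Section Det.
Variable la : seq nat.
Let l := size la.
Let U : 'M[symfun K]_l := \matrix_(i, j) hsub (nth 0%N la i + j) i.
Let a (i : 'I_l) : {poly symfun K} := T (hsub (nth 0%N la i) i) - (hsub (nth 0%N la i) i)%:P.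
Let rho (j : nat) : {poly symfun K} := (t%:A%:P * 'X) ^+ j.

(** When w times each column of the shifted Jacobi-Trudi matrix is subtracted from
the next one, [shift_hsubS] shows the result to be the same operation, with t w
for w, on a rank one perturbation of the original matrix. *)
Lemma shift_schur : T (schur K la) = (schur K la)%:P +
  \sum_(m < l) \sum_(i < l) rho m * a i * (cofactor U i m)%:P.
Proof.
rewrite schur_hsub -/l -/U.
have -> : T (\det U) = \det (\matrix_(i < l, j < l) T (hsub (nth 0%N la i + j) i)).
  by rewrite -det_map_mx; congr (\det _); apply/matrixP => i j; rewrite !mxE.
(* Column operations with 'X on the left side, with t 'X on the right side. *)
rewrite -[LHS]mulr1 -(det_bidiag l 'X) -det_mulmx.
rewrite (mul_bidiag (fun (i : 'I_l) j => T (hsub (nth 0%N la i + j) i))).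
rewrite (_ : \matrix_(i, j) _ = (\matrix_(i < l, j < l)
   ((hsub (nth 0%N la i + j) i)%:P + a i * rho j)) *m bidiag l (t%:A%:P * 'X)).
  rewrite det_mulmx det_bidiag mulr1.
  rewrite (_ : \matrix_(i, j) _ = \matrix_(i, j) (map_mx polyC U i j + a i * rho j));
    last by apply/matrixP => i j; rewrite !mxE.
  rewrite (det_rank_one (map_mx polyC U) a (fun j : 'I_l => rho j)) det_map_mx /=.
  congr (_ + _); apply: eq_bigr => m _; apply: eq_bigr => i _.
  by rewrite cofactor_map_mx.
rewrite (mul_bidiag (fun (i : 'I_l) j => (hsub (nth 0%N la i + j) i)%:P + a i * rho j)).
apply/matrixP => i j; rewrite !mxE.
case: j => -[|j] jl /=; first by rewrite /a /rho addn0 expr0 mulr1 !subr0 addrC subrK.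
rewrite addnS shift_hsubS /rho exprS; ring.
Qed.

Lemma pairing_rho m (i : 'I_l) : pairing om (rho m * a i) = t ^+ m *: ((1 - t) *:
  (q ^+ (nth 0%N la i + m - i) *: hsub (nth 0%N la i + m) i -
   \sum_(k < m.+1) hsub (nth 0%N la i + m) (i + k) * om k)).
Proof.
rewrite /rho exprMn -mulrA -rmorphXn /= pairingC -[_%:A]/(in_alg _ _) -rmorphXn mulr_algl.
congr (_ *: _); set n := nth 0%N la i; set N := (n + m).+1.
have aE r : (a i)`_r = if r is 0%N then 0 else (1 - t) *: hsub n (i + r).
  by rewrite coefB shift_hsub coefC; case: r => [|r] /=; rewrite ?scale1r ?addn0 ?subrr ?subr0.
have asz : (size (a i) <= n.+1)%N.
  apply/leq_sizeP => r nr; rewrite aE; case: r nr => // r nr.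
  by rewrite /hsub (_ : (i + r.+1 <= n)%N = false) ?scaler0 //; apply/negbTE; lia.
rewrite (@pairing_widen _ N) /N; last first.
  by rewrite (leq_trans (size_polyMleq _ _)) // size_polyXn; lia.
rewrite -sum_om_hsub (@big_ord_widen _ _ _ m.+1 N (fun k => hsub (n + m) (i + k) * om k)); last by lia.
rewrite [X in _ *: (_ - X)]big_mkcond -sumrB scaler_sumr; apply: eq_bigr => k _.
rewrite coefXnM aE ltnS; case: (ltngtP k m) => [km|mk|->].
- by rewrite subrr scaler0 mul0r.
- have -> : (k - m = (k - m).-1.+1)%N by lia.
  rewrite subr0 scalerAl; congr (_ *: _ * _).
  by rewrite -(hsub_add n _ m); congr hsub; lia.
by rewrite subnn subrr scaler0 mul0r.
Qed.

Let om0 : om 0%N = 1. Proof. by case: om_newton. Qed.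

(** The terms with k > 0 expand determinants with two equal columns. *)
Lemma sum_cofactor (m : 'I_l) :
  \sum_(i < l) (\sum_(k < m.+1) hsub (nth 0%N la i + m) (i + k) * om k) * cofactor U i m
  = \det U.
Proof.
under eq_bigr => i _ do rewrite mulr_suml.
rewrite exchange_big big_ord_recl /= [X in _ + X]big1 ?addr0 => [|k _].
  have := congr1 (fun A : 'M_l => A m m) (mul_adj_mx U); rewrite !mxE eqxx mulr1n => <-.
  by apply: eq_bigr => i _; rewrite !mxE om0 mulr1 addn0 mulrC.
rewrite /bump leq0n add1n.
have km : (m - k.+1 < l)%N by have := ltn_ord m; lia.
have := congr1 (fun A : 'M_l => A m (Ordinal km)) (mul_adj_mx U); rewrite !mxE.
have -> : (m == Ordinal km) = false.
  by apply/eqP => /(congr1 val) /=; have := ltn_ord k; lia.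
rewrite mulr0n => e; rewrite -[RHS](mul0r (om k.+1)) -[in RHS]e mulr_suml.
apply: eq_bigr => i _; rewrite !mxE /=.
rewrite mulrAC; congr (_ * _); rewrite mulrC; congr (_ * _).
by rewrite -(hsub_add _ i k.+1); congr hsub; have := ltn_ord k; lia.
Qed.

(** Scaling the entries of one column scales every term of the Leibniz
expansion. *)
Lemma sum_scaled_cofactor (m : 'I_l) (Q : 'I_l -> K) :
  \sum_(i < l) (Q i *: U i m) * cofactor U i m =
  \sum_(s : 'S_l) Q (s^-1%g m) *: ((-1) ^+ s * \prod_i U i (s i)).
Proof.
(* The matrix with the entries of column m scaled. *)
pose V : 'M[symfun K]_l := \matrix_(i, j) if j == m then Q i *: U i m else U i j.
transitivity (\det V).
  rewrite (expand_det_col V m); apply: eq_bigr => i _; rewrite !mxE eqxx; congr (_ * _).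
  rewrite /cofactor; congr (_ * \det _); apply/matrixP => k j; rewrite !mxE.
  by rewrite eq_sym (negPf (neq_lift m j)).
apply: eq_bigr => s _; rewrite scalerAr; congr (_ * _).
rewrite (bigD1 (s^-1%g m)) //= [in RHS](bigD1 (s^-1%g m)) //= !mxE permKV eqxx -scalerAl.
congr (_ *: (_ * _)); apply: eq_bigr => i im; rewrite !mxE.
by rewrite -(inj_eq (@perm_inj _ s^-1)) permK (negPf im).
Qed.

(** By [shift_schur] and [pairing_rho] the operator expands along the cofactors of the
Jacobi-Trudi matrix. One part of the expansion is the determinant again, by
[sum_cofactor]; in the other one column is rescaled by powers of q. *)
Lemma macop_schur :
  macop q0_generic (fun r => 1 - t ^+ r) om (schur K la) =
  \sum_(s : 'S_l) (1 - (1 - t) * \sum_(i < l) t ^+ s i * (1 - q ^+ (nth 0%N la i + s i - i)))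
     *: ((-1) ^+ s * \prod_(i < l) hsub (nth 0%N la i + s i) i).
Proof.
rewrite /macop shift_schur pairingD -[_%:P in X in X + _]mulr1 pairingC.
rewrite pairing_sum; under eq_bigr => m _ do rewrite pairing_sum.
rewrite (eq_bigr (fun m : 'I_l => t ^+ m *: ((1 - t) *: (
   \sum_(i < l) (q ^+ (nth 0%N la i + m - i) *: U i m) * cofactor U i m - \det U)))); last first.
  move=> m _; rewrite -(sum_cofactor m) -sumrB !scaler_sumr; apply: eq_bigr => i _.
  rewrite mulrC pairingC pairing_rho mulrC -!scalerAl mulrBl !mxE.
  by rewrite -scalerAl.
rewrite -/U (@pairing_widen _ 1) ?size_poly1 // big_ord1 coef1 om0 !mulr1.
rewrite schur_hsub -/l -/U.
have dU : \det U = \sum_(s : 'S_l) 1 *: ((-1) ^+ s * \prod_i U i (s i)).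
  by apply: eq_bigr => s _; rewrite scale1r.
rewrite (eq_bigr (fun m : 'I_l => \sum_(s : 'S_l) (t ^+ m * ((1 - t) *
    (q ^+ (nth 0%N la (s^-1%g m) + m - (s^-1%g m)) - 1))) *: ((-1) ^+ s * \prod_i U i (s i)))).
  rewrite exchange_big /= {1}dU -big_split; apply: eq_bigr => s _ /=.
  rewrite -scaler_suml -scalerDl; congr (_ *: (_ * _)); last first.
    by apply: eq_bigr => i _; rewrite !mxE.
  rewrite (reindex_inj (@perm_inj _ s)) /= -mulrN -sumrN mulr_sumr; congr (_ + _).
  by apply: eq_bigr => i _; rewrite permK; ring.
move=> m _; rewrite (sum_scaled_cofactor m (fun i => q ^+ (nth 0%N la i + m - i))).
rewrite dU -sumrB !scaler_sumr; apply: eq_bigr => s _.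
by rewrite -scalerBl !scalerA mulrA.
Qed.

Lemma schur_sum : schur K la =
  \sum_(s : 'S_l) (-1) ^+ s * \prod_(i < l) hsub (nth 0%N la i + s i) i.
Proof.
by apply: eq_bigr => s _; congr (_ * _); apply: eq_bigr => i _; rewrite !mxE.
Qed.

End Det.
End MacopSchur.

(** * Jacobi-Trudi and dominance *)

Section Staircase.
Local Open Scope nat_scope.

Lemma sumn_take_big s k : sumn (take k s) = \sum_(i < size s | i < k) nth 0 s i.
Proof.
elim: s k => [|a s IH] k; first by rewrite big_ord0.
case: k => [|k]; first by rewrite big_pred0.
rewrite /=; by rewrite big_mkcond big_ord_recl /= -big_mkcond IH.
Qed.

Variables (l : nat) (p : 'S_l).

(** The values of a permutation on the first k indices are distinct. *)
Lemma sum_perm_ge k : \sum_(i < l | i < k) i <= \sum_(i < l | i < k) p i.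
Proof.
have le : \sum_(i < l | i < k) (k - p i) <= \sum_(i < l | i < k) (k - i).
  apply: (@leq_trans (\sum_(i < l) (k - p i))).
    by rewrite big_mkcond; apply: leq_sum => i _; case: ifP.
  have -> : \sum_(i < l) (k - p i) = \sum_(i < l) (k - i).
    by rewrite [RHS](reindex_inj (@perm_inj _ p)).
  rewrite [X in _ <= X]big_mkcond.
  by apply: leq_sum => i _; case: ltnP => //; rewrite -subn_eq0 => /eqP->.
have eA : \sum_(i < l | i < k) (k - i) + \sum_(i < l | i < k) i = \sum_(i < l | i < k) k.
  by rewrite -big_split; apply: eq_bigr => i ik /=; rewrite subnK // ltnW.
have : \sum_(i < l | i < k) k <= \sum_(i < l | i < k) (k - p i) + \sum_(i < l | i < k) p i.
  by rewrite -big_split; apply: leq_sum => i ik /=; lia.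
lia.
Qed.

Lemma perm_eq1_of_sums :
  (forall k, \sum_(i < l | i < k) p i <= \sum_(i < l | i < k) i) -> p = 1%g.
Proof.
move=> h; have e k : \sum_(i < l | i < k) p i = \sum_(i < l | i < k) i.
  by apply/eqP; rewrite eqn_leq h sum_perm_ge.
apply/permP => i; rewrite perm1; apply: val_inj => /=.
have sp (F : 'I_l -> nat) : \sum_(j < l | j < i.+1) F j = F i + \sum_(j < l | j < i) F j.
  rewrite (bigD1 i) //=; congr (_ + _); apply: eq_bigl => j.
  by rewrite ltnS ltn_neqAle andbC.
by have := e i.+1; rewrite !sp e => /addIn.
Qed.

Variables (la : intpart).
Hypothesis la_l : size (val la) = l.
Hypothesis nonneg : forall i : 'I_l, i <= nth 0 (val la) i + p i.
Let al (i : 'I_l) := nth 0 (val la) i + p i - i.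

Let al_sum k :
  \sum_(i < l | i < k) al i + \sum_(i < l | i < k) i = sumn (take k (val la)) + \sum_(i < l | i < k) p i.
Proof.
rewrite sumn_take_big la_l -!big_split; apply: eq_bigr => i _ /=.
by rewrite /al subnK.
Qed.

(** The exponents la_i + p(i) - i of a Jacobi-Trudi term dominate la, because the
partial sums of p(i) - i are nonnegative. *)
Lemma staircase_excess_dom c : excess c (val la) <= \sum_(i < l) (al i - c).
Proof.
have /andP[srt _] := valP la; have := excess_take c srt.
set k := count _ _; have := al_sum k; have := sum_perm_ge k.
have : \sum_(i < l | i < k) al i <= k * c + \sum_(i < l) (al i - c).
  apply: (@leq_trans (\sum_(i < l | i < k) c + \sum_(i < l | i < k) (al i - c))).
    by rewrite -big_split; apply: leq_sum => i _ /=; lia.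
  apply: leq_add; last by rewrite big_mkcond; apply: leq_sum => i _; case: ifP.
  have kl : k <= l by rewrite -la_l count_size.
  by rewrite (big_ord_narrow kl) sum_nat_const card_ord.
lia.
Qed.

(** Equality forces all partial sums of p(i) - i to vanish. *)
Lemma staircase_eq : (forall c, \sum_(i < l) (al i - c) = excess c (val la)) -> p = 1%g.
Proof.
move=> h; apply: perm_eq1_of_sums => k; have /andP[srt _] := valP la.
have := al_sum k; rewrite (sumn_take_nth k srt); set c := nth _ _ _.
have : \sum_(i < l | i < k) al i <= k * c + excess c (val la).
  rewrite -h; apply: (@leq_trans (\sum_(i < l | i < k) c + \sum_(i < l | i < k) (al i - c))).
    by rewrite -big_split; apply: leq_sum => i _ /=; lia.
  apply: leq_add; last by rewrite big_mkcond; apply: leq_sum => i _; case: ifP.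
  case: (leqP k l) => kl; first by rewrite (big_ord_narrow kl) sum_nat_const card_ord.
  apply: (@leq_trans (\sum_(i < l) c)).
    by rewrite big_mkcond; apply: leq_sum => i _; case: ifP.
  by rewrite sum_nat_const card_ord leq_mul2r ltnW ?orbT.
lia.
Qed.

Lemma staircase_sum : \sum_(i < l) al i = sumn (val la).
Proof.
have := al_sum l; rewrite take_oversize ?la_l //.
have E (F : 'I_l -> nat) : \sum_(i < l | i < l) F i = \sum_(i < l) F i.
  by apply: eq_bigl => i; rewrite ltn_ord.
rewrite !E; have -> : \sum_(i < l) p i = \sum_(i < l) i.
  by rewrite [RHS](reindex_inj (@perm_inj _ p)).
lia.
Qed.

End Staircase.

(** Strict dominance. *)
Definition above (nu mu : intpart) : Prop :=
  [/\ excess_dom (val nu) (val mu), nu <> mu & sumn (val nu) = sumn (val mu)].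

Definition dominating_span (K : fieldType) (mu : seq nat) : symfun K -> Prop :=
  in_span (fun f => exists2 la : intpart, dominates (val la) mu & f = schur K (val la)).

Section Triangular.
Variable K : fieldType.
Local Notation h := (hfun K).

Lemma hfun0 : h 0 = 1. Proof. by case: (newton_h K). Qed.

Lemma monom_pos (s : seq nat) : monom h [seq k <- s | (0 < k)%N] = monom h s.
Proof.
elim: s => //= k s IH; rewrite monom_cons -IH.
by case: k => [|k] /=; rewrite ?hfun0 ?mul1r // monom_cons.
Qed.

Lemma jacobi_trudi_term (la : intpart) (p : 'S_(size (val la))) : p != 1%g ->
  \prod_(i < size (val la)) hsub K (nth 0%N (val la) i + p i) i = 0 \/
  exists2 nu : intpart, above nu la &
    \prod_(i < size (val la)) hsub K (nth 0%N (val la) i + p i) i = monom h (val nu).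
Proof.
move=> p1; set l := size _ in p p1 *.
case: (boolP [forall i : 'I_l, (i <= nth 0 (val la) i + p i)%N]) => [/forallP nn|]; last first.
  rewrite negb_forall => /existsP[i ni]; left; rewrite (bigD1 i) //= /hsub.
  by rewrite (negPf ni) mul0r.
right; pose al (i : 'I_l) := (nth 0 (val la) i + p i - i)%N.
pose s := [seq k <- [seq al i | i <- enum 'I_l] | (0 < k)%N].
have sp : positive s by apply/allP => k; rewrite mem_filter => /andP[].
have ex c : excess c (val (part_of s)) = (\sum_(i < l) (al i - c))%N.
  by rewrite (excess_perm c (part_perm sp)) excess_pos /excess big_map big_enum.
exists (part_of s).
  split.
  - by move=> c; rewrite ex; apply: staircase_excess_dom.
  - move=> e; move/eqP: p1; apply; apply: (@staircase_eq l p la) => // c.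
    by rewrite -ex e.
  - rewrite -excess0 ex -(staircase_sum (p := p) (la := la)) //.
    by apply: eq_bigr => i _; rewrite subn0.
rewrite (monom_perm _ (part_perm sp)) monom_pos /monom big_map big_enum.
by apply: eq_bigr => i _; rewrite /hsub nn.
Qed.

Lemma jacobi_trudi_diag (la : intpart) :
  \prod_(i < size (val la)) hsub K (nth 0%N (val la) i + (1%g : 'S_(size (val la))) i) i =
  monom h (val la).
Proof.
rewrite /monom (big_nth 0%N) big_mkord; apply: eq_bigr => i _.
by rewrite perm1 /hsub leq_addl addnK.
Qed.

(** Weighting the terms of the Jacobi-Trudi determinant keeps it triangular in
the products of the h's; the term of the identity is the diagonal. *)
Lemma jacobi_trudi_sum (la : intpart) (c : 'S_(size (val la)) -> K) :
  exists L : seq (K * intpart), (forall x, x \in L -> above x.2 la) /\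
  \sum_(p : 'S_(size (val la))) c p *: ((-1) ^+ p *
     \prod_(i < size (val la)) hsub K (nth 0%N (val la) i + p i) i) =
  c 1%g *: monom h (val la) + \sum_(x <- L) x.1 *: monom h (val x.2).
Proof.
rewrite (bigD1 1%g) //= jacobi_trudi_diag odd_perm1 expr0 mul1r.
suff [L [LP ->]] : exists L : seq (K * intpart), (forall x, x \in L -> above x.2 la) /\
  \sum_(p : 'S_(size (val la)) | p != 1%g) c p *: ((-1) ^+ p *
     \prod_(i < size (val la)) hsub K (nth 0%N (val la) i + p i) i) =
  \sum_(x <- L) x.1 *: monom h (val x.2) by exists L.
apply: (big_ind (fun v => exists L : seq (K * intpart),
  (forall x, x \in L -> above x.2 la) /\ v = \sum_(x <- L) x.1 *: monom h (val x.2))).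
- by exists [::]; rewrite big_nil.
- move=> _ _ [L [LP ->]] [L' [LP' ->]]; exists (L ++ L'); rewrite big_cat; split=> // x.
  by rewrite mem_cat => /orP[/LP|/LP'].
move=> p /jacobi_trudi_term[->|[nu nula ->]].
  by exists [::]; rewrite mulr0 scaler0 big_nil.
exists [:: (c p * (-1) ^+ p, nu)]; split; first by move=> x; rewrite inE => /eqP->.
rewrite big_seq1 -scalerA; congr (_ *: _).
by case: (odd_perm p); rewrite ?expr0 ?expr1 ?mul1r ?scale1r ?mulN1r ?scaleN1r.
Qed.

End Triangular.

Lemma act_morph (K : fieldType) (V W : lmodType K) (D : {linear V -> V})
    (D' : {linear W -> W}) (phi : {linear V -> W}) :
  (forall v, phi (D v) = D' (phi v)) -> forall p v, phi (act D p v) = act D' p (phi v).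
Proof.
move=> DD' p v; rewrite /act linear_sum; apply: eq_bigr => i _; rewrite linearZ /=.
congr (_ *: _); elim: (nat_of_ord i) => //= k IH; by rewrite DD' IH.
Qed.

Section Kill.
Variables (K : fieldType) (D : {linear symfun K -> symfun K}) (e : intpart -> K).
Local Notation h := (hfun K).
Hypothesis schur_h : forall la : intpart, exists L : seq (K * intpart),
  (forall x, x \in L -> above x.2 la) /\
  schur K (val la) = monom h (val la) + \sum_(x <- L) x.1 *: monom h (val x.2).
Hypothesis D_schur : forall la : intpart, exists L : seq (K * intpart),
  (forall x, x \in L -> above x.2 la) /\
  D (schur K (val la)) - e la *: schur K (val la) = \sum_(x <- L) x.1 *: monom h (val x.2).

(** The candidate annihilator of vectors on which an operator is triangular, with
diagonal entries [e]. *)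
Definition annih (S : seq intpart) : {poly K} := \prod_(ka <- S) ('X - (e ka)%:P).

Lemma annih_cons ka S : annih (ka :: S) = annih S * ('X - (e ka)%:P).
Proof. by rewrite /annih big_cons mulrC. Qed.

Lemma annih_cat S S' : annih (S ++ S') = annih S * annih S'.
Proof. exact: big_cat. Qed.

(** By induction along dominance, the factor of the diagonal entry leaves only terms
strictly above, each killed by the factors collected for it. *)
Lemma schur_killed mu : exists S : seq intpart, (forall ka, ka \in S -> above ka mu) /\
  act D (annih (mu :: S)) (schur K (val mu)) = 0 /\
  act D (annih (mu :: S)) (monom h (val mu)) = 0.
Proof.
elim/excess_dom_ind: mu => mu IH.
have [L [LP Ls]] := schur_h mu; have [L' [LP' Ls']] := D_schur mu.
have [S [SP Sk]] : exists S : seq intpart, (forall ka, ka \in S -> above ka mu) /\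
    forall x, x \in L ++ L' -> act D (annih S) (monom h (val x.2)) = 0.
  have LL x : x \in L ++ L' -> above x.2 mu by rewrite mem_cat => /orP[/LP|/LP'].
  elim: (L ++ L') LL => [|x M IHM] LL; first by exists [::].
  have [S [SP Sk]] : exists S : seq intpart, (forall ka, ka \in S -> above ka mu) /\
    forall x, x \in M -> act D (annih S) (monom h (val x.2)) = 0.
    by apply: IHM => y yM; apply: LL; rewrite inE yM orbT.
  have xmu := LL x (mem_head _ _); have [xd xn xs] := xmu.
  have [T [TP [_ Tk]]] := IH _ xd xn xs.
  exists (x.2 :: T ++ S); split.
    move=> ka; rewrite inE mem_cat => /or3P[/eqP-> //|/TP[kd kn ks]|/SP //].
    split; [exact: excess_dom_trans kd xd| |by rewrite ks].
    by move=> kam; apply: xn; apply: excess_dom_antisym => //; rewrite -kam.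
  move=> y; rewrite inE -cat_cons annih_cat => /orP[/eqP->|/Sk yk].
    by apply: act_dvd Tk _; apply: dvdp_mulr.
  by apply: act_dvd yk _; apply: dvdp_mull.
exists S; split=> //.
have ks : act D (annih (mu :: S)) (schur K (val mu)) = 0.
  rewrite annih_cons actM actXsubC Ls' linear_sum big1_seq //= => x xL'.
  by rewrite linearZ /= Sk ?scaler0 // mem_cat xL' orbT.
split=> //; have -> : monom h (val mu) = schur K (val mu) - \sum_(x <- L) x.1 *: monom h (val x.2).
  by rewrite Ls addrK.
suff z0 : act D (annih (mu :: S)) (\sum_(x <- L) x.1 *: monom h (val x.2)) = 0.
  by rewrite linearB /= ks z0 subr0.
rewrite linear_sum; apply: big1_seq => x /andP[_ xL].
have z : act D (annih (mu :: S)) (monom h (val x.2)) = 0.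
  apply: (act_dvd (p := annih S)); first by rewrite Sk // mem_cat xL.
  by rewrite annih_cons dvdp_mulr.
by rewrite linearZ /= z scaler0.
Qed.

Lemma span_killed (mu : intpart) v : dominating_span (val mu) v ->
  exists S : seq intpart, (forall ka, ka \in S -> above ka mu) /\ act D (annih (mu :: S)) v = 0.
Proof.
case=> s [sP ->]; elim: s sP => [|x s IH] sP.
  by exists [::]; split=> //; rewrite big_nil linear0.
have [S [SP Sk]] : exists S : seq intpart, (forall ka, ka \in S -> above ka mu) /\
    act D (annih (mu :: S)) (\sum_(y <- s) y.1 *: y.2) = 0.
  by apply: IH => y ys; apply: sP; rewrite inE ys orbT.
have [la [lasum ladom] xE] := sP x (mem_head _ _).
have lamu : excess_dom (val la) (val mu).
  by apply: excess_dom_take => //; case/andP: (valP mu).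
have [T [TP [Tk _]]] := schur_killed la.
have [U [UP Uk]] : exists U : seq intpart, (forall ka, ka \in U -> above ka mu) /\
    act D (annih (mu :: U)) x.2 = 0.
  case: (pselect (la = mu)) => [e'|n]; first by exists T; rewrite -e' xE.
  exists (la :: T); split; last first.
    by rewrite annih_cons xE; apply: act_dvd Tk _; apply: dvdp_mulr.
  move=> ka; rewrite inE => /orP[/eqP-> //|/TP[kd kn ks]].
  split; [exact: excess_dom_trans kd lamu| |by rewrite ks].
  by move=> kam; apply: n; apply: excess_dom_antisym => //; rewrite -kam.
exists (S ++ U); split; first by move=> ka; rewrite mem_cat => /orP[/SP|/UP].
rewrite big_cons linearD linearZ /= (act_dvd Uk) ?scaler0 ?add0r.
  by apply: act_dvd Sk _; rewrite !annih_cons annih_cat mulrAC dvdp_mulr.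
by rewrite !annih_cons annih_cat -mulrA dvdp_mull.
Qed.

End Kill.

(** * Modified Macdonald functions are eigenvectors *)

(** Up to the factor 1 - q, the sum of q^a' t^l' over the cells of the diagram,
a' and l' being coarm and coleg. *)
Definition cell_sum (K : comNzRingType) (q t : K) (s : seq nat) : K :=
  \sum_(i < size s) t ^+ i * (1 - q ^+ nth 0%N s i).

Definition mac_eig (K : comNzRingType) (q t : K) (s : seq nat) : K :=
  1 - (1 - t) * cell_sum q t s.

Lemma count_sorted s i j : sorted geq s -> (i < count (ltn j) s)%N = (j < nth 0%N s i)%N.
Proof.
elim: s i => [|a s IH] i srt; first by rewrite nth_nil.
have [al ss] := sorted_geq_cons srt; case: (ltnP j a) => ja /=.
  by rewrite ja; case: i => [|i] //=; rewrite add1n ltnS IH.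
have small x : x \in a :: s -> (x <= j)%N.
  by rewrite inE => /orP[/eqP-> //|/(allP al) /= xa]; apply: leq_trans xa ja.
rewrite [(j < a)%N]ltnNge ja /= add0n (_ : count _ s = 0%N).
  apply/esym/negbTE; rewrite -leqNgt; case: (ltnP i (size s).+1) => il.
    by apply: small; apply: mem_nth.
  by rewrite nth_default.
apply/eqP; rewrite -leqn0 leqNgt -has_count; apply/hasPn => x xs /=.
by rewrite -leqNgt small // inE xs orbT.
Qed.

(** Transposing the diagram exchanges coarms and colegs. *)
Lemma mac_eig_conj (K : comNzRingType) (q t : K) (la : intpart) :
  mac_eig q t (val la) = mac_eig t q (conj_part (val la)).
Proof.
have /andP[srt _] := valP la; set s := val la in srt *.
have geo (x : K) n N : (n <= N)%N ->
    1 - x ^+ n = (1 - x) * \sum_(j < N) (if (j < n)%N then x ^+ j else 0).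
  move=> nN; rewrite -[1 in LHS](expr1n _ n) subrXX; congr (_ * _).
  rewrite -big_mkcond (big_ord_narrow nN) /=; apply: eq_bigr => j _.
  by rewrite expr1n mul1r.
congr (1 - _); rewrite /cell_sum.
have nthh i : (nth 0 s i <= head 0 s)%N.
  case: (ltnP i (size s)) => il; last by rewrite nth_default.
  by apply: head_max => //; apply: mem_nth.
rewrite (eq_bigr (fun i : 'I_(size s) => (1 - q) * \sum_(j < head 0%N s)
   (if (j < nth 0%N s i)%N then t ^+ i * q ^+ j else 0))); last first.
  move=> i _; rewrite (geo q _ _ (nthh i)) mulrCA mulr_sumr; congr (_ * _).
  by apply: eq_bigr => j _; case: ifP; rewrite ?mulr0.
have szc : size (conj_part s) = head 0%N s by rewrite size_map size_iota.
rewrite szc (eq_bigr (fun j : 'I_(head 0%N s) => (1 - t) * \sum_(i < size s)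
   (if (j < nth 0%N s i)%N then t ^+ i * q ^+ j else 0))); last first.
  move=> j _; rewrite conj_part_nth ltn_ord (geo t _ _ (count_size _ _)) mulrCA.
  congr (_ * _); rewrite mulr_sumr; apply: eq_bigr => i _.
  by rewrite -count_sorted //; case: ifP; rewrite ?mulr0 // mulrC.
rewrite -!mulr_sumr exchange_big /= !mulrA; congr (_ * _); ring.
Qed.

Lemma annih_coprime (K : fieldType) (e e' : intpart -> K) (S T : seq intpart) :
  (forall la ka, la \in S -> ka \in T -> e la <> e' ka) ->
  coprimep (annih e S) (annih e' T).
Proof.
move=> ne; elim: T ne => [|ka T IH] ne; first by rewrite /annih big_nil coprimep1.
rewrite annih_cons coprimepMr IH; last by move=> la ka' lS kT; apply: ne; rewrite // inE kT orbT.
rewrite coprimep_XsubC /annih -(big_map e predT (fun c => 'X - c%:P)) root_prod_XsubC.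
by apply/mapP => -[la lS /esym]; apply: ne; rewrite // mem_head.
Qed.

Section MacdonaldEigen.
Variables (K : fieldType) (q0 : K) (q0_generic : generic q0).

(** The coefficients of Exp[- z X]. *)
Definition omega : nat -> symfun K :=
  symendo q0_generic (fun r => - pfun K r) \o hfun K.

Lemma newton_omega : newton (fun r => - pfun K r) omega.
Proof.
apply: newton_ext (newton_map (symendo q0_generic (fun r => - pfun K r)) (newton_h K)) _ _ => // n.
by rewrite /= symendo_p.
Qed.

(** The Macdonald operator f |-> f[X + (1 - q)(1 - t)/z] Exp[- z X] at z^0. *)
Definition mac_op (q t : K) : {linear symfun K -> symfun K} :=
  macop q0_generic (fun r => (1 - q ^+ r) * (1 - t ^+ r)) omega.

Section OneSide.
Variables (q t : K).
Let D := macop q0_generic (fun r => 1 - t ^+ r)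
  (plethysm (fun r => 1 - q ^+ r) \o omega).
Let e (la : intpart) := mac_eig q t (val la).

Lemma newton_omega_plethysm :
  newton (fun r => - ((1 - q ^+ r) *: pfun K r)) (plethysm (fun r => 1 - q ^+ r) \o omega).
Proof.
apply: newton_ext (newton_map (plethysm (fun r => 1 - q ^+ r)) newton_omega) _ _ => // n /=.
by rewrite rmorphN /= (plethysm_p q0_generic).
Qed.

Lemma macop_span_killed (mu : intpart) v : dominating_span (val mu) v ->
  exists S : seq intpart, (forall ka, ka \in S -> above ka mu) /\
    act D (annih e (mu :: S)) v = 0.
Proof.
apply: span_killed => la.
  have [L [LP E]] := jacobi_trudi_sum (la := la) (fun=> 1 : K).
  exists L; split=> //; rewrite scale1r in E; rewrite schur_sum -E.
  by apply: eq_bigr => p _; rewrite scale1r.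
have [L [LP E]] := jacobi_trudi_sum (la := la) (fun p : 'S_(size (val la)) =>
   1 - (1 - t) * \sum_(i < size (val la)) t ^+ p i *
    (1 - q ^+ (nth 0%N (val la) i + p i - i)) - e la).
have c0 : 1 - (1 - t) * \sum_(i < size (val la)) t ^+ (1%g : 'S_(size (val la))) i *
    (1 - q ^+ (nth 0%N (val la) i + (1%g : 'S_(size (val la))) i - i)) - e la = 0.
  apply/eqP; rewrite subr_eq0; apply/eqP; congr (1 - _ * _); apply: eq_bigr => i _.
  by rewrite perm1 addnK.
exists L; split=> //; move: E => /=; rewrite c0 scale0r add0r => <-.
rewrite (macop_schur _ _ newton_omega_plethysm).
by rewrite schur_sum scaler_sumr -sumrB; apply: eq_bigr => p _; rewrite [RHS]scalerBl.
Qed.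

(** The substitution X |-> X (1 - q) turns [mac_op q t] into the operator that is
triangular on Schur functions. *)
Lemma mac_op_killed (mu : intpart) (f : symfun K) :
  (forall r, (0 < r)%N -> 1 - q ^+ r != 0) ->
  dominating_span (val mu) (plethysm (fun r => 1 - q ^+ r) f) ->
  exists S : seq intpart, (forall ka, ka \in S -> above ka mu) /\
    act (mac_op q t) (annih e (mu :: S)) f = 0.
Proof.
move=> q1 /macop_span_killed[S [SP Sk]]; exists S; split=> //.
apply: (can_inj (plethysmK q0_generic (c := fun r => 1 - q ^+ r)
   (c' := fun r => (1 - q ^+ r)^-1) _)) => [r r0|]; first by rewrite mulVf ?q1.
rewrite linear0 -[RHS]Sk; apply: act_morph => g.
exact: macop_plethysm.
Qed.

End OneSide.

(** The two triangularities bound the eigenvalues that occur in [f] by the ones of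
partitions above mu and of conjugates of partitions above its conjugate; since
conjugation reverses dominance, only mu is in both families. *)
Lemma macdonald_eigen (q t : K) (mu : intpart) (f : symfun K) :
  (forall r, (0 < r)%N -> 1 - q ^+ r != 0) ->
  (forall r, (0 < r)%N -> 1 - t ^+ r != 0) ->
  injective (fun la : intpart => mac_eig q t (val la)) ->
  dominating_span (val mu) (plethysm (fun r => 1 - q ^+ r) f) ->
  dominating_span (conj_part (val mu)) (plethysm (fun r => 1 - t ^+ r) f) ->
  mac_op q t f = mac_eig q t (val mu) *: f.
Proof.
move=> q1 t1 inj fq ft.
have [S [SP Sk]] := mac_op_killed t q1 fq.
have [T [TP Tk]] := @mac_op_killed t q (conj_intpart mu) f t1 ft.
have opC : mac_op t q =1 mac_op q t.
  by move=> g; rewrite /mac_op /=; congr (macop _ _ _ _); apply/funext => r; rewrite mulrC.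
have {}Tk : act (mac_op q t) (annih (fun la : intpart => mac_eig t q (val la))
    (conj_intpart mu :: T)) f = 0.
  rewrite -[RHS]Tk; symmetry; exact: (act_morph (phi := idfun)).
have ec : mac_eig t q (val (conj_intpart mu)) = mac_eig q t (val mu).
  exact/esym/mac_eig_conj.
rewrite annih_cons in Sk; rewrite annih_cons ec in Tk.
apply: act_bezout Sk Tk; apply: annih_coprime => la ka /SP[lad lan _] /TP[kad _ kas] e.
have {}e : la = conj_intpart ka by apply: inj; rewrite e; apply: mac_eig_conj.
apply: lan; apply: excess_dom_antisym => //; rewrite e; apply: excess_dom_conj => //.
rewrite kas -!excess0; have /andP[srt _] := valP mu.
by rewrite /= excess_conj // drop0 excess0.
Qed.

End MacdonaldEigen.

(** * Change of scalars *)

Section SymfunMap.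
Variables (K L : comNzRingType) (phi : {rmorphism K -> L}).

Fact symfun_map_additive : additive (symfun_map phi).
Proof. by move=> f g; apply: symfun_eq => n /=; rewrite rmorphB. Qed.
HB.instance Definition _ :=
  GRing.isAdditive.Build (symfun K) (symfun L) (symfun_map phi) symfun_map_additive.
Fact symfun_map_multiplicative : multiplicative (symfun_map phi).
Proof. by split=> [f g|]; apply: symfun_eq => n /=; rewrite ?rmorphM ?rmorph1. Qed.
HB.instance Definition _ :=
  GRing.isMultiplicative.Build (symfun K) (symfun L) (symfun_map phi)
    symfun_map_multiplicative.

Lemma symfun_mapZ c f : symfun_map phi (c *: f) = phi c *: symfun_map phi f.
Proof.
apply: symfun_eq => n /=; apply/mpolyP => m; rewrite mcoeff_map_mpoly !mcoeffZ mcoeff_map_mpoly.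
exact: rmorphM.
Qed.

Lemma symfun_map_p k : symfun_map phi (pfun K k) = pfun L k.
Proof.
apply: symfun_eq => n /=; case: k => [|k] /=; first by rewrite rmorph1.
rewrite rmorph_sum; apply: eq_bigr => i _ /=; rewrite rmorphXn /=; congr (_ ^+ _).
by apply/mpolyP => m; rewrite mcoeff_map_mpoly !mcoeffX; apply: rmorph_nat.
Qed.

End SymfunMap.

(** The multiplicities are read off as coefficients of the polynomial sum of the
1 - X^k. *)
Lemma tofrac_generic (R : idomainType) :
  (forall n, n.+1%:R != 0 :> R) -> generic (tofrac 'X : {fraction {poly R}}).
Proof.
move=> R0 s s' sp sp'.
have natr_inj a b : a%:R = b%:R :> R -> a = b.
  wlog le : a b / (a <= b)%N => [W e|e].
    by case: (leqP a b) => [/W|/ltnW/W h]; [apply|apply/esym/h].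
  apply/eqP; rewrite eqn_leq le /= leqNgt; apply/negP => lt.
  have := R0 (b - a).-1; rewrite prednK ?subn_gt0 // natrB // e subrr eqxx.
  by [].
have qE u : qexp (tofrac 'X) u = tofrac (\sum_(k <- u) (1 - 'X^k) : {poly R}).
  by rewrite rmorph_sum; apply: eq_bigr => k _; rewrite rmorphB rmorph1 rmorphXn.
rewrite !qE => /eqP; rewrite tofrac_eq => /eqP e.
have cE (u : seq nat) m : (\sum_(k <- u) (1 - 'X^k) : {poly R})`_m.+1 = - (count_mem m.+1 u)%:R.
  elim: u => [|k u IH]; first by rewrite big_nil coef0 oppr0.
  rewrite big_cons coefD IH coefB coef1 coefXn /= sub0r natrD opprD eq_sym.
  by [].
apply/allP => k; rewrite mem_cat => ks.
have : (0 < k)%N by case/orP: ks => ks; [apply: (allP sp)|apply: (allP sp')].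
case: k {ks} => // m _ /=; have := congr1 (fun p : {poly R} => p`_m.+1) e.
by rewrite /= !cE => /oppr_inj/natr_inj ->.
Qed.

Lemma qvar_generic : generic qvar.
Proof. by apply: tofrac_generic => n; rewrite Num.Theory.pnatr_eq0. Qed.

Lemma qtvar_generic : generic qtvar.
Proof.
move=> s s' sp sp' e; apply: qvar_generic => //; apply: (fmorph_inj scalar_incl).
have qE u : scalar_incl (qexp qvar u) = qexp qtvar u.
  by rewrite rmorph_sum; apply: eq_bigr => k _; rewrite rmorphB rmorph1 rmorphXn.
by rewrite !qE.
Qed.

Lemma generic_qpow (K : fieldType) (q : K) : generic q ->
  forall r, (0 < r)%N -> 1 - q ^+ r != 0.
Proof.
move=> qg r r0; apply/eqP => e; have := qg [:: r] [::].
by rewrite /positive /= r0 /qexp big_seq1 big_nil => /(_ isT isT e)/perm_size.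
Qed.

Section RegularAtOne.
Variable K : fieldType.
Implicit Types (c d : {fraction {poly K}}) (v w : K).

(** The relation [scalar_at_t1] over an arbitrary field of constants. *)
Definition reg_at1 c v : Prop := exists a b : {poly K},
  [/\ b.[1] != 0, c = tofrac a / tofrac b & v = a.[1] / b.[1]].

Let hnz (b : {poly K}) : b.[1] != 0 -> b != 0.
Proof. by apply: contraNneq => ->; rewrite horner0. Qed.

Let hnzF (b : {poly K}) : b.[1] != 0 -> tofrac b != 0 :> {fraction {poly K}}.
Proof. by rewrite tofrac_eq0; apply: hnz. Qed.

Lemma reg_at1_unique c v w : reg_at1 c v -> reg_at1 c w -> v = w.
Proof.
move=> [a [b [b1 -> ->]]] [a' [b' [b1' e ->]]].
have /eqP : tofrac (a * b') = tofrac (a' * b) :> {fraction {poly K}}.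
  by rewrite !tofracM; apply/eqP; rewrite -eqr_div ?hnzF // e.
rewrite tofrac_eq => /eqP /(congr1 (fun p => p.[1])); rewrite !hornerM => e1.
by apply/eqP; rewrite eqr_div // e1.
Qed.

Lemma reg_at1_tofrac (a : {poly K}) : reg_at1 (tofrac a) a.[1].
Proof. by exists a, 1; rewrite hornerC oner_neq0 rmorph1 !divr1. Qed.

Lemma reg_at1D c v d w : reg_at1 c v -> reg_at1 d w -> reg_at1 (c + d) (v + w).
Proof.
move=> [a [b [b1 -> ->]]] [a' [b' [b1' -> ->]]].
exists (a * b' + a' * b), (b * b'); split.
- by rewrite hornerM mulf_neq0.
- by rewrite addf_div ?hnzF // tofracD !tofracM.
by rewrite addf_div // !hornerE.
Qed.

Lemma reg_at1M c v d w : reg_at1 c v -> reg_at1 d w -> reg_at1 (c * d) (v * w).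
Proof.
move=> [a [b [b1 -> ->]]] [a' [b' [b1' -> ->]]].
exists (a * a'), (b * b'); split.
- by rewrite hornerM mulf_neq0.
- by rewrite mulf_div !tofracM.
by rewrite mulf_div !hornerM.
Qed.

Lemma reg_at1V c v : v != 0 -> reg_at1 c v -> reg_at1 c^-1 v^-1.
Proof.
move=> v0 [a [b [b1 cE vE]]]; exists b, a; split.
- by apply: contraNneq v0 => a1; rewrite vE a1 mul0r.
- by rewrite cE invf_div.
by rewrite vE invf_div.
Qed.

End RegularAtOne.

Notation at1 := scalar_at_t1.

Lemma at1_unique c v w : at1 c v -> at1 c w -> v = w.
Proof. exact: reg_at1_unique. Qed.

Lemma at1_tofrac (a : {poly Qq}) : at1 (tofrac a) a.[1].
Proof. exact: reg_at1_tofrac. Qed.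

Lemma at1_incl v : at1 (scalar_incl v) v.
Proof. by have := at1_tofrac v%:P; rewrite hornerC. Qed.

Lemma at1_0 : at1 0 0. Proof. by have := at1_incl 0; rewrite rmorph0. Qed.
Lemma at1_1 : at1 1 1. Proof. by have := at1_incl 1; rewrite rmorph1. Qed.

Lemma at1_t : at1 tvar 1.
Proof. by have := at1_tofrac 'X; rewrite hornerX. Qed.

Lemma at1D c v d w : at1 c v -> at1 d w -> at1 (c + d) (v + w).
Proof. exact: reg_at1D. Qed.

Lemma at1M c v d w : at1 c v -> at1 d w -> at1 (c * d) (v * w).
Proof. exact: reg_at1M. Qed.

Lemma at1V c v : v != 0 -> at1 c v -> at1 c^-1 v^-1.
Proof. exact: reg_at1V. Qed.

Lemma at1N c v : at1 c v -> at1 (- c) (- v).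
Proof.
move=> cv; rewrite -mulN1r -[- v]mulN1r; apply: at1M cv.
by have := at1_incl (-1); rewrite rmorphN rmorph1.
Qed.

Lemma at1B c v d w : at1 c v -> at1 d w -> at1 (c - d) (v - w).
Proof. by move=> cv dw; apply/at1D/at1N. Qed.

Lemma at1_div c v d w : w != 0 -> at1 c v -> at1 d w -> at1 (c / d) (v / w).
Proof. by move=> w0 cv dw; apply/at1M/at1V. Qed.

Lemma at1X c v n : at1 c v -> at1 (c ^+ n) (v ^+ n).
Proof.
move=> cv; elim: n => [|n IH]; first by rewrite !expr0; apply: at1_1.
by rewrite !exprS; apply: at1M.
Qed.

Lemma at1_sum (I : Type) (r : seq I) (P : pred I) (F : I -> Qqt) (G : I -> Qq) :
  (forall i, P i -> at1 (F i) (G i)) ->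
  at1 (\sum_(i <- r | P i) F i) (\sum_(i <- r | P i) G i).
Proof.
move=> FG; apply: (big_ind2 at1); [exact: at1_0|exact: at1D|exact: FG].
Qed.

Lemma at1_prod (I : Type) (r : seq I) (P : pred I) (F : I -> Qqt) (G : I -> Qq) :
  (forall i, P i -> at1 (F i) (G i)) ->
  at1 (\prod_(i <- r | P i) F i) (\prod_(i <- r | P i) G i).
Proof.
move=> FG; apply: (big_ind2 at1); [exact: at1_1|exact: at1M|exact: FG].
Qed.

Lemma at1_qt r : at1 (1 - qtvar ^+ r) (1 - qvar ^+ r).
Proof. by apply/(at1B at1_1)/at1X/at1_incl. Qed.

Lemma at1_neq0 c v : at1 c v -> v != 0 -> c != 0.
Proof.
move=> cv; apply: contraNneq => c0; rewrite c0 in cv; apply/eqP.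
exact: at1_unique cv at1_0.
Qed.

Definition eps : Qqt := 1 - tvar.

Lemma eps_neq0 : eps != 0.
Proof.
rewrite /eps subr_eq0 -(rmorph1 (@tofrac {poly Qq})) tofrac_eq.
apply/eqP => /(congr1 (fun p : {poly Qq} => p`_1)).
by rewrite coef1 coefX => /eqP; rewrite eq_sym oner_eq0.
Qed.

Lemma at1_eps : at1 eps 0.
Proof. by have := at1B at1_1 at1_t; rewrite subrr. Qed.

(** A geometric sum. *)
Lemma at1_tpow_div n : at1 ((1 - tvar ^+ n) / eps) n%:R.
Proof.
rewrite -[1 in X in at1 X](expr1n _ n) subrXX -/eps mulrC mulKf ?eps_neq0 //.
have -> : n%:R = \sum_(i < n) (1 : Qq) by rewrite sumr_const card_ord.
apply: at1_sum => i _; rewrite expr1n mul1r; have := at1X i at1_t.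
by rewrite expr1n.
Qed.

Lemma Qq_char0 n : (0 < n)%N -> n%:R != 0 :> Qq.
Proof. exact: generic_natr_neq0 qvar_generic n. Qed.

Lemma tpow_neq0 r : (0 < r)%N -> 1 - tvar ^+ r != 0.
Proof.
move=> r0; have := at1_neq0 (at1_tpow_div r) (Qq_char0 r0).
by apply: contraNneq => ->; rewrite mul0r.
Qed.

Lemma at1_cell_sum s : at1 (cell_sum qtvar tvar s) (qexp qvar s).
Proof.
rewrite /qexp (big_nth 0%N) big_mkord; apply: at1_sum => i _.
by have := at1M (at1X i at1_t) (at1_qt (nth 0%N s i)); rewrite expr1n mul1r.
Qed.

Lemma cell_sum_inj : injective (fun la : intpart => cell_sum qtvar tvar (val la)).
Proof.
move=> la mu e; apply: perm_part; apply: qvar_generic; try exact: part_positive.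
by apply: at1_unique (at1_cell_sum _) _; rewrite e; apply: at1_cell_sum.
Qed.

Lemma mac_eig_inj : injective (fun la : intpart => mac_eig qtvar tvar (val la)).
Proof.
move=> la mu /addrI/oppr_inj /(mulfI eps_neq0); exact: cell_sum_inj.
Qed.

(** * The row functions *)

Lemma qpoch_neq0 n : qpoch n != 0.
Proof.
rewrite /qpoch prodf_seq_neq0; apply/allP => i; rewrite mem_index_iota => /andP[i0 _].
exact: generic_qpow qvar_generic i i0.
Qed.

Lemma qpochS n : qpoch n.+1 = qpoch n * (1 - qvar ^+ n.+1).
Proof. by rewrite /qpoch big_nat_recr. Qed.

Definition hrow (n : nat) : LambdaQq := plethysm (fun r => (1 - qvar ^+ r)^-1) (hfun Qq n).

Lemma htildeE n : htilde n = qpoch n *: hrow n. Proof. by []. Qed.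

Lemma newton_hrow : newton (fun r => (1 - qvar ^+ r)^-1 *: pfun Qq r) hrow.
Proof.
apply: newton_ext (newton_map (plethysm _) (newton_h Qq)) _ _ => // n /=.
exact: plethysm_p qvar_generic _ _ _.
Qed.

Lemma htilde_free : free_gens htilde.
Proof.
apply: (newton_free_gens qvar_generic) newton_hrow => [r r0|n _]; last exact: qpoch_neq0.
by rewrite invr_eq0 generic_qpow //; apply: qvar_generic.
Qed.

Definition hrowF (n : nat) : LambdaQqt := Lambda_incl (hrow n).

Lemma newton_hrowF : newton (fun r => (1 - qtvar ^+ r)^-1 *: pfun Qqt r) hrowF.
Proof.
apply: newton_ext (newton_map (symfun_map scalar_incl) newton_hrow) _ _ => // n /=.
by rewrite symfun_mapZ symfun_map_p fmorphV rmorphB rmorph1 rmorphXn.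
Qed.

Definition htildeF (n : nat) : LambdaQqt := Lambda_incl (htilde n).

Lemma htildeFE n : htildeF n = scalar_incl (qpoch n) *: hrowF n.
Proof. exact: symfun_mapZ. Qed.

Lemma htildeF_free : free_gens htildeF.
Proof.
have -> : htildeF = fun n => scalar_incl (qpoch n) *: hrowF n.
  by apply/funext => n; rewrite htildeFE.
apply: (newton_free_gens qtvar_generic) newton_hrowF => [r r0|n _].
  by rewrite invr_eq0 generic_qpow //; apply: qtvar_generic.
by rewrite fmorph_eq0 qpoch_neq0.
Qed.

Lemma free_gens_scale (K : fieldType) (x : nat -> symfun K) (d : nat -> K) :
  (forall n, (0 < n)%N -> d n != 0) -> free_gens x -> free_gens (fun n => d n *: x n).
Proof.
move=> d0 [gen univ]; split=> [P P1 PZD PM|B iota g].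
  apply: gen => // k f k0 Pf; have P0 : P 0 by have := PZD (-1) _ _ P1 P1; rewrite scaleN1r addNr.
  have := PZD (d k)^-1 _ _ (PM k f k0 Pf) P0.
  by rewrite addr0 -scalerAl scalerA mulVf ?d0 // scale1r.
have [phi [phiZ phix]] := univ B iota (fun n => iota (d n)^-1 * g n).
exists phi; split=> // k k0; rewrite phiZ phix // mulrA -rmorphM mulfV ?d0 //.
by rewrite rmorph1 mul1r.
Qed.

(** * Reduction of lattices at t = 1 *)

(** The elements [F] of the algebra generated by the [x n] over the scalars regular at
t = 1, each with its reduction [G], for which [x n] is given the value [u n].
For free generators the values can be prescribed at will. *)
Inductive spec (x : nat -> LambdaQqt) (u : nat -> LambdaQq) : LambdaQqt -> LambdaQq -> Prop :=
| spec_one : spec x u 1 1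
| spec_add F G F' G' : spec x u F G -> spec x u F' G' -> spec x u (F + F') (G + G')
| spec_scale c v F G : at1 c v -> spec x u F G -> spec x u (c *: F) (v *: G)
| spec_mul F G F' G' : spec x u F G -> spec x u F' G' -> spec x u (F * F') (G * G')
| spec_gen n : (0 < n)%N -> spec x u (x n) (u n).

Section SpecTheory.
Variables (x : nat -> LambdaQqt) (u : nat -> LambdaQq).
Local Notation sp := (spec x u).

Lemma spec_0 : sp 0 0.
Proof. by have := spec_scale at1_0 (spec_one x u); rewrite !scale0r. Qed.

Lemma spec_opp F G : sp F G -> sp (- F) (- G).
Proof. by move=> FG; rewrite -scaleN1r -[- G]scaleN1r; apply: spec_scale FG; apply: at1N at1_1. Qed.

Lemma spec_sub F G F' G' : sp F G -> sp F' G' -> sp (F - F') (G - G').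
Proof. by move=> FG FG'; apply/spec_add/spec_opp. Qed.

Lemma spec_sum (I : Type) (r : seq I) (P : pred I) F G :
  (forall i, P i -> sp (F i) (G i)) -> sp (\sum_(i <- r | P i) F i) (\sum_(i <- r | P i) G i).
Proof.
by move=> FG; apply: (big_ind2 sp) => //; [apply: spec_0|move=> *; apply: spec_add].
Qed.

Lemma spec_sum_seq (I : eqType) (r : seq I) F G :
  (forall i, i \in r -> sp (F i) (G i)) -> sp (\sum_(i <- r) F i) (\sum_(i <- r) G i).
Proof. by move=> FG; rewrite big_seq [X in sp _ X]big_seq; apply: spec_sum. Qed.

Lemma spec_monom s : positive s -> sp (monom x s) (monom u s).
Proof.
elim: s => [_|k s IH /= /andP[k0 sp0]]; first by rewrite /monom !big_nil; apply: spec_one.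
by rewrite !monom_cons; apply: spec_mul (IH sp0); apply: spec_gen.
Qed.

Hypotheses (x_free : free_gens x) (u_free : free_gens u).

(** Coordinates are morphisms that send [x n] and [u n] to the same variable. *)
Lemma spec_coordm F G : sp F G -> forall N m, at1 (coordm x_free N F)@_m (coordm u_free N G)@_m.
Proof.
elim=> {F G} [|F G F' G' _ IH _ IH'|c v F G cv _ IH|F G F' G' _ IH _ IH'|n n0] N m.
- rewrite !rmorph1 !mcoeff1; case: eqP => _; [exact: at1_1|exact: at1_0].
- by rewrite !rmorphD !mcoeffD; apply: at1D.
- by rewrite !coordmZ !mcoeffZ; apply: at1M.
- by rewrite !rmorphM !mcoeffM; apply: at1_sum => i _; apply: at1M.
rewrite !coordm_gen // /coord_gens; case: insub => [i|].
  by rewrite !mcoeffX; case: eqP => _; [apply: at1_1|apply: at1_0].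
by rewrite !mcoeff0; apply: at1_0.
Qed.

Lemma spec_coordp F G la : sp F G -> at1 (coordp x_free la F) (coordp u_free la G).
Proof. by move=> FG; apply: spec_coordm. Qed.

Lemma spec_unique F G G' : sp F G -> sp F G' -> G = G'.
Proof.
move=> FG FG'; apply/eqP; rewrite -subr_eq0; apply/eqP; apply: (coordp_eq0 (x_free := u_free)) => la.
by have := spec_coordp (val la) (spec_sub FG FG'); rewrite subrr coordp0 => h; apply: at1_unique h at1_0.
Qed.

(** Some coordinate of [eta] is a unit at t = 1. *)
Lemma spec_scalar0 eta g d : sp eta g -> g != 0 -> sp (d *: eta) 0 -> at1 d 0.
Proof.
move=> eg g0 de0.
have [la la0] : exists la : intpart, coordp u_free (val la) g != 0.
  apply: contrapT => n; case/negP: g0; apply/eqP/(coordp_eq0 (x_free := u_free)) => la.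
  by apply/eqP; apply: contrapT => ne; apply: n; exists la; apply/negP.
have c1 := spec_coordp (val la) eg; have := spec_coordp (val la) de0.
rewrite coordp0 -[d *: eta]addr0 coordpZD coordp0 addr0 => c2.
have := at1_div la0 c2 c1; rewrite mul0r mulfK //.
exact: at1_neq0 c1 la0.
Qed.

End SpecTheory.

(** ** Eigenvectors in a lattice *)

Section Eigenlattice.
Variables (x : nat -> LambdaQqt) (u : nat -> LambdaQq).
Local Notation sp := (spec x u).
Variables (H : intpart -> LambdaQqt) (E : intpart -> Qqt) (E0 : intpart -> Qq).
Variables (N : {linear LambdaQqt -> LambdaQqt}) (N0 : {linear LambdaQq -> LambdaQq}).
Hypothesis NH : forall ka, N (H ka) = E ka *: H ka.
Hypothesis EE0 : forall ka, at1 (E ka) (E0 ka).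
Hypothesis E0_inj : injective E0.
Hypothesis NN0 : forall F G, sp F G -> sp (N F) (N0 G).

Let E_inj : injective E.
Proof. by move=> la mu e; apply: E0_inj; apply: at1_unique (EE0 _) _; rewrite e. Qed.

Lemma act_lagrange (S : seq intpart) (b : intpart -> Qqt) ka : ka \in S -> uniq S ->
  act N (lagrange_at E S ka) (\sum_(nu <- S) b nu *: H nu) = b ka *: H ka.
Proof.
move=> kS uS; rewrite linear_sum (bigD1_seq ka) //= linearZ /= (act_eigen _ (NH ka)).
have LE nu : nu \in S -> (lagrange_at E S ka).[E nu] = (nu == ka)%:R.
  by move=> nS; apply: lagrange_atE => // ? ? _ _; apply: E_inj.
rewrite LE // eqxx scale1r big1_seq ?addr0 // => nu /andP[nk nS].
by rewrite linearZ /= (act_eigen _ (NH nu)) LE // (negPf nk) scale0r scaler0.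
Qed.

(** The denominators of the interpolation polynomial are differences of
eigenvalues that remain distinct at t = 1. *)
Lemma spec_lagrange S ka F G : sp F G ->
  sp (act N (lagrange_at E S ka) F) (act N0 (lagrange_at E0 S ka) G).
Proof.
move=> FG; elim: S => [|j S IH] /=.
  by rewrite /lagrange_at !big_nil -!polyC1 !actC !scale1r.
rewrite /lagrange_at !big_cons; case: ifP => // jk.
rewrite [act N _ _]actM [act N0 _ _]actM !actZ !actXsubC; apply: spec_scale.
  apply: at1V; last exact: at1B (EE0 _) (EE0 _).
  by rewrite subr_eq0; apply: contraTneq jk => /E0_inj->; rewrite eqxx.
by apply: spec_sub; [apply: NN0|apply: spec_scale].
Qed.

Lemma spec_eigenline (S : seq intpart) (b : intpart -> Qqt) ka F G : ka \in S -> uniq S ->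
  F = \sum_(nu <- S) b nu *: H nu -> sp F G ->
  sp (b ka *: H ka) (act N0 (lagrange_at E0 S ka) G).
Proof. by move=> kS uS -> FG; rewrite -(act_lagrange b kS uS); apply: spec_lagrange. Qed.

Lemma act_lagrange_eigen (S : seq intpart) nu ka v : nu \in S -> ka \in S ->
  N0 v = E0 nu *: v -> act N0 (lagrange_at E0 S ka) v = (nu == ka)%:R *: v.
Proof.
move=> nS kS vE; rewrite (act_eigen _ vE) lagrange_atE // => ? ? _ _; exact: E0_inj.
Qed.

Hypotheses (x_free : free_gens x) (u_free : free_gens u).
Hypothesis H_basis : is_basis H.

Lemma basis_expand F (T : seq intpart) : exists S (b : intpart -> Qqt),
  [/\ uniq S, {subset T <= S} & F = \sum_(nu <- S) b nu *: H nu].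
Proof.
have [[c [s [us s0 ->]]] _] := H_basis F.
exists (s ++ [seq k <- undup T | k \notin s]), c; split.
- rewrite cat_uniq us filter_uniq ?undup_uniq // andbT; apply/hasPn => k.
  by rewrite mem_filter => /andP[].
- by move=> k kT; rewrite mem_cat mem_filter mem_undup kT andbT orbN.
rewrite big_cat /= [X in _ + X]big1_seq ?addr0 // => k /andP[_].
by rewrite mem_filter => /andP[/s0-> _]; rewrite scale0r.
Qed.

(** The interpolation projections to the eigenlines have no pole at t = 1, so each
eigencomponent of [F] reduces to 0 as [F] does. *)
Lemma spec_eigen_small (eta : intpart -> LambdaQqt) (g : intpart -> LambdaQq)
    (a : intpart -> Qqt) F :
  (forall ka, eta ka = a ka *: H ka) -> (forall ka, sp (eta ka) (g ka)) ->
  (forall ka, g ka != 0) -> sp F 0 ->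
  exists (S : seq intpart) (d : intpart -> Qqt),
    F = \sum_(ka <- S) d ka *: eta ka /\ forall ka, ka \in S -> at1 (d ka) 0.
Proof.
move=> etaE etag g0 F0; have [S [b [uS _ Fb]]] := basis_expand F [::].
have a0 ka : a ka != 0.
  apply: contraNneq (g0 ka) => a0; apply/eqP; apply: spec_unique x_free u_free _ _ _ (etag ka) _.
  by rewrite etaE a0 scale0r; apply: spec_0.
exists S, (fun ka => b ka / a ka); split.
  by rewrite Fb; apply: eq_bigr => ka _; rewrite etaE scalerA divfK ?a0.
move=> ka kS; apply: (spec_scalar0 x_free u_free (etag ka) (g0 ka)).
rewrite etaE scalerA divfK ?a0 // -(act_lagrange b kS uS) -Fb.
rewrite -(linear0 (act N0 (lagrange_at E0 S ka))).
exact: spec_lagrange.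
Qed.

End Eigenlattice.

(** * Row functions and q-shifts of the variables *)

Section GenericRow.
Variables (K : fieldType) (q0 : K) (q0_generic : generic q0).

(** Exp[- z X] Exp[z X/(1 - q)] = Exp[q z X/(1 - q)]. *)
Lemma sum_omega_row (q : K) (a : nat -> symfun K) :
  (forall r, (0 < r)%N -> 1 - q ^+ r != 0) ->
  newton (fun r => (1 - q ^+ r)^-1 *: pfun K r) a ->
  forall n, \sum_(k < n.+1) omega q0_generic k * a (n - k)%N = q ^+ n *: a n.
Proof.
move=> q1 na n.
have E r : q%:A ^+ r = (q ^+ r)%:A :> symfun K by rewrite -(rmorphXn (in_alg _)).
rewrite -mulr_algl -E.
apply: (newton_uniq (torsion_free_alg q0_generic (in_alg (symfun K)))
  (newton_prod (newton_omega q0_generic) na) (newton_scale q%:A na)) => r.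
rewrite E mulr_algl scalerA -[- pfun K r.+1]scaleN1r -scalerDl; congr (_ *: _).
by have := q1 r.+1 isT => h; field.
Qed.

Lemma omega_rec (q : K) (a : nat -> symfun K) :
  (forall r, (0 < r)%N -> 1 - q ^+ r != 0) ->
  newton (fun r => (1 - q ^+ r)^-1 *: pfun K r) a ->
  forall n, omega q0_generic n.+1 = (q ^+ n.+1 - 1) *: a n.+1
    - \sum_(k < n) omega q0_generic k.+1 * a (n - k)%N.
Proof.
move=> q1 na n; have [a0 _] := na; have [o0 _] := newton_omega q0_generic.
have := sum_omega_row q1 na n.+1; rewrite big_ord_recl big_ord_recr /= o0 mul1r subn0.
rewrite /bump /= add1n subnn a0 mulr1 scalerBl scale1r => <-.
by rewrite [a n.+1 + _]addrC addrK [X in X - _]addrC addrK.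
Qed.

(** The operator sum_i (1 - T_(q, x_i)) written without variables: T_(q, x_i) changes
p_r by - (1 - q^r) x_i^r, and the powers of x_i add up to power sums. *)
Definition qlapS (q : K) : {linear symfun K -> symfun K} :=
  macop q0_generic (fun r => - (1 - q ^+ r)) (fun i => if i is 0%N then 0 else - pfun K i).

Lemma shift_dilate q n (i : 'I_n) f :
  (map_poly (symfun_ev n) (shift q0_generic (fun r => - (1 - q ^+ r)) f)).['X_i] =
  dilate q i (f n).
Proof.
move: f; apply: (symfun_p_ind q0_generic) => [|a f g fE gE|k f k0 fE].
- by rewrite rmorph1 rmorph1 hornerC rmorph1.
- rewrite rmorphD /= shiftZ rmorphD /= rmorphM /= map_polyC /= hornerD hornerM hornerC.
  by rewrite fE gE rmorphD /= dilateZ mulr_algl.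
have -> : (pfun K k * f) n = pfun K k n * f n by [].
rewrite rmorphM rmorphM /= hornerM fE rmorphM /=.
congr (_ * _); rewrite shift_p // rmorphD rmorphM /= !map_polyC map_polyXn /=.
rewrite !hornerE /= /symfun_ev; case: k k0 => // k _ /=; rewrite rmorph_sum /=.
rewrite (bigD1 i) //= [in RHS](bigD1 i) //= rmorphXn /= dilateX eqxx exprZn.
rewrite [RHS](_ : _ = q ^+ k.+1 *: 'X_i ^+ k.+1 + \sum_(j < n | j != i) 'X_j ^+ k.+1).
  by rewrite mulr_algl scaleNr scalerBl scale1r; ring.
congr (_ + _); apply: eq_bigr => j ji; by rewrite rmorphXn /= dilateX (negPf ji).
Qed.

Lemma qlapS_ev q f n : (qlapS q f) n = qlap q (f n).
Proof.
rewrite /qlapS /= /macop; set P := shift _ _ f.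
have P0 : P`_0 = f by apply: shift_coef0.
rewrite (@pairing_widen _ (size P).+1) // big_ord_recl mulr0 add0r.
rewrite -[LHS]/(symfun_ev n _) rmorph_sum /= /qlap.
rewrite (eq_bigr (fun i : 'I_n => \sum_(k < size P) - ((P`_k.+1) n * 'X_i ^+ k.+1))).
  rewrite exchange_big; apply: eq_bigr => k _ /=.
  by rewrite sumrN -mulr_sumr -mulrN.
move=> i _; rewrite -shift_dilate -/P.
have szP : (size (map_poly (symfun_ev n) P) <= (size P).+1)%N.
  by apply: leq_trans (size_poly _ _) _.
rewrite (horner_coef_wide _ szP) big_ord_recl coef_map P0 expr0 mulr1 opprD addrA.
rewrite subrr add0r sumrN; congr (- _); apply: eq_bigr => k _.
by rewrite coef_map.
Qed.

Lemma qlapS_aug q s : positive s -> qlapS q (aug (pfun K) s) = qexp q s *: aug (pfun K) s.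
Proof.
move=> sp; apply: symfun_eq => n; rewrite qlapS_ev aug_ev // qlap_mono -aug_ev //.
Qed.

Lemma aug_neq0 s : positive s -> aug (pfun K) s != 0.
Proof.
move=> sp; apply/eqP => s0; have := aug_class_sum q0_generic (l := [:: (1, s)]) (qexp q0 s).
rewrite /= sp !big_seq1 s0 scaler0 big_cons big_nil eqxx addr0.
by move=> /(_ isT erefl)/eqP; rewrite oner_eq0.
Qed.

End GenericRow.

Lemma derivation_monom (K : fieldType) (D : {linear symfun K -> symfun K})
    (x : nat -> symfun K) (c : nat -> K) s :
  (forall f g, D (f * g) = D f * g + f * D g) ->
  (forall k, k \in s -> D (x k) = c k *: x k) ->
  D (monom x s) = (\sum_(k <- s) c k) *: monom x s.
Proof.
move=> DM; elim: s => [|k s IH] Dx.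
  by rewrite big_nil scale0r /monom big_nil derivation1.
rewrite big_cons monom_cons DM IH; last by move=> l ls; apply: Dx; rewrite inE ls orbT.
by rewrite Dx ?mem_head // scalerDl -scalerAl -scalerAr.
Qed.

(** The Leibniz rule raises each entry once and, for each, subtracts the same product
with one more factor. *)
Lemma bump_derivation_monom (K : fieldType) (D : {linear symfun K -> symfun K})
    (x : nat -> symfun K) (k : nat) (c : K) s :
  (forall f g, D (f * g) = D f * g + f * D g) ->
  (forall m, m \in s -> D (x m) = c *: (x (m + k)%N - x m * x k)) ->
  D (monom x s) =
  c *: (\sum_(u <- bumps k s) monom x u - monom x (k :: s) *+ size s).
Proof.
move=> DM; elim: s => [|m s IH] Dx.
  by rewrite big_nil subr0 scaler0 /monom big_nil derivation1.
rewrite [monom x (m :: s)]monom_cons DM IH; last by move=> l ls; apply: Dx; rewrite inE ls orbT.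
rewrite Dx ?mem_head // big_bumps_cons -scalerAl -scalerAr -scalerDr; congr (_ *: _).
rewrite !monom_cons; under [in RHS]eq_bigr => u _ do rewrite monom_cons.
rewrite -mulr_sumr /= mulrS mulrBr -!mulrnAr; ring.
Qed.

(** * The two lattices *)

Lemma invM_mulN (K : fieldType) (a b : K) : a != 0 -> (a * b)^-1 * - a = - b^-1.
Proof. by move=> a0; rewrite invfM mulrN mulrAC mulVf // mul1r. Qed.

Lemma inv_quotient (K : fieldType) (e a b : K) : e != 0 ->
  (b / e)^-1 * (e * a)^-1 = (a * b)^-1.
Proof. by move=> e0; rewrite -invfM; rewrite mulrA divfK // mulrC. Qed.

Lemma power_rec (K : fieldType) (q e : K) (a : nat -> symfun K) n :
  newton (fun r => (1 - q ^+ r)^-1 *: pfun K r) a ->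
  (e * (1 - q ^+ n.+1))^-1 *: pfun K n.+1 = n.+1%:R *: (e^-1 *: a n.+1) -
    \sum_(i < n) ((e * (1 - q ^+ i.+1))^-1 *: pfun K i.+1) * a (n - i)%N.
Proof.
move=> [a0 aP]; have := aP n; rewrite big_ord_recr /= subnn a0 mulr1 => E.
rewrite scaler_nat scalerMnr E scalerDr scaler_sumr.
rewrite [X in X + _ - _](_ : _ = \sum_(i < n) ((e * (1 - q ^+ i.+1))^-1 *: pfun K i.+1)
    * a (n - i)%N).
  by rewrite addrAC subrr add0r scalerA invfM.
by apply: eq_bigr => i _; rewrite scalerAl scalerA invfM.
Qed.

Lemma shift_scaled_p (K : fieldType) (q0 : K) (q0_generic : generic q0) (c : nat -> K) b n i :
  (0 < n)%N -> (shift q0_generic c (b *: pfun K n))`_i.+1 =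
  if i.+1 == n then (b * c n) *: 1 else 0.
Proof.
move=> n0; rewrite shiftZ coefCM mulr_algl shift_p // coefD coefC coefCM coefXn add0r.
by case: eqP => _; rewrite ?mulr0 ?scaler0 // mulr1 scalerA.
Qed.

Lemma shift_scaled_row (K : fieldType) (q0 : K) (q0_generic : generic q0) (c e : nat -> K)
    (t : K) (a : nat -> symfun K) d n i :
  newton (fun r => e r *: pfun K r) a ->
  (forall r, (0 < r)%N -> e r * c r = 1 - t ^+ r) -> 1 - t != 0 ->
  (shift q0_generic c ((1 - t)^-1 *: (d *: a n)))`_i.+1 =
  if (i < n)%N then d *: a (n - i.+1)%N else 0.
Proof.
move=> na ec t1; rewrite !shiftZ !coefCM !mulr_algl (shift_newton q0_generic na ec).
case: ifP => _; last by rewrite !scaler0.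
by rewrite /= !scalerA mulrAC mulVf // mul1r.
Qed.

Lemma qlapSE (K : fieldType) (q0 : K) (q0_generic : generic q0) (q : K) f n :
  (size (shift q0_generic (fun r => - (1 - q ^+ r)) f) <= n.+1)%N ->
  qlapS q0_generic q f =
  \sum_(k < n) (shift q0_generic (fun r => - (1 - q ^+ r)) f)`_k.+1 * - pfun K k.+1.
Proof.
by move=> sz; rewrite /qlapS /= /macop (pairing_widen _ sz) big_ord_recl mulr0 add0r.
Qed.

(** If the coefficients of positive degree of two polynomials are divisible by [e], then
modulo [e] the quotients obey the Leibniz rule. *)
Lemma scaled_coefM (K : fieldType) (P Q : {poly symfun K}) (e : K) i : e != 0 ->
  e^-1 *: (P * Q)`_i.+1 = P`_0 * (e^-1 *: Q`_i.+1) + (e^-1 *: P`_i.+1) * Q`_0 +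
  \sum_(j < i) e *: ((e^-1 *: P`_j.+1) * (e^-1 *: Q`_(i - j.+1).+1)).
Proof.
move=> e0; rewrite coefM big_ord_recl big_ord_recr /= subn0 subnn.
rewrite [X in _ + X]addrC addrA scalerDr scalerDr scalerAr scalerAl; congr (_ + _ + _).
rewrite scaler_sumr; apply: eq_bigr => j _.
rewrite -scalerAr -scalerAl !scalerA mulfV // mul1r; congr (_ *: (_ * _`__)).
by rewrite /bump leq0n add1n subSS -subSn ?subSS //; apply: ltn_ord.
Qed.

Lemma scaler_swap (K : fieldType) (V : lmodType K) (a b : K) (v : V) :
  a *: (b *: v) = b *: (a *: v).
Proof. by rewrite !scalerA mulrC. Qed.

Lemma omega_row_sum (K : fieldType) (q0 : K) (q0_generic : generic q0) (q : K)
    (a : nat -> symfun K) n :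
  (forall r, (0 < r)%N -> 1 - q ^+ r != 0) ->
  newton (fun r => (1 - q ^+ r)^-1 *: pfun K r) a ->
  \sum_(i < n.+1) a (n - i)%N * - omega q0_generic i.+1 = (1 - q ^+ n.+1) *: a n.+1.
Proof.
move=> q1 na; have [a0 _] := na.
rewrite big_ord_recr /= subnn a0 mul1r (omega_rec q0_generic q1 na n).
have -> : \sum_(i < n) a (n - i)%N * - omega q0_generic i.+1 =
    - \sum_(i < n) omega q0_generic i.+1 * a (n - i)%N.
  by rewrite -sumrN; apply: eq_bigr => i _; rewrite mulrN mulrC.
by rewrite opprB addKr -scaleNr opprB.
Qed.

Lemma scaled_mulN (K : comNzRingType) (V : symfun K) (a : K) (W : symfun K) :
  V * (- a *: W) = (a *: V) * - W.
Proof. by rewrite scaleNr !mulrN -scalerAr -scalerAl. Qed.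

Notation omegaF := (omega qtvar_generic).
Notation omegaQ := (omega qvar_generic).
Notation TF := (shift qtvar_generic (fun r => (1 - qtvar ^+ r) * (1 - tvar ^+ r))).

(** The generators h~_n/(1 - t) of the larger lattice. Their values [uA] are chosen so
that the Macdonald operator reduces to q-shifts of the variables. *)
Definition yA (n : nat) : LambdaQqt := eps^-1 *: htildeF n.
Definition uA (n : nat) : LambdaQq := - qpoch n.-1 *: pfun Qq n.

Lemma yA_free : free_gens yA.
Proof. by apply: (free_gens_scale _ htildeF_free) => n _; rewrite invr_eq0 eps_neq0. Qed.

Lemma uA_free : free_gens uA.
Proof.
by apply: (free_gens_scale _ (free_gens_p qvar_generic)) => n _; rewrite oppr_eq0 qpoch_neq0.
Qed.

Notation specA := (spec yA uA).
Notation specL := (spec htildeF htilde).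

(** (1 - D)/(1 - t) for the Macdonald operator D. The division is what makes its
eigenvalues distinct at t = 1. *)
Definition mac_lap (F : LambdaQqt) : LambdaQqt :=
  eps^-1 *: (F - mac_op qtvar_generic qtvar tvar F).

Fact mac_lap_linear : linear mac_lap.
Proof.
move=> c F G; rewrite /mac_lap linearP /= [c *: (_ *: _)]scalerA [c * _]mulrC.
rewrite -[(_ * c) *: _]scalerA -scalerDr; congr (_ *: _).
by rewrite scalerBr opprD addrACA.
Qed.
HB.instance Definition _ :=
  GRing.isLinear.Build Qqt LambdaQqt LambdaQqt _ mac_lap mac_lap_linear.

Lemma omegaF0 : omegaF 0 = 1. Proof. by case: (newton_omega qtvar_generic). Qed.

Lemma mac_lapE F n : (size (TF F) <= n.+1)%N ->
  mac_lap F = \sum_(k < n) (TF F)`_k.+1 * (- eps^-1 *: omegaF k.+1).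
Proof.
move=> szF; rewrite /mac_lap /mac_op /= /macop (pairing_widen _ szF) big_ord_recl.
rewrite omegaF0 mulr1 shift_coef0 opprD addrA subrr add0r -sumrN scaler_sumr.
by apply: eq_bigr => k _; rewrite -scalerAr scaleNr scalerN.
Qed.

Lemma TF_row_cond r : (0 < r)%N ->
  (1 - qtvar ^+ r)^-1 * ((1 - qtvar ^+ r) * (1 - tvar ^+ r)) = 1 - tvar ^+ r.
Proof. by move=> r0; rewrite mulKf // generic_qpow //; apply: qtvar_generic. Qed.

Lemma scaleF_neq0 n : scalar_incl (qpoch n) != 0.
Proof. by rewrite fmorph_eq0 qpoch_neq0. Qed.

Lemma hrowF_htildeF n : hrowF n = (scalar_incl (qpoch n))^-1 *: htildeF n.
Proof. by rewrite htildeFE scalerA mulVf ?scaleF_neq0 // scale1r. Qed.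

Lemma hrow_htilde n : hrow n = (qpoch n)^-1 *: htilde n.
Proof. by rewrite htildeE scalerA mulVf ?qpoch_neq0 // scale1r. Qed.

Lemma hrowF0 : hrowF 0 = 1. Proof. by case: newton_hrowF. Qed.
Lemma hrow0 : hrow 0 = 1. Proof. by case: newton_hrow. Qed.

Lemma at1_qpochV n : at1 (scalar_incl (qpoch n))^-1 (qpoch n)^-1.
Proof. apply: at1V (qpoch_neq0 n) _; exact: at1_incl. Qed.

Lemma qpow_neq0 r : (0 < r)%N -> 1 - qvar ^+ r != 0.
Proof. exact: generic_qpow qvar_generic r. Qed.

Lemma qtpow_neq0 r : (0 < r)%N -> 1 - qtvar ^+ r != 0.
Proof. exact: generic_qpow qtvar_generic r. Qed.

Lemma omegaF_rec n : omegaF n.+1 = (qtvar ^+ n.+1 - 1) *: hrowF n.+1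
    - \sum_(k < n) omegaF k.+1 * hrowF (n - k)%N.
Proof. exact: omega_rec qtpow_neq0 newton_hrowF n. Qed.

Lemma omegaQ_rec n : omegaQ n.+1 = (qvar ^+ n.+1 - 1) *: hrow n.+1
    - \sum_(k < n) omegaQ k.+1 * hrow (n - k)%N.
Proof. exact: omega_rec qpow_neq0 newton_hrow n. Qed.

(** ** The lattice generated by the row functions divided by 1 - t *)

Lemma specA_row n : (0 < n)%N -> specA (eps^-1 *: hrowF n) ((qpoch n)^-1 *: uA n).
Proof.
move=> n0; rewrite hrowF_htildeF scalerA mulrC -scalerA.
by apply: spec_scale (at1_qpochV n) _; apply: spec_gen.
Qed.

(** 1 - t times the generator h~_n/(1 - t), up to a unit. *)
Lemma specA_row0 n : (0 < n)%N -> specA (hrowF n) 0.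
Proof.
move=> n0; rewrite -[hrowF n](scalerKV (eps_neq0)) -(scale0r ((qpoch n)^-1 *: uA n)).
by apply: spec_scale at1_eps _; apply: specA_row.
Qed.

Lemma qpoch_uA n : (qpoch n.+1)^-1 *: uA n.+1 = - (1 - qvar ^+ n.+1)^-1 *: pfun Qq n.+1.
Proof.
rewrite /uA scalerA qpochS /=; congr (_ *: _).
exact: invM_mulN (qpoch_neq0 n).
Qed.

(** In the recursion for omega_(n+1)/(1 - t) the products reduce to 0, their second
factors being row functions. *)
Lemma specA_omega n : specA (- eps^-1 *: omegaF n.+1) (- pfun Qq n.+1).
Proof.
elim/ltn_ind: n => n IH; rewrite omegaF_rec scalerBr.
have -> : - pfun Qq n.+1 =
   (1 - qvar ^+ n.+1) *: ((qpoch n.+1)^-1 *: uA n.+1) - \sum_(k < n) - pfun Qq k.+1 * 0.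
  rewrite big1 ?subr0 => [|k _]; last by rewrite mulr0.
  by rewrite qpoch_uA scalerA mulrN mulfV ?qpow_neq0 // scaleN1r.
apply: spec_sub.
  rewrite scalerA mulNr -mulrN opprB mulrC -scalerA.
  by apply: spec_scale (at1_qt _) _; apply: specA_row.
rewrite scaler_sumr; apply: spec_sum => k _; rewrite scalerAl.
by apply: spec_mul; [apply: IH|apply: specA_row0; rewrite subn_gt0].
Qed.

(** Newton's identities divided by 1 - t: all products but the one with
a_0 = 1 reduce to 0. *)
Lemma specA_power n : (0 < n)%N ->
  specA ((eps * (1 - qtvar ^+ n))^-1 *: pfun Qqt n) (- n%:R * (1 - qvar ^+ n)^-1 *: pfun Qq n).
Proof.
elim/ltn_ind: n => -[//|n] IH _; rewrite (power_rec eps n newton_hrowF).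
have -> : - n.+1%:R * (1 - qvar ^+ n.+1)^-1 *: pfun Qq n.+1 =
    n.+1%:R *: ((qpoch n.+1)^-1 *: uA n.+1) -
    \sum_(i < n) (- i.+1%:R * (1 - qvar ^+ i.+1)^-1 *: pfun Qq i.+1) * 0.
  rewrite big1 ?subr0 => [|i _]; last by rewrite mulr0.
  by rewrite qpoch_uA scalerA mulrN mulNr.
apply: spec_sub.
  apply: spec_scale; last exact: specA_row.
  by have := at1_incl n.+1%:R; rewrite rmorph_nat.
apply: spec_sum => i _; apply: spec_mul; first by apply: IH; rewrite // ltnS.
by apply: specA_row0; rewrite subn_gt0.
Qed.

Lemma star_p k : (0 < k)%N ->
  star (pfun Qqt k) = ((1 - qtvar ^+ k) * (1 - tvar ^+ k))^-1 *: pfun Qqt k.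
Proof. exact: plethysm_p qtvar_generic _ _. Qed.

Lemma specA_star k : (0 < k)%N ->
  specA (star (pfun Qqt k)) (- (1 - qvar ^+ k)^-1 *: pfun Qq k).
Proof.
move=> k0; rewrite star_p //.
have k1 : k%:R != 0 :> Qq by apply: Qq_char0.
have := spec_scale (at1V k1 (at1_tpow_div k)) (specA_power k0).
rewrite !scalerA; congr (spec _ _ (_ *: _) (_ *: _)).
  exact: inv_quotient eps_neq0.
by rewrite mulrA mulrN mulVf // mulN1r.
Qed.

Notation qshift := (shift qvar_generic (fun r => - (1 - qvar ^+ r))).

(** f[X + (1 - q)(1 - t) w] has the reduction p_r |-> p_r - (1 - q^r) w^r: of the
coefficients of a shifted generator only those of w^0 and w^n are not
multiples of 1 - t. *)
Lemma specA_shift F G : specA F G -> forall i, specA (TF F)`_i (qshift G)`_i.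
Proof.
elim=> {F G} [|F G F' G' _ IH _ IH'|c v F G cv _ IH|F G F' G' _ IH _ IH'|n n0] i.
- by rewrite !rmorph1 !coef1; case: eqP => _; [apply: spec_one|apply: spec_0].
- by rewrite !rmorphD !coefD; apply: spec_add.
- by rewrite !shiftZ !coefCM !mulr_algl; apply: spec_scale.
- by rewrite !rmorphM !coefM; apply: spec_sum => j _; apply: spec_mul.
case: i => [|i]; first by rewrite !shift_coef0; apply: spec_gen.
rewrite /yA htildeFE (shift_scaled_row _ _ _ _ newton_hrowF TF_row_cond eps_neq0).
rewrite shift_scaled_p //; case: (eqVneq i.+1 n) => [e|ne].
  rewrite -e ltnSn subnn hrowF0 mulrNN /= -qpochS.
  by apply: spec_scale (at1_incl _) _; apply: spec_one.
case: ifP => lt; last exact: spec_0.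
have n' : (0 < n - i.+1)%N by rewrite subn_gt0 ltn_neqAle ne.
by have := spec_scale (at1_incl (qpoch n)) (specA_row0 n'); rewrite scaler0.
Qed.

Lemma specA_lap F G : specA F G -> specA (mac_lap F) (qlapS qvar_generic qvar G).
Proof.
move=> FG; pose n := maxn (size (TF F)) (size (qshift G)).
have szF : (size (TF F) <= n.+1)%N by apply: leq_trans (leq_maxl _ _) (leqnSn _).
have szG : (size (qshift G) <= n.+1)%N by apply: leq_trans (leq_maxr _ _) (leqnSn _).
rewrite (mac_lapE szF) (qlapSE szG); apply: spec_sum => k _.
by apply: spec_mul; [apply: specA_shift|apply: specA_omega].
Qed.

(** ** The lattice generated by the row functions *)

Lemma specL_row n : specL (hrowF n) (hrow n).
Proof.
case: n => [|n]; first by rewrite hrowF0 hrow0; apply: spec_one.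
rewrite hrowF_htildeF hrow_htilde; apply: spec_scale (at1_qpochV _) _.
exact: spec_gen.
Qed.

Lemma specL_omega n : specL (omegaF n.+1) (omegaQ n.+1).
Proof.
elim/ltn_ind: n => n IH; rewrite omegaF_rec omegaQ_rec; apply: spec_sub.
  apply: spec_scale (specL_row _); apply: at1B at1_1.
  exact/at1X/at1_incl.
by apply: spec_sum => k _; apply: spec_mul (IH _ _) (specL_row _).
Qed.

Definition dshift_gen (i n : nat) : LambdaQq :=
  if (i <= n)%N then qpoch n *: hrow (n - i)%N else 0.

(** The coefficient of w^i in f[X + (1 - q)(1 - t) w] is divisible by 1 - t for i > 0; by
[scaled_coefM] the quotient reduces to a derivation of f. *)
Definition dshift (i : nat) := free_derivation htilde_free (dshift_gen i).

Lemma dshiftM i : is_derivation (dshift i).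
Proof. exact: free_derivationM. Qed.

Lemma dshiftE i n : (0 < n)%N -> dshift i (htilde n) = dshift_gen i n.
Proof. exact: free_derivationE. Qed.

Lemma specL_dshift F G : specL F G ->
  forall i, specL (eps^-1 *: (TF F)`_i.+1) (dshift i.+1 G).
Proof.
elim=> {F G} [|F G F' G' _ IH _ IH'|c v F G cv _ IH|F G F' G' FG IH FG' IH'|n n0] i.
- rewrite rmorph1 coef1 scaler0 (derivation1 (dshiftM _)); exact: spec_0.
- by rewrite rmorphD coefD scalerDr linearD; apply: spec_add.
- rewrite shiftZ coefCM mulr_algl [X in specL _ X]linearZ /= scaler_swap.
  exact: spec_scale cv (IH i).
- rewrite rmorphM (scaled_coefM _ _ _ eps_neq0) !shift_coef0 (dshiftM i.+1 G G').
  rewrite [X in specL _ X]addrC -[X in specL _ X]addr0; apply: spec_add.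
    by apply: spec_add; apply: spec_mul.
  have -> : 0 = \sum_(j < i) 0 *: (dshift j.+1 G * dshift (i - j.+1).+1 G').
    by rewrite big1 // => j _; rewrite scale0r.
  apply: spec_sum => j _; apply: spec_scale at1_eps _.
  by apply: spec_mul; [apply: IH|apply: IH'].
have -> : eps^-1 *: (TF (htildeF n))`_i.+1 = (TF (eps^-1 *: htildeF n))`_i.+1.
  by rewrite shiftZ coefCM mulr_algl.
rewrite htildeFE (shift_scaled_row _ _ _ _ newton_hrowF TF_row_cond eps_neq0).
rewrite dshiftE // /dshift_gen; case: ifP => _; last exact: spec_0.
by apply: spec_scale (at1_incl _) (specL_row _).
Qed.

Definition qdegree := free_derivation htilde_free (fun n => (1 - qvar ^+ n) *: htilde n).

Lemma qdegreeM : is_derivation qdegree.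
Proof. exact: free_derivationM. Qed.

Lemma qdegreeE n : (0 < n)%N -> qdegree (htilde n) = (1 - qvar ^+ n) *: htilde n.
Proof. exact: free_derivationE. Qed.

Lemma qdegree_monom s : positive s ->
  qdegree (monom htilde s) = qexp qvar s *: monom htilde s.
Proof.
move=> /allP sp; apply: (derivation_monom qdegreeM) => k /sp; exact: qdegreeE.
Qed.

(** On each element almost all [dshift i] vanish, so that the sum is finite and a
derivation; on generators it is given by [omega_row_sum]. *)
Lemma dshift_sum G : exists n0, forall n, (n0 <= n)%N ->
  \sum_(k < n) dshift k.+1 G * - omegaQ k.+1 = qdegree G.
Proof.
move: G; apply: (htilde_free.1 (fun G => exists n0, forall n, (n0 <= n)%N ->
  \sum_(k < n) dshift k.+1 G * - omegaQ k.+1 = qdegree G)).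
- exists 0%N => n _; rewrite (derivation1 qdegreeM) big1 // => k _.
  by rewrite (derivation1 (dshiftM _)) mul0r.
- move=> c G G' [n Gn] [n' Gn']; exists (maxn n n') => m; rewrite geq_max => /andP[nm nm'].
  rewrite linearP -(Gn m nm) -(Gn' m nm') scaler_sumr -big_split; apply: eq_bigr => k _ /=.
  by rewrite linearP mulrDl scalerAl.
move=> k G k0 [n Gn]; exists (maxn n k) => m; rewrite geq_max => /andP[nm km].
rewrite qdegreeM -(Gn m nm) mulr_sumr qdegreeE //.
rewrite (eq_bigr (fun i : 'I_m => (dshift_gen i.+1 k * - omegaQ i.+1) * G +
   htilde k * (dshift i.+1 G * - omegaQ i.+1))); last first.
  by move=> i _; rewrite dshiftM dshiftE // mulrDl mulrAC mulrA.
rewrite big_split /= -mulr_suml; congr (_ * _ + _).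
rewrite [LHS](_ : _ = qpoch k *: \sum_(i < k) hrow (k.-1 - i)%N * - omegaQ i.+1).
  case: k k0 {km} => // k _; rewrite (omega_row_sum _ _ qpow_neq0 newton_hrow).
  by rewrite scaler_swap.
rewrite scaler_sumr (big_ord_widen m (fun i => qpoch k *: (hrow (k.-1 - i)%N * - omegaQ i.+1))) //.
rewrite [RHS]big_mkcond; apply: eq_bigr => i _; rewrite /dshift_gen.
case: ifP => _; last by rewrite mul0r.
by rewrite scalerAl; case: k k0 {km} => // k _; rewrite subSS.
Qed.

Lemma specL_lap F G : specL F G -> specL (mac_lap F) (qdegree G).
Proof.
move=> FG; have [n0 Gn] := dshift_sum G; pose n := maxn n0 (size (TF F)).
have szF : (size (TF F) <= n.+1)%N by apply: leq_trans (leq_maxr _ _) (leqnSn _).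
rewrite (mac_lapE szF) -(Gn n (leq_maxl _ _)); apply: spec_sum => k _.
rewrite scaled_mulN; apply: spec_mul; first exact: specL_dshift.
by apply/spec_opp/specL_omega.
Qed.

(** * The eigenvalues of Pi near t = 1 *)

Definition row_prod (s : seq nat) : Qq := \prod_(k <- s) qpoch k.-1.

(** The value at t = 1 of Pi_s/(1 - t)^(l - 1), with l the length of s. The first
factor covers the empty list, for which Pi_s (1 - t) is 0 at t = 1. *)
Definition Pi_lim (s : seq nat) : Qq :=
  (0 < size s)%:R * ((size s).-1)`!%:R * row_prod s.

Lemma qpoch_prod n : qpoch n = \prod_(i < n) (1 - qvar ^+ i.+1).
Proof. by rewrite /qpoch big_add1 big_mkord. Qed.

Lemma at1_cell i j : at1 (1 - qtvar ^+ i * tvar ^+ j) (1 - qvar ^+ i).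
Proof.
apply: at1B at1_1 _; have := at1M (at1X i (at1_incl qvar)) (at1X j at1_t).
by rewrite expr1n mulr1.
Qed.

(** The factor of [Pi_coef] contributed by row [j], of length [n]. *)
Definition row_factor (n j : nat) : Qqt :=
  \prod_(i < n | (i != 0 :> nat)%N || (j != 0 :> nat)%N) (1 - qtvar ^+ i * tvar ^+ j).

Lemma row_factorS n j : row_factor n.+1 j =
  (if j == 0%N then 1 else 1 - tvar ^+ j) * \prod_(i < n) (1 - qtvar ^+ i.+1 * tvar ^+ j).
Proof.
rewrite /row_factor big_mkcond big_ord_recl /= expr0 mul1r; congr (_ * _).
by case: eqP.
Qed.

Lemma at1_row_factor0 n : at1 (row_factor n.+1 0) (qpoch n).
Proof.
rewrite row_factorS mul1r qpoch_prod; apply: at1_prod => i _; exact: at1_cell.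
Qed.

Lemma at1_row_factor n j : at1 (row_factor n.+1 j.+1 / eps) (j.+1%:R * qpoch n).
Proof.
rewrite row_factorS mulrAC; apply: at1M (at1_tpow_div _) _.
by rewrite qpoch_prod; apply: at1_prod => i _; apply: at1_cell.
Qed.

Lemma Pi_coef_row s : Pi_coef s = \prod_(j < size s) row_factor (nth 0%N s j) j.
Proof. by []. Qed.

Lemma scaled_prod (K : fieldType) (e x : K) n (F : 'I_n -> K) : e != 0 ->
  e * (x * \prod_(j < n) F j) / e ^+ n.+1 = x * \prod_(j < n) (F j / e).
Proof.
move=> e0; rewrite prodf_div prodr_const card_ord exprS invfM mulrACA mulfV // mul1r.
by rewrite mulrA.
Qed.

Lemma prod_fact n : \prod_(j < n) (j.+1%:R : Qq) = n`!%:R.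
Proof.
elim: n => [|n IH]; first by rewrite big_ord0.
by rewrite big_ord_recr IH factS mulnC natrM.
Qed.

(** Each row but the first contributes one factor 1 - t^j, from its first cell. *)
Lemma at1_Pi s : positive s -> at1 (eps * Pi_coef s / eps ^+ size s) (Pi_lim s).
Proof.
case: s => [_|m s /= /andP[m0 /allP sp]].
  rewrite /Pi_coef big_ord0 mulr1 expr0 divr1 /Pi_lim !mul0r; exact: at1_eps.
rewrite Pi_coef_row big_ord_recl /= scaled_prod ?eps_neq0 //.
rewrite /Pi_lim /row_prod mul1r big_cons mulrCA; apply: at1M.
  by case: m m0 => // m _; apply: at1_row_factor0.
rewrite /= -prod_fact (big_nth 0%N) big_mkord -big_split; apply: at1_prod => j _ /=.
have := sp _ (mem_nth 0%N (ltn_ord j)); case: (nth _ _ _) => // n _.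
exact: at1_row_factor.
Qed.

Lemma row_prod_neq0 s : row_prod s != 0.
Proof. by rewrite prodf_seq_neq0; apply/allP => k _; apply: qpoch_neq0. Qed.

Lemma row_prod_perm s s' : perm_eq s s' -> row_prod s = row_prod s'.
Proof. exact: perm_big. Qed.

Lemma Pi_lim_perm s s' : perm_eq s s' -> Pi_lim s = Pi_lim s'.
Proof. by move=> p; rewrite /Pi_lim (row_prod_perm p) (perm_size p). Qed.

(** The scalar between products of the [uA] and products of power sums. *)
Definition sign_prod (s : seq nat) : Qq := (-1) ^+ size s * row_prod s.

Lemma monom_uA s : monom uA s = sign_prod s *: monom (pfun Qq) s.
Proof.
elim: s => [|k s IH]; first by rewrite /sign_prod /row_prod /monom !big_nil expr0 mulr1 scale1r.
rewrite !monom_cons IH /uA /sign_prod /row_prod big_cons /= exprS.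
by rewrite -scalerAl -scalerAr scalerA; congr (_ *: _); ring.
Qed.

Lemma monom_scale (K : fieldType) (c : K) (x : nat -> symfun K) s :
  monom (fun n => c *: x n) s = c ^+ size s *: monom x s.
Proof.
elim: s => [|k s IH]; first by rewrite /monom !big_nil scale1r.
by rewrite !monom_cons IH -scalerAl -scalerAr scalerA exprS.
Qed.

(** * Values in zero variables *)

Lemma newton_zero (B : comNzRingType) (P a : nat -> B) : torsion_free B ->
  newton P a -> (forall r, P r.+1 = 0) -> forall n, a n.+1 = 0.
Proof.
move=> tf [_ aP] P0 n; apply: (tf n); rewrite aP big1 // => i _.
by rewrite P0 mul0r.
Qed.

Section ZeroVariables.
Variables (K : fieldType) (q0 : K) (q0_generic : generic q0).

(** The value in zero variables is the constant term. *)
Lemma newton_ev0 (c : nat -> K) (a : nat -> symfun K) n :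
  newton (fun r => c r *: pfun K r) a -> a n.+1 0%N = 0.
Proof.
move=> na; have tf : torsion_free {mpoly K[0]}.
  exact: (torsion_free_alg q0_generic (@mpolyC 0 K)).
apply: (newton_zero tf (newton_map (symfun_ev 0) na)) => r /=.
by rewrite /symfun_ev /= big_ord0 scaler0.
Qed.

Lemma positive_degree_ev0 (g : symfun K) : positive_degree g -> g 0%N = 0.
Proof.
case=> s [sP ->]; rewrite -[LHS]/(symfun_ev 0 _) linear_sum; apply: big1_seq => x /andP[_ xs].
rewrite linearZ /= /symfun_ev; have [d d0 /(_ 0%N) hd] := sP x xs.
rewrite (_ : x.2 0%N = 0) ?scaler0 //; apply/mpolyP => m; rewrite mcoeff0.
apply: (dhomog_nemf_coeff hd); rewrite /= mdegE big_ord0 eq_sym -lt0n.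
exact: d0.
Qed.

End ZeroVariables.

Lemma htilde_ev0 n : (0 < n)%N -> htilde n 0%N = 0.
Proof.
case: n => // n _; rewrite htildeE /=.
by rewrite (newton_ev0 qvar_generic n newton_hrow) scaler0.
Qed.

Lemma htildeF_ev0 n : (0 < n)%N -> htildeF n 0%N = 0.
Proof.
move=> n0; rewrite -[LHS]/(map_mpoly scalar_incl (htilde n 0%N)) htilde_ev0 //.
exact: rmorph0.
Qed.

Lemma monom_ev0 (K : fieldType) (x : nat -> symfun K) s :
  (forall n, (0 < n)%N -> x n 0%N = 0) -> positive s -> s != [::] -> monom x s 0%N = 0.
Proof.
by move=> x0; case: s => // k s /= /andP[k0 _] _; rewrite monom_cons /= x0 // mul0r.
Qed.

Lemma mac_lap_ev0 F : mac_lap F 0%N = 0.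
Proof.
rewrite (mac_lapE (leqnSn _)) -[LHS]/(symfun_ev 0 _) rmorph_sum; apply: big1 => k _.
transitivity (symfun_ev 0 (TF F)`_k.+1 * (- eps^-1 *: omegaF k.+1 0%N)); first by [].
have nw : newton (fun r => -1 *: pfun Qqt r) omegaF.
  by apply: newton_ext (newton_omega qtvar_generic) _ _ => // r; rewrite scaleN1r.
by rewrite (newton_ev0 qtvar_generic k nw) scaler0 mulr0.
Qed.

(** * The derivations D_k *)

Definition row_image (k m : nat) : LambdaQq :=
  (qvar ^+ k - 1)^-1 *: (htilde (m + k) - htilde m * htilde k).

Definition rowD (k : nat) : {linear LambdaQq -> LambdaQq} :=
  free_derivation htilde_free (row_image k).

Lemma rowDM k : is_derivation (rowD k).
Proof. exact: free_derivationM. Qed.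

Lemma rowDE k : row_rule k (rowD k).
Proof. by move=> m; apply: free_derivationE. Qed.

(** The bracket that both second derivatives of h~_m have in common is symmetric in
j and k. *)
Lemma row_image_swap (V : comNzRingType) (hmkj hmj hmk hkj hm hj hk : V) :
  hmkj - hmk * hj - ((hmj - hm * hj) * hk + hm * (hkj - hk * hj)) =
  hmkj - hmj * hk - ((hmk - hm * hk) * hj + hm * (hkj - hj * hk)).
Proof. ring. Qed.

Lemma derivation_row_image (K : fieldType) (D : {linear symfun K -> symfun K})
    (a b : K) (x : nat -> symfun K) (j k m : nat) :
  (forall f g, D (f * g) = D f * g + f * D g) ->
  (forall n, (0 < n)%N -> D (x n) = a *: (x (n + j)%N - x n * x j)) ->
  (0 < k)%N -> (0 < m)%N ->
  D (b *: (x (m + k)%N - x m * x k)) = (b * a) *: (x (m + k + j)%N - x (m + k)%N * x j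
    - ((x (m + j)%N - x m * x j) * x k + x m * (x (k + j)%N - x k * x j))).
Proof.
move=> DM Dx k0 m0; rewrite linearZ linearB /= DM !Dx ?addn_gt0 ?k0 ?m0 //.
by rewrite -scalerAl -scalerAr -scalerDr -scalerBr scalerA.
Qed.

(** The commutator of two derivations is a derivation, so that the generators
suffice. *)
Lemma rowD_comm j k : (0 < j)%N -> (0 < k)%N -> forall f, rowD j (rowD k f) = rowD k (rowD j f).
Proof.
move=> j0 k0; apply: (htilde_free.1 (fun f => rowD j (rowD k f) = rowD k (rowD j f))).
- by rewrite !(derivation1 (rowDM _)) !linear0.
- by move=> c f g ef eg; rewrite !linearP /= ef eg.
move=> m f m0 ef; rewrite !rowDM !linearD /= !rowDM ef.
have -> : rowD j (rowD k (htilde m)) = rowD k (rowD j (htilde m)).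
  rewrite !rowDE // /row_image.
  rewrite (derivation_row_image _ (rowDM j) (@rowDE j)) //.
  rewrite (derivation_row_image _ (rowDM k) (@rowDE k)) //.
  rewrite [(_ - _)^-1 * _]mulrC row_image_swap [(m + k + j)%N]addnAC [(k + j)%N]addnC.
  by [].
by rewrite -!addrA; congr (_ + _); rewrite addrCA.
Qed.

(** * Theta operators at t = 1 *)

Lemma aug_perm_part (s : seq nat) : positive s ->
  aug (pfun Qq) (val (part_of s)) = aug (pfun Qq) s.
Proof. by move=> sp; apply/aug_perm/part_perm. Qed.

Lemma basis_neq0 (K : fieldType) (V : lmodType K) (I : eqType) (b : I -> V) i :
  is_basis b -> b i != 0.
Proof.
move=> bb; apply/eqP => bi; have [_ uni] := bb 0.
have h0 : has_coords b 0 (fun=> 0) by exists [::]; rewrite big_nil.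
have h1 : has_coords b 0 (fun j => (j == i)%:R).
  exists [:: i]; split=> [//|j|]; first by rewrite inE => /negPf->.
  by rewrite big_seq1 bi scaler0.
by have /eqP := uni _ _ h0 h1 i; rewrite eqxx eq_sym oner_eq0.
Qed.

Lemma monom_yA s : monom (fun n => eps *: yA n) s = monom htildeF s.
Proof. by apply: eq_bigr => k _; rewrite /yA scalerA mulfV ?scale1r // eps_neq0. Qed.

Definition lap_eig (ka : intpart) : Qqt := cell_sum qtvar tvar (val ka).
Definition lap_eig0 (ka : intpart) : Qq := qexp qvar (val ka).

Lemma at1_lap_eig ka : at1 (lap_eig ka) (lap_eig0 ka).
Proof. exact: at1_cell_sum. Qed.

Lemma lap_eig0_inj : injective lap_eig0.
Proof. by move=> la mu e; apply: perm_part; apply: qvar_generic e; apply: part_positive. Qed.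

Lemma eig_lap (F : LambdaQqt) (c : Qqt) :
  mac_op qtvar_generic qtvar tvar F = (1 - eps * c) *: F -> mac_lap F = c *: F.
Proof.
move=> e; rewrite /mac_lap e scalerBl scale1r opprB addrC subrK scalerA mulKf //.
exact: eps_neq0.
Qed.

Lemma act_lagrange_aug (S : seq intpart) mu u : positive u -> part_of u \in S -> mu \in S ->
  act (qlapS qvar_generic qvar) (lagrange_at lap_eig0 S mu) (aug (pfun Qq) u) =
  (part_of u == mu)%:R *: aug (pfun Qq) u.
Proof.
move=> up uS muS; have e : qexp qvar u = lap_eig0 (part_of u).
  by rewrite /lap_eig0 /qexp (perm_big _ (part_perm up)).
have := qlapS_aug qvar_generic qvar up; rewrite e.
exact: (@act_lagrange_eigen _ _ lap_eig0_inj S _ mu _ uS muS).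
Qed.

Section Macdonald.
Variable H : intpart -> LambdaQqt.
Hypothesis H_mac : is_modified_Macdonald H.

Lemma Mac_basis : is_basis H. Proof. by case: H_mac. Qed.

Lemma mac_lap_Mac ka : mac_lap (H ka) = lap_eig ka *: H ka.
Proof.
apply: eig_lap; have [_ /(_ ka) [h1 h2 _]] := H_mac.
apply: macdonald_eigen h1 h2; [exact: qtpow_neq0|exact: tpow_neq0|exact: mac_eig_inj].
Qed.

(** The product of the generators h~_(mu_i)/(1 - t) is projected to the eigenline of
H_mu. For the first reduction, [monom_aug] shows that the projection of the product
of power sums is the augmented function of mu; for the second, the product is
an eigenvector already. *)
Lemma eig_ex (mu : intpart) : exists a : Qqt,
  specA (a *: H mu) (sign_prod (val mu) *: aug (pfun Qq) (val mu)) /\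
  specL (eps ^+ size (val mu) *: (a *: H mu)) (monom htilde (val mu)).
Proof.
have mup := part_positive mu; have [L /allP LP LE] := monom_aug mup.
have [S [b [uS TS yE]]] := basis_expand Mac_basis (monom yA (val mu)) (mu :: map part_of L).
have muS : mu \in S by apply: TS; apply: mem_head.
exists (b mu); split.
  have := spec_eigenline mac_lap_Mac at1_lap_eig lap_eig0_inj specA_lap muS uS yE
    (spec_monom yA uA mup).
  congr (spec _ _ _ _); rewrite monom_uA LE linearZ /= linearD linear_sum /=; congr (_ *: _).
  rewrite act_lagrange_aug ?part_of_val ?eqxx ?scale1r //.
  rewrite big1_seq ?addr0 // => s /andP[_ sL]; have /andP[sp ss] := LP s sL.
  rewrite act_lagrange_aug //; last by apply: TS; rewrite inE map_f ?orbT.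
  rewrite (_ : (part_of s == mu) = false) ?scale0r //; apply/negP.
  by rewrite eq_part_of // => /perm_size e; rewrite e ltnn in ss.
have hE : monom htildeF (val mu) =
    \sum_(nu <- S) (eps ^+ size (val mu) * b nu) *: H nu.
  by rewrite -monom_yA monom_scale yE scaler_sumr; apply: eq_bigr => nu _; rewrite scalerA.
have := spec_eigenline mac_lap_Mac at1_lap_eig lap_eig0_inj specL_lap muS uS hE
  (spec_monom htildeF htilde mup).
rewrite scalerA; congr (spec _ _ _ _).
rewrite (act_lagrange_eigen lap_eig0_inj muS muS (qdegree_monom mup)).
by rewrite eqxx scale1r.
Qed.

End Macdonald.

Lemma scaler_swap3 (K : fieldType) (V : lmodType K) (a b c : K) (v : V) :
  a *: (b *: (c *: v)) = (a * c) *: (b *: v).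
Proof. by rewrite !scalerA mulrAC. Qed.

Lemma scaled_aug_neq0 (K : fieldType) (q0 : K) (a : K) s : generic q0 ->
  a != 0 -> positive s -> a *: aug (pfun K) s != 0.
Proof. by move=> gq a0 sp; rewrite scaler_eq0 negb_or a0 (aug_neq0 gq sp). Qed.

Lemma sign_prod_perm s s' : perm_eq s s' -> sign_prod s = sign_prod s'.
Proof. by move=> p; rewrite /sign_prod (row_prod_perm p) (perm_size p). Qed.

Lemma scaler_div (K : fieldType) (V : lmodType K) (a b : K) (v : V) : b != 0 ->
  (a / b) *: (b *: v) = a *: v.
Proof. by move=> b0; rewrite scalerA divfK. Qed.

Lemma scaler_ratio (K : fieldType) (V : lmodType K) (a b c : K) (v : V) :
  (a / b) *: (c *: v) = (a * (c / b)) *: v.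
Proof. by rewrite scalerA mulrAC mulrA. Qed.

Lemma Pi_lim_neq0 s : s != [::] -> Pi_lim s != 0.
Proof.
move=> sn; rewrite /Pi_lim !mulf_neq0 ?row_prod_neq0 ?Qq_char0 ?fact_gt0 //.
by case: s sn => // k s _; rewrite oner_neq0.
Qed.

Section Theta.
Variables (H : intpart -> LambdaQqt) (Pi : {linear LambdaQqt -> LambdaQqt}).
Hypothesis H_mac : is_modified_Macdonald H.
Hypothesis PiH : forall mu : intpart, Pi (H mu) = Pi_coef (val mu) *: H mu.

Definition eig_coef (mu : intpart) : Qqt := sval (cid (eig_ex H_mac mu)).
(** A multiple of H_mu with a nonzero reduction in the larger lattice; after multiplication
by (1 - t)^l, with l the length of mu, it has one in the smaller lattice. *)
Definition eigA (mu : intpart) : LambdaQqt := eig_coef mu *: H mu.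
Definition eigL (mu : intpart) : LambdaQqt := eps ^+ size (val mu) *: eigA mu.

Lemma specA_eig mu : specA (eigA mu) (sign_prod (val mu) *: aug (pfun Qq) (val mu)).
Proof. by rewrite /eigA /eig_coef; case: cid => a []. Qed.

Lemma specL_eig mu : specL (eigL mu) (monom htilde (val mu)).
Proof. by rewrite /eigL /eigA /eig_coef; case: cid => a []. Qed.

Lemma specL_Pi_eig mu : specL (eps *: Pi (eigA mu)) (Pi_lim (val mu) *: monom htilde (val mu)).
Proof.
have -> : eps *: Pi (eigA mu) = (eps * Pi_coef (val mu) / eps ^+ size (val mu)) *: eigL mu.
  rewrite /eigL scalerA divfK ?expf_neq0 ?eps_neq0 // /eigA [Pi _]linearZ PiH.
  exact: scaler_swap3.
exact: spec_scale (at1_Pi (part_positive mu)) (specL_eig mu).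
Qed.

Lemma sign_prod_neq0 s : sign_prod s != 0.
Proof. by rewrite mulf_neq0 ?signr_eq0 ?row_prod_neq0. Qed.

(** The coefficients on the eigenvectors vanish at t = 1, and (1 - t) Pi maps the
eigenvectors into the smaller lattice. *)
Lemma specL_Pi_small X : specA X 0 -> specL (eps *: Pi X) 0.
Proof.
move=> X0; have gnz (ka : intpart) : sign_prod (val ka) *: aug (pfun Qq) (val ka) != 0.
  exact: scaled_aug_neq0 qvar_generic (sign_prod_neq0 _) (part_positive ka).
have [S [d [-> d0]]] := spec_eigen_small (mac_lap_Mac H_mac) at1_lap_eig lap_eig0_inj
  specA_lap yA_free uA_free (Mac_basis H_mac) (fun=> erefl) specA_eig gnz X0.
rewrite linear_sum scaler_sumr.
have -> : 0 = \sum_(ka <- S) 0 *: (Pi_lim (val ka) *: monom htilde (val ka)).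
  by rewrite big1 // => ka _; rewrite scale0r.
apply: spec_sum_seq => ka kS.
have -> : eps *: Pi (d ka *: eigA ka) = d ka *: (eps *: Pi (eigA ka)).
  by rewrite [Pi _]linearZ; apply: scaler_swap.
exact: spec_scale (d0 ka kS) (specL_Pi_eig ka).
Qed.

(** [X] differs from a combination of the eigenvectors by an element that reduces
to 0, and Pi is known on eigenvectors. *)
Lemma specL_Pi_aug (a : seq nat -> Qq) (L : seq (seq nat)) X : all positive L ->
  specA X (\sum_(u <- L) a u *: aug (pfun Qq) u) ->
  specL (eps *: Pi X) (\sum_(u <- L) (a u * (Pi_lim u / sign_prod u)) *: monom htilde u).
Proof.
move=> /allP Lp XL.
(* The combination of eigenvectors with the reduction of X. *)
pose Y := \sum_(u <- L) scalar_incl (a u / sign_prod u) *: eigA (part_of u).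
have YL : specA Y (\sum_(u <- L) a u *: aug (pfun Qq) u).
  apply: spec_sum_seq => u /Lp up.
  have := spec_scale (at1_incl (a u / sign_prod u)) (specA_eig (part_of u)).
  congr (spec _ _ _ _); rewrite (sign_prod_perm (part_perm up)) (aug_perm_part up).
  exact: scaler_div (sign_prod_neq0 u).
have XY : specA (X - Y) 0 by have := spec_sub XL YL; rewrite subrr.
have -> : eps *: Pi X = eps *: Pi (X - Y) + eps *: Pi Y.
  by rewrite -scalerDr -linearD /= subrK.
rewrite -[X in specL _ X]add0r; apply: spec_add (specL_Pi_small XY) _.
rewrite linear_sum scaler_sumr; apply: spec_sum_seq => u /Lp up.
have -> : eps *: Pi (scalar_incl (a u / sign_prod u) *: eigA (part_of u)) =
   scalar_incl (a u / sign_prod u) *: (eps *: Pi (eigA (part_of u))).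
  by rewrite [Pi _]linearZ; apply: scaler_swap.
have := spec_scale (at1_incl (a u / sign_prod u)) (specL_Pi_eig (part_of u)).
congr (spec _ _ _ _); rewrite (Pi_lim_perm (part_perm up)) (monom_perm _ (part_perm up)).
exact: scaler_ratio.
Qed.

Lemma Pi_coef_neq0 (ka : intpart) : val ka != [::] -> Pi_coef (val ka) != 0.
Proof.
move=> /Pi_lim_neq0 lim.
apply: contraNneq (lim) => P0; apply/eqP/(at1_unique (at1_Pi (part_positive ka))).
by rewrite P0 mulr0 mul0r; apply: at1_0.
Qed.
End Theta.

(** The scalar by which (1 - t) Pi carries augmented functions with [n] parts to products of
row functions. *)
Definition pi_ratio (n : nat) : Qq := (-1) ^+ n * ((0 < n)%:R * (n.-1)`!%:R).

Lemma ratio_split (K : fieldType) (m e r : K) : r != 0 -> e * e = 1 -> m * r / (e * r) = e * m.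
Proof.
move=> r0 ee; have e0 : e != 0 by apply: contra_eq_neq ee => ->; rewrite mulr0 eq_sym oner_eq0.
by rewrite -mulf_div divff // mulr1 -[e^-1]mul1r -ee mulfK // mulrC.
Qed.

Lemma Pi_ratio s : Pi_lim s / sign_prod s = pi_ratio (size s).
Proof.
apply: ratio_split (row_prod_neq0 s) _.
by rewrite -exprD addnn -mul2n exprM sqrrN expr1n expr1n.
Qed.

Lemma pi_ratioS n : pi_ratio n.+2 = - n.+1%:R * pi_ratio n.+1.
Proof. by rewrite /pi_ratio !mul1r /= factS natrM exprS; ring. Qed.

Lemma scaled_mul_aug (K : fieldType) (a b : K) k s :
  (a *: pfun K k) * (b *: aug (pfun K) s) =
  \sum_(u <- (k :: s) :: bumps k s) (a * b) *: aug (pfun K) u.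
Proof.
by rewrite big_cons -scaler_sumr -scalerDr -mul_aug -scalerAl -scalerAr scalerA.
Qed.

(** The scalars that Pi, at t = 1, puts on the terms of p_k m~_s: a term with one
more part gets a further factor - l from the two factorials, with l the
length of s. *)
Lemma theta_bumps (K : fieldType) (M : lmodType K) (x : seq nat -> M) (r : nat -> K)
    (P sg c : K) k s :
  P = r (size s) * sg -> P != 0 -> r (size s).+1 = - (size s)%:R * r (size s) ->
  P^-1 *: (\sum_(u <- (k :: s) :: bumps k s) (- c^-1 * sg * r (size u)) *: x u) =
  (- c)^-1 *: (\sum_(u <- bumps k s) x u - x (k :: s) *+ size s).
Proof.
move=> PE P0 rS; rewrite big_cons /= rS scalerDr scalerA scaler_sumr.
have Pr : P^-1 * (r (size s) * sg) = 1 by rewrite -PE mulVf.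
rewrite scalerBr -scaler_nat scalerA addrC scaler_sumr; congr (_ + _).
  apply: eq_big_seq => u /size_bumps us; rewrite us scalerA; congr (_ *: _).
  by rewrite invrN -mulrA [sg * _]mulrC mulrCA Pr mulr1.
rewrite -scaleNr; congr (_ *: _).
rewrite [RHS](_ : _ = - (- c)^-1 * (size s)%:R * (P^-1 * (r (size s) * sg))).
  by rewrite invrN; ring.
by rewrite Pr mulr1 mulNr.
Qed.

Lemma conjugate_eigen (K : fieldType) (V : algType K) (f g : {linear V -> V})
    (S v : V) (e P d : K) : cancel f g -> e != 0 -> P != 0 -> f v = P *: v ->
  f (S * g (d *: v)) = (e * P / d)^-1 *: (e *: f (S * v)).
Proof.
move=> fK e0 P0 fv; have gv : g v = P^-1 *: v.
  by rewrite -[X in g X](scalerK P0) -fv linearZ /= fK.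
rewrite linearZ /= gv -!scalerAr !linearZ /= !scalerA; congr (_ *: _).
by rewrite !invfM invrK !mulrA mulfV // mul1r mulrC.
Qed.

Section ThetaOperator.
Variables (H : intpart -> LambdaQqt) (Pi Pi_inv : {linear LambdaQqt -> LambdaQqt}).
Hypothesis H_mac : is_modified_Macdonald H.
Hypothesis PiH : forall mu : intpart, Pi (H mu) = Pi_coef (val mu) *: H mu.
Hypothesis PiK : cancel Pi Pi_inv.

Lemma Pi_eig (ka : intpart) : Pi (eigA H_mac ka) = Pi_coef (val ka) *: eigA H_mac ka.
Proof. by rewrite /eigA [Pi _]linearZ PiH; apply: scaler_swap. Qed.

Lemma Theta_eig_eq f (ka : intpart) : val ka != [::] ->
  Theta Pi Pi_inv f (eigL H_mac ka) =
  (eps * Pi_coef (val ka) / eps ^+ size (val ka))^-1 *: (eps *: Pi (star f * eigA H_mac ka)).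
Proof.
move=> kan; exact: conjugate_eigen PiK eps_neq0 (Pi_coef_neq0 kan) (Pi_eig ka).
Qed.

(** On an eigenvector Theta is the multiplication of the augmented function by p_k,
up to scalars: p_k[X/M] reduces to a multiple of p_k, and Pi to the map between augmented
functions and products of row functions. *)
Lemma specL_Theta_eig k (ka : intpart) : (0 < k)%N -> val ka != [::] ->
  specL (Theta Pi Pi_inv (pfun Qqt k) (eigL H_mac ka)) (rowD k (monom htilde (val ka))).
Proof.
move=> k0 kan; set s := val ka; have sp : positive s := part_positive ka.
have L0 : Pi_lim s != 0 by apply: Pi_lim_neq0.
have Lp : all positive ((k :: s) :: bumps k s).
  by rewrite /= k0 sp; apply/allP => u; apply: bumps_positive.
have step : specA (star (pfun Qqt k) * eigA H_mac ka)
    (\sum_(u <- (k :: s) :: bumps k s) (- (1 - qvar ^+ k)^-1 * sign_prod s) *: aug (pfun Qq) u).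
  by rewrite -scaled_mul_aug; apply: spec_mul (specA_star k0) (specA_eig H_mac ka).
have := specL_Pi_aug H_mac PiH Lp step.
rewrite Theta_eig_eq // => /(spec_scale (at1V L0 (at1_Pi sp))).
congr (spec _ _ _ _).
rewrite (bump_derivation_monom (k := k) (c := (qvar ^+ k - 1)^-1) (rowDM k)); last first.
  by move=> m /(allP sp); apply: rowDE.
under eq_bigr => u _ do rewrite Pi_ratio.
rewrite -[qvar ^+ k - 1]opprB; apply: theta_bumps => //.
  by rewrite -Pi_ratio divfK ?sign_prod_neq0.
by move: kan; rewrite -/s; case: (s) => // m s' _; apply: pi_ratioS.
Qed.

End ThetaOperator.

(** If only the member indexed by the empty partition has a constant term, the
members with this index cancel. *)
Lemma no_constant_term (K : fieldType) (x : intpart -> symfun K) (S : seq intpart)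
    (c : intpart -> K) :
  (forall ka, val ka != [::] -> x ka 0%N = 0) -> x (row_part 0) 0%N != 0 ->
  (\sum_(ka <- S) c ka *: x ka) 0%N = 0 ->
  \sum_(ka <- S) c ka *: x ka = \sum_(ka <- S | val ka != [::]) c ka *: x ka.
Proof.
move=> x0 xe; rewrite (bigID (fun ka : intpart => val ka != [::])) /=.
set Y := \sum_(ka <- S | val ka != [::]) _.
set Z := \sum_(ka <- S | ~~ (val ka != [::])) _ => XZ.
suff Z0 : Z = 0 by rewrite Z0 addr0.
have Y0 : Y 0%N = 0.
  rewrite -[LHS]/(symfun_ev 0 Y) linear_sum big1 // => ka kan.
  by rewrite linearZ /= /symfun_ev x0 ?scaler0.
have ZE : Z = (\sum_(ka <- S | ~~ (val ka != [::])) c ka) *: x (row_part 0).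
  rewrite scaler_suml; apply: eq_bigr => ka; rewrite negbK => /eqP kae.
  by congr (_ *: x _); apply: val_inj.
have : Z 0%N = 0 by apply: etrans XZ; rewrite -[RHS]/(Y 0%N + Z 0%N) Y0 add0r.
rewrite ZE => /eqP; rewrite -[X in X == _]/(_ *: x (row_part 0) 0%N) scaler_eq0 (negPf xe) orbF.
by move=> /eqP->; rewrite scale0r.
Qed.

Lemma scaled_ev0_eq0 (K : fieldType) (c : K) (f : symfun K) :
  c != 0 -> (c *: f) 0%N = 0 -> f 0%N = 0.
Proof.
move=> c0 /eqP; rewrite -[X in X == _]/(c *: f 0%N).
by rewrite scaler_eq0 (negPf c0) => /eqP.
Qed.

Lemma ev0_scaled (K : fieldType) (c : K) (f : symfun K) :
  f 0%N = 0 -> (c *: f) 0%N = 0.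
Proof. by move=> f0; rewrite -[LHS]/(c *: f 0%N) f0 scaler0. Qed.

Section MacdonaldValues.
Variable H : intpart -> LambdaQqt.
Hypothesis H_mac : is_modified_Macdonald H.

Lemma lap_eig_neq0 (ka : intpart) : val ka != [::] -> lap_eig ka != 0.
Proof.
move=> kan; apply: contraNneq kan => e0.
have := at1_lap_eig ka; rewrite e0 => /(at1_unique at1_0) /esym e.
have : perm_eq (val ka) [::].
  apply: qvar_generic => //; first exact: part_positive.
  by rewrite -/(lap_eig0 ka) e /qexp big_nil.
by move=> /perm_size/size0nil->.
Qed.

(** [mac_lap] kills constant terms, whereas the eigenvalue of H_mu is not 0. *)
Lemma Mac_ev0 (ka : intpart) : val ka != [::] -> H ka 0%N = 0.
Proof.
move=> kan; apply: scaled_ev0_eq0 (lap_eig_neq0 kan) _.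
by rewrite -(mac_lap_Mac H_mac) mac_lap_ev0.
Qed.

(** Otherwise no element of the span of the basis would have a constant term. *)
Lemma Mac_empty_ev0 : H (row_part 0) 0%N != 0.
Proof.
apply/eqP => H0; have [[c [s [_ _ e]]] _] := Mac_basis H_mac 1.
have /eqP := congr1 (symfun_ev 0) e; rewrite rmorph1 linear_sum big1 ?oner_eq0 // => ka _.
rewrite linearZ /= /symfun_ev; case: (eqVneq (val ka) [::]) => [kae|kan].
  by have -> : ka = row_part 0 by [apply: val_inj]; rewrite H0 scaler0.
by rewrite Mac_ev0 ?scaler0.
Qed.

Lemma eigL_ev0 (ka : intpart) : val ka != [::] -> eigL H_mac ka 0%N = 0.
Proof.
move=> kan; exact/ev0_scaled/ev0_scaled/Mac_ev0.
Qed.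

End MacdonaldValues.

Section ConjugateMul.
Variables (K : fieldType) (f g : {linear symfun K -> symfun K}) (S : symfun K).

Definition conjugate_mul (v : symfun K) : symfun K := f (S * g v).

Fact conjugate_mul_linear : linear conjugate_mul.
Proof. by move=> a u v; rewrite /conjugate_mul linearP mulrDr -scalerAr linearP. Qed.

HB.instance Definition _ :=
  GRing.isLinear.Build K (symfun K) (symfun K) *:%R conjugate_mul conjugate_mul_linear.

End ConjugateMul.

Section ThetaLimit.
Variables (H : intpart -> LambdaQqt) (Pi Pi_inv : {linear LambdaQqt -> LambdaQqt}).
Hypothesis H_mac : is_modified_Macdonald H.
Hypothesis PiH : forall mu : intpart, Pi (H mu) = Pi_coef (val mu) *: H mu.
Hypothesis PiK : cancel Pi Pi_inv.

(** The expansion in eigenvectors has coefficients vanishing at t = 1, and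
Theta is under control on eigenvectors other than the empty one, which does not
occur. *)
Lemma specL_Theta_small k (X : LambdaQqt) : (0 < k)%N -> X 0%N = 0 -> specL X 0 ->
  specL (Theta Pi Pi_inv (pfun Qqt k) X) 0.
Proof.
move=> k0 X0 XL.
have gnz (ka : intpart) : monom htilde (val ka) != 0.
  exact: (basis_neq0 ka (monom_basis htilde_free)).
have etaE ka : eigL H_mac ka = (eps ^+ size (val ka) * eig_coef H_mac ka) *: H ka.
  by rewrite /eigL /eigA scalerA.
have [S [d [XE d0]]] := spec_eigen_small (mac_lap_Mac H_mac) at1_lap_eig lap_eig0_inj
  specL_lap htildeF_free htilde_free (Mac_basis H_mac) etaE (specL_eig H_mac) gnz XL.
have {XE} XE : X = \sum_(ka <- S) (d ka * (eps ^+ size (val ka) * eig_coef H_mac ka)) *: H ka.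
  by rewrite XE; apply: eq_bigr => ka _; rewrite etaE scalerA.
rewrite XE in X0; rewrite (no_constant_term (Mac_ev0 H_mac) (Mac_empty_ev0 H_mac) X0) in XE.
pose T : {linear LambdaQqt -> LambdaQqt} := conjugate_mul Pi Pi_inv (star (pfun Qqt k)).
rewrite (_ : Theta _ _ _ X = T X) // XE linear_sum.
have -> : 0 = \sum_(ka <- S | val ka != [::]) 0 *: rowD k (monom htilde (val ka)).
  by rewrite big1 // => ka _; rewrite scale0r.
rewrite big_seq_cond [X in specL _ X]big_seq_cond; apply: spec_sum => ka /andP[kS kan].
rewrite -scalerA -etaE linearZ /=.
exact: spec_scale (d0 ka kS) (specL_Theta_eig H_mac PiH PiK k0 kan).
Qed.

(** h~_mu differs from the eigenvector attached to mu by an element that reduces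
to 0. *)
Lemma specL_Theta_monom k (ka : intpart) : (0 < k)%N -> val ka != [::] ->
  specL (Theta Pi Pi_inv (pfun Qqt k) (monom htildeF (val ka))) (rowD k (monom htilde (val ka))).
Proof.
move=> k0 kan; pose T : {linear LambdaQqt -> LambdaQqt} := conjugate_mul Pi Pi_inv (star (pfun Qqt k)).
have -> : Theta Pi Pi_inv (pfun Qqt k) (monom htildeF (val ka)) =
    T (eigL H_mac ka) + T (monom htildeF (val ka) - eigL H_mac ka).
  by rewrite -linearD addrC subrK.
rewrite -[X in specL _ X]addr0; apply: spec_add.
  exact: specL_Theta_eig.
apply: specL_Theta_small => //.
  rewrite -[LHS]/(monom htildeF (val ka) 0%N - eigL H_mac ka 0%N).
  by rewrite eigL_ev0 // (monom_ev0 htildeF_ev0) ?part_positive ?subr0.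
rewrite -(subrr (monom htilde (val ka))).
by apply: spec_sub (specL_eig H_mac ka); apply: spec_monom; apply: part_positive.
Qed.

Lemma Lambda_incl_monom s : Lambda_incl (monom htilde s) = monom htildeF s.
Proof. exact: (monom_map (symfun_map scalar_incl)). Qed.

Lemma specL_Theta k g : (0 < k)%N -> positive_degree g ->
  specL (Theta Pi Pi_inv (pfun Qqt k) (Lambda_incl g)) (rowD k g).
Proof.
move=> k0 /positive_degree_ev0 g0; have [c [S [_ _ gE]]] := has_coords_ex htilde_free g.
rewrite gE in g0; have xe : monom htilde (val (row_part 0)) 0%N != 0.
  by rewrite /monom big_nil oner_neq0.
have xn (ka : intpart) : val ka != [::] -> monom htilde (val ka) 0%N = 0.
  by move=> kan; apply: (monom_ev0 htilde_ev0) kan; apply: part_positive.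
rewrite (no_constant_term xn xe g0) in gE.
pose T : {linear LambdaQqt -> LambdaQqt} := conjugate_mul Pi Pi_inv (star (pfun Qqt k)).
have -> : Lambda_incl g = \sum_(ka <- S | val ka != [::])
    scalar_incl (c ka) *: monom htildeF (val ka).
  rewrite gE /Lambda_incl raddf_sum; apply: eq_bigr => ka _.
  by rewrite -Lambda_incl_monom; apply: symfun_mapZ.
rewrite (_ : Theta _ _ _ _ = T (\sum_(ka <- S | val ka != [::])
    scalar_incl (c ka) *: monom htildeF (val ka))) // gE !linear_sum.
apply: spec_sum => ka kan.
rewrite linearZ [X in specL _ X]linearZ.
exact: spec_scale (at1_incl _) (specL_Theta_monom k0 kan).
Qed.

End ThetaLimit.

Lemma specL_specializes F G : specL F G -> specializes_at_t1 F G.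
Proof.
move=> FG; have [c cF] := has_coords_ex htildeF_free F.
have [v vG] := has_coords_ex htilde_free G.
exists intpart, (fun la : intpart => monom htilde (val la)), c, v; split=> //.
- exact: monom_basis htilde_free.
- by case: cF => S [uS S0 ->]; exists S; split=> //; apply: eq_bigr => la _; rewrite Lambda_incl_monom.
move=> la; rewrite (has_coordsE htildeF_free cF) (has_coordsE htilde_free vG).
exact: spec_coordp.
Qed.

Theorem theorem1p2 :
  exists D : nat -> {linear LambdaQq -> LambdaQq},
  [/\ forall k, (0 < k)%N ->
        [/\ is_derivation (D k), row_rule k (D k)
          & forall E : {linear LambdaQq -> LambdaQq},
              is_derivation E -> row_rule k E -> E =1 D k],
      forall (H : intpart -> LambdaQqt)
             (Pi Pi_inv : {linear LambdaQqt -> LambdaQqt}),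
        is_modified_Macdonald H ->
        (forall mu : intpart, Pi (H mu) = Pi_coef (val mu) *: H mu) ->
        cancel Pi Pi_inv -> cancel Pi_inv Pi ->
        forall (k : nat) (g : LambdaQq), (0 < k)%N -> positive_degree g ->
          specializes_at_t1 (Theta Pi Pi_inv (pfun Qqt k) (Lambda_incl g)) (D k g)
    & forall j k, (0 < j)%N -> (0 < k)%N ->
        forall f : LambdaQq, D j (D k f) = D k (D j f)].
Proof.
exists rowD; split=> [k k0|H Pi Pi_inv H_mac PiH PiK _ k g k0 g0|]; last exact: rowD_comm.
  split; [exact: rowDM|exact: rowDE|move=> E EM Ek].
  by apply: (derivation_uniq htilde_free EM (rowDM k)) => m m0; rewrite Ek // rowDE.
exact: specL_specializes (specL_Theta H_mac PiH PiK k0 g0).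
Qed.
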